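(* Let $a,b$ be positive integers with $\gcd(a,b)=1$ such that the multiplicative group $(\mathbb{Z}/(a^2+b^2)\mathbb{Z})^{\times}$ of units of the ring $\mathbb{Z}/(a^2+b^2)\mathbb{Z}$ is cyclic. Let $C\ge 3$ be an integer. Then there is a constant $N=N(a,b,C)$ such that for every integer $n\ge N$ with $\operatorname{ord}_2(n)\le C$, there exist $x,y,z,w\in\mathbb{N}=\{0,1,2,\dots\}$ such that $$x^2+y^2+z^2+w^2=n \quad\text{and}\quad ax+by\in\mathcal{S}.$$
   Context: $\mathcal{S}=\{x^2: x\in\mathbb{Z}\}$ denotes the set of integer squares. $\operatorname{ord}_2(n)$ denotes the exponent of $2$ in the prime factorization of the positive integer $n$. *)

(* Defs.v *)
From mathcomp Require Import all_boot all_order all_algebra all_fingroup all_solvable.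

Definition is_square (n : nat) : Prop := exists k : nat, n = (k ^ 2)%N.

(* Main.v *)
(* Put d = a^2 + b^2.  Cyclicity forces d = 2, d = p^k or d = 2 p^k with p odd.
   If d n = m^4 + R, R = T^2 + Z^2 + W^2 with d | R - T^2 and |T| small against m^2,
   then, for a suitable sign of T, x = (a m^2 + b T) / d and y = (b m^2 - a T) / d are
   natural numbers with a x + b y = m^2, and n - x^2 - y^2 = (Z^2 + W^2) / d is a sum of
   two squares.  So one needs m slightly below (d n)^(1/4) for which R = d n - m^4 has a
   representation by three squares with a prescribed residue of T^2 mod p^k.

   Write R = c^2 r with r squarefree.  Such a representation of r is found by Linnik's
   ergodic argument.  Representations of r are pure quaternions of norm r.  As -r is a
   square mod p, a representation A determines a walk, whose J-th position is fixed by
   the left ideal generated by p^(kJ) and A + u, where u^2 = -r mod p^(kJ); two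
   representations with the same walk are related by a quaternion of norm p^(kJ), and
   such pairs are few.  If no step of the walk meets the prescribed residue, one of the
   p^k lines available at every step is forbidden, so that there are at most
   (p^k - 1)^J walks.  With p^(2kJ) about r this bounds the number of representations
   by a power of r with exponent smaller than 1/2.

   On the other hand r has many representations as soon as -r is a square modulo many
   small primes q: each product of K such primes yields a representation, and these are
   distinct when the products are smaller than r^(1/2).  That m can be chosen so that
   q splits for a positive proportion of the primes q follows by averaging over m from a
   second moment estimate for the curves y^2 = m^4 - c over F_q; bounding the number of
   points of the conics x^2 + r y^2 = d n excludes small r.  One representation of r to
   start with is Legendre's three squares theorem. *)

Require Import Defs.
From HB Require Import structures.
From mathcomp Require Import all_boot all_order all_algebra all_fingroup all_solvable.
From mathcomp Require Import all_field realalg.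
From mathcomp Require Import zify ring lra.
From Stdlib Require Import Classical_Prop.
Set Implicit Arguments.
Unset Strict Implicit.
Unset Printing Implicit Defensive.
Import Order.TTheory GRing.Theory Num.Theory.

(** * Integral quaternions *)

Section QuatDef.
Local Open Scope ring_scope.

(** One representation in the right residue class is enough, so no equidistribution is proved: only
    that avoiding the class would leave too few representations. Forbidding one of P = p^k lines
    saves the constant factor (P - 1) / P at each of about log r steps, hence a power of r. All
    other losses must stay below it: sizes are measured by X, about n^(1/E) with E = 224 P^2, and
    the total loss is X^7.

    Cyclicity matters because d divides the product of a m^2 + b T and a m^2 - b T, whose sum is
    prime to p: a single odd prime power must divide one factor, and a sign of T decides which. As p
    divides a^2 + b^2, - 1 is a square modulo p, so quaternions become matrices there; as p divides
    d, - r is a square modulo p too. The bound on the exponent of 2 in n limits the modulus of the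
    progression in which m must lie to keep r away from 7 modulo 8.

    In the order of quaternions with integer coordinates a left ideal need not be principal unless
    it contains an odd integer. Hence the care for parity: odd norms throughout, and rotations by 1
    + i, 1 + j, 1 + k to strip even factors. *)

Record quat := Quat { qre : int; qi : int; qj : int; qk : int }.

Definition quat_enc (x : quat) := (qre x, qi x, qj x, qk x).
Definition quat_dec (t : int * int * int * int) :=
  let: (a, b, c, d) := t in Quat a b c d.
Lemma quat_encK : cancel quat_enc quat_dec. Proof. by case. Qed.
HB.instance Definition _ := Choice.copy quat (can_type quat_encK).

Lemma quat_eq (x y : quat) :
  qre x = qre y -> qi x = qi y -> qj x = qj y -> qk x = qk y -> x = y.
Proof. by case: x y => [a b c d] [a' b' c' d'] /= -> -> -> ->. Qed.

Definition qadd x y :=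
  Quat (qre x + qre y) (qi x + qi y) (qj x + qj y) (qk x + qk y).
Definition qopp x := Quat (- qre x) (- qi x) (- qj x) (- qk x).
Definition qzero := Quat 0 0 0 0.
Definition qone := Quat 1 0 0 0.
Definition qmul x y := Quat
  (qre x * qre y - qi x * qi y - qj x * qj y - qk x * qk y)
  (qre x * qi y + qi x * qre y + qj x * qk y - qk x * qj y)
  (qre x * qj y - qi x * qk y + qj x * qre y + qk x * qi y)
  (qre x * qk y + qi x * qj y - qj x * qi y + qk x * qre y).

Fact qaddA : associative qadd.
Proof. by move=> x y z; apply: quat_eq => /=; ring. Qed.
Fact qaddC : commutative qadd.
Proof. by move=> x y; apply: quat_eq => /=; ring. Qed.
Fact qadd0 : left_id qzero qadd.
Proof. by move=> x; apply: quat_eq => /=; ring. Qed.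
Fact qaddN : left_inverse qzero qopp qadd.
Proof. by move=> x; apply: quat_eq => /=; ring. Qed.
Fact qmulA : associative qmul.
Proof. by move=> x y z; apply: quat_eq => /=; ring. Qed.
Fact qmul1 : left_id qone qmul.
Proof. by move=> x; apply: quat_eq => /=; ring. Qed.
Fact qmulr1 : right_id qone qmul.
Proof. by move=> x; apply: quat_eq => /=; ring. Qed.
Fact qmulDl : left_distributive qmul qadd.
Proof. by move=> x y z; apply: quat_eq => /=; ring. Qed.
Fact qmulDr : right_distributive qmul qadd.
Proof. by move=> x y z; apply: quat_eq => /=; ring. Qed.
Fact qone_neq0 : qone != qzero. Proof. by []. Qed.

HB.instance Definition _ := GRing.isZmodule.Build quat qaddA qaddC qadd0 qaddN.
HB.instance Definition _ :=
  GRing.Zmodule_isNzRing.Build quat qmulA qmul1 qmulr1 qmulDl qmulDr qone_neq0.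

Lemma qreD x y : qre (x + y) = qre x + qre y. Proof. by []. Qed.
Lemma qiD x y : qi (x + y) = qi x + qi y. Proof. by []. Qed.
Lemma qjD x y : qj (x + y) = qj x + qj y. Proof. by []. Qed.
Lemma qkD x y : qk (x + y) = qk x + qk y. Proof. by []. Qed.
Lemma qreN x : qre (- x) = - qre x. Proof. by []. Qed.
Lemma qiN x : qi (- x) = - qi x. Proof. by []. Qed.
Lemma qjN x : qj (- x) = - qj x. Proof. by []. Qed.
Lemma qkN x : qk (- x) = - qk x. Proof. by []. Qed.
Lemma qreM x y : qre (x * y) =
  qre x * qre y - qi x * qi y - qj x * qj y - qk x * qk y. Proof. by []. Qed.
Lemma qiM x y : qi (x * y) =
  qre x * qi y + qi x * qre y + qj x * qk y - qk x * qj y. Proof. by []. Qed.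
Lemma qjM x y : qj (x * y) =
  qre x * qj y - qi x * qk y + qj x * qre y + qk x * qi y. Proof. by []. Qed.
Lemma qkM x y : qk (x * y) =
  qre x * qk y + qi x * qj y - qj x * qi y + qk x * qre y. Proof. by []. Qed.

Definition qE := (qreD, qiD, qjD, qkD, qreN, qiN, qjN, qkN, qreM, qiM, qjM, qkM).

Definition qconj x := Quat (qre x) (- qi x) (- qj x) (- qk x).
Definition qnorm x := qre x ^+ 2 + qi x ^+ 2 + qj x ^+ 2 + qk x ^+ 2.
Definition qz (n : int) := Quat n 0 0 0.

End QuatDef.

Ltac qring := apply: quat_eq; rewrite ?qE /qconj /qz /qnorm /=; ring.

Section QuatTheory.
Local Open Scope ring_scope.
Implicit Types (x y z u v w : quat) (m n f : int).

Lemma qconjM x y : qconj (x * y) = qconj y * qconj x. Proof. by qring. Qed.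
Lemma qconjK x : qconj (qconj x) = x. Proof. by qring. Qed.
Lemma qconj_qz n : qconj (qz n) = qz n. Proof. by qring. Qed.
Lemma qmul_conj x : x * qconj x = qz (qnorm x). Proof. by qring. Qed.
Lemma qconj_mul x : qconj x * x = qz (qnorm x). Proof. by qring. Qed.
Lemma qzC n x : x * qz n = qz n * x. Proof. by qring. Qed.
Lemma qzM m n : qz (m * n) = qz m * qz n. Proof. by qring. Qed.
Lemma qzD m n : qz (m + n) = qz m + qz n. Proof. by qring. Qed.
Lemma qzN n : qz (- n) = - qz n. Proof. by qring. Qed.
Lemma qz_inj : injective qz. Proof. by move=> m n []. Qed.
Lemma qnormM x y : qnorm (x * y) = qnorm x * qnorm y.
Proof. by rewrite /qnorm !qE; ring. Qed.
Lemma qnorm_conj x : qnorm (qconj x) = qnorm x.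
Proof. by rewrite /qnorm /=; ring. Qed.
Lemma qnorm_qz n : qnorm (qz n) = n ^+ 2.
Proof. by rewrite /qnorm /=; ring. Qed.
Lemma qnorm_ge0 x : 0 <= qnorm x.
Proof. by rewrite /qnorm !addr_ge0 ?sqr_ge0. Qed.
Lemma qnorm_eq0 x : qnorm x = 0 -> x = 0.
Proof.
rewrite /qnorm => h; have := (sqr_ge0 (qre x), sqr_ge0 (qi x), sqr_ge0 (qj x), sqr_ge0 (qk x)).
case=> [[[h0 h1] h2] h3].
have H t : t ^+ 2 = 0 -> t = 0 :> int by move/eqP; rewrite sqrf_eq0 => /eqP.
by apply: quat_eq; apply: H => /=; lra.
Qed.
Lemma qnorm_gt0 x : x != 0 -> 0 < qnorm x.
Proof.
move=> x0; rewrite lt_def qnorm_ge0 andbT; apply: contra_neq x0; exact: qnorm_eq0.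
Qed.
Lemma qz_mulE n x : qz n * x = Quat (n * qre x) (n * qi x) (n * qj x) (n * qk x).
Proof. by qring. Qed.
Lemma qz_mulI n x y : n != 0 -> qz n * x = qz n * y -> x = y.
Proof.
move=> n0; rewrite !qz_mulE => -[] /(mulfI n0) h0 /(mulfI n0) h1 /(mulfI n0) h2 /(mulfI n0) h3.
exact: quat_eq.
Qed.

Lemma qmul_eq0 x y : x * y = 0 -> x = 0 \/ y = 0.
Proof.
move=> h; have : qnorm x * qnorm y = 0 by rewrite -qnormM h.
by move/eqP; rewrite mulf_eq0 => /orP[] /eqP /qnorm_eq0; [left|right].
Qed.
Lemma qmulIr y x x' : y != 0 -> x * y = x' * y -> x = x'.
Proof.
move=> y0 /eqP; rewrite -subr_eq0 -mulrBl => /eqP /qmul_eq0 [/eqP|/eqP].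
  by rewrite subr_eq0 => /eqP.
by rewrite (negPf y0).
Qed.
Lemma qmulIl y x x' : y != 0 -> y * x = y * x' -> x = x'.
Proof.
move=> y0 /eqP; rewrite -subr_eq0 -mulrBr => /eqP /qmul_eq0 [/eqP|/eqP].
  by rewrite (negPf y0).
by rewrite subr_eq0 => /eqP.
Qed.

Definition qdvd n x := exists y, x = qz n * y.

Lemma qdvdP n x : qdvd n x <->
  [/\ (n %| qre x)%Z, (n %| qi x)%Z, (n %| qj x)%Z & (n %| qk x)%Z].
Proof.
split=> [[y ->]|[/dvdzP[a ha] /dvdzP[b hb] /dvdzP[c hc] /dvdzP[d hd]]].
  by rewrite qz_mulE /= !dvdz_mulr.
by exists (Quat a b c d); rewrite qz_mulE; apply: quat_eq => /=; rewrite mulrC.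
Qed.
Lemma qdvdD n x y : qdvd n x -> qdvd n y -> qdvd n (x + y).
Proof. by move=> [u ->] [v ->]; exists (u + v); rewrite mulrDr. Qed.
Lemma qdvdN n x : qdvd n x -> qdvd n (- x).
Proof. by move=> [u ->]; exists (- u); rewrite mulrN. Qed.
Lemma qdvdB n x y : qdvd n x -> qdvd n y -> qdvd n (x - y).
Proof. by move=> hx hy; apply: qdvdD => //; apply: qdvdN. Qed.
Lemma qdvdMl n x y : qdvd n x -> qdvd n (y * x).
Proof. by move=> [u ->]; exists (y * u); rewrite mulrA qzC mulrA. Qed.
Lemma qdvdMr n x y : qdvd n x -> qdvd n (x * y).
Proof. by move=> [u ->]; exists (u * y); rewrite mulrA. Qed.
Lemma qdvd_qz n m : (n %| m)%Z -> qdvd n (qz m).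
Proof. by move=> /dvdzP[k ->]; exists (qz k); rewrite qzM qzC. Qed.
Lemma qdvd_conj n x : qdvd n x -> qdvd n (qconj x).
Proof. by move=> [u ->]; exists (qconj u); rewrite qconjM qconj_qz qzC. Qed.

Definition parz (n : int) : bool := odd `|n|%N.
Lemma parzD m n : parz (m + n) = parz m (+) parz n.
Proof. rewrite /parz; lia. Qed.
Lemma parzN n : parz (- n) = parz n. Proof. by rewrite /parz abszN. Qed.
Lemma parzM m n : parz (m * n) = parz m && parz n.
Proof. by rewrite /parz abszM oddM. Qed.
Lemma parzX n : parz (n ^+ 2) = parz n.
Proof. by rewrite expr2 parzM andbb. Qed.
Lemma parz_dvd n : ~~ parz n = (2 %| n)%Z.
Proof. by rewrite /parz dvdzE dvdn2. Qed.

Lemma parz_norm x :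
  parz (qnorm x) = parz (qre x) (+) parz (qi x) (+) parz (qj x) (+) parz (qk x).
Proof. by rewrite /qnorm !parzD !parzX. Qed.
(** Since t^2 = t modulo 2, the norm modulo 2 is the sum of the coordinates, hence additive. So a
    remainder of even norm can be repaired by changing the quotient. *)
Lemma parz_normD x y : parz (qnorm (x + y)) = parz (qnorm x) (+) parz (qnorm y).
Proof.
rewrite !parz_norm !qE !parzD.
by case: (parz (qre x)) (parz (qi x)) (parz (qj x)) (parz (qk x)) (parz (qre y))
  (parz (qi y)) (parz (qj y)) (parz (qk y)) => [] [] [] [] [] [] [] [].
Qed.
Lemma parz_normN x : parz (qnorm (- x)) = parz (qnorm x).
Proof. by rewrite !parz_norm !qE !parzN. Qed.

(** No residue is exactly half of an odd modulus, which makes the inequality strict, as [unit_shift]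
    requires. *)
Lemma round_odd (w n : int) : 0 < n -> parz n ->
  exists k d, w = n * k + d /\ 2 * `|d| < n.
Proof.
move=> n0 np.
have e := divz_eq w n; have h1 := modz_ge0 w (lt0r_neq0 n0); have h2 := ltz_pmod w n0.
move: e h1 h2; move: (w %/ n)%Z (w %% n)%Z => k d e h1 h2.
have [h|h] : 2 * d < n \/ 2 * d > n.
- by move: np; rewrite /parz; lia.
- by exists k, d; split; [rewrite e; ring | lia].
- by exists (k + 1), (d - n); split; [rewrite e; ring | lia].
Qed.

(* Changing one coordinate of the quotient flips the parity of the remainder:
   this is the covering radius of the lattice D4. *)
Lemma unit_shift (x : quat) (n : int) : x != 0 -> 0 < n ->
  2 * `|qre x| < n -> 2 * `|qi x| < n -> 2 * `|qj x| < n -> 2 * `|qk x| < n ->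
  exists e, qnorm e = 1 /\ qnorm (x - qz n * e) < n ^+ 2.
Proof.
case: x => a b c d x0 n0 /= ha hb hc hd.
(* The largest coordinate [s] is moved by [n] towards the opposite sign: the norm becomes at most
   n^2 - 2 n |s| + 4 s^2, which is below n^2 because 2 |s| < n. *)
have key (s t u v : int) : 2 * `|s| < n -> `|t| <= `|s| -> `|u| <= `|s| -> `|v| <= `|s| ->
   0 < `|s| -> exists z : int, z ^+ 2 = 1 /\ (s - n * z) ^+ 2 + t ^+ 2 + u ^+ 2 + v ^+ 2 < n ^+ 2.
  move=> h1 h2 h3 h4 h5.
  have sq (t' s' : int) : `|t'| <= `|s'| -> t' ^+ 2 <= s' ^+ 2.
    by move=> h; rewrite -[t' ^+ 2]real_normK ?num_real // -[s' ^+ 2]real_normK ?num_real // lerXn2r ?nnegrE.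
  have q2 := sq _ _ h2; have q3 := sq _ _ h3; have q4 := sq _ _ h4.
  have [hs|hs] := leP 0 s.
    exists 1; split; first by ring.
    have p : 0 < s * (n - 2 * s) by apply: mulr_gt0; move: h1 h5; rewrite ger0_norm // subr_gt0.
    by lra.
  exists (-1); split; first by ring.
  have p : 0 < (- s) * (n + 2 * s).
    by rewrite mulr_gt0 ?oppr_gt0 // -[2 * s]opprK -mulrN subr_gt0 -(ltr0_norm hs).
  by lra.
have nz : 0 < `|a| + `|b| + `|c| + `|d|.
  rewrite lt_def !addr_ge0 // andbT; apply: contra_neq x0 => h.
  by have [-> -> -> ->] : [/\ a = 0, b = 0, c = 0 & d = 0] by split; lia.
have four (A B C D : int) : 0 < A + B + C + D ->
   [/\ B <= A, C <= A, D <= A & 0 < A] \/ [/\ A <= B, C <= B, D <= B & 0 < B] \/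
   [/\ A <= C, B <= C, D <= C & 0 < C] \/ [/\ A <= D, B <= D, C <= D & 0 < D].
  move=> h; case: (leP A B) => h1; case: (leP C D) => h2.
  - by case: (leP B D) => h3; [right; right; right|right; left]; split; lia.
  - by case: (leP B C) => h3; [right; right; left|right; left]; split; lia.
  - by case: (leP A D) => h3; [right; right; right|left]; split; lia.
  - by case: (leP A C) => h3; [right; right; left|left]; split; lia.
have [[h1 h2 h3 h]|[[h1 h2 h3 h]|[[h1 h2 h3 h]|[h1 h2 h3 h]]]] := four _ _ _ _ nz.
- have [z [z1 hz]] := key _ _ _ _ ha h1 h2 h3 h; exists (Quat z 0 0 0).
  by rewrite qz_mulE /qnorm /=; split; [rewrite z1|]; lra.
- have [z [z1 hz]] := key _ _ _ _ hb h1 h2 h3 h; exists (Quat 0 z 0 0).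
  by rewrite qz_mulE /qnorm /=; split; [rewrite z1|]; lra.
- have [z [z1 hz]] := key _ _ _ _ hc h1 h2 h3 h; exists (Quat 0 0 z 0).
  by rewrite qz_mulE /qnorm /=; split; [rewrite z1|]; lra.
- have [z [z1 hz]] := key _ _ _ _ hd h1 h2 h3 h; exists (Quat 0 0 0 z).
  by rewrite qz_mulE /qnorm /=; split; [rewrite z1|]; lra.
Qed.

(** Rounding gives a short remainder. If its norm is even, moving the quotient by a unit changes it
    by an element of odd norm, which flips the parity, and [unit_shift] keeps it short. Thus the
    Euclidean algorithm never leaves odd norms. *)
Lemma qdiv_odd (z q : quat) : parz (qnorm q) ->
  (exists k, z = k * q) \/
  exists k, parz (qnorm (z - k * q)) /\ qnorm (z - k * q) < qnorm q.
Proof.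
move=> qp.
have q0 : q != 0 by apply: contraTneq qp => ->.
have n0 := qnorm_gt0 q0; set n := qnorm q in n0 qp *.
have [k0 [d0 [e0 h0]]] := round_odd (qre (z * qconj q)) n0 qp.
have [k1 [d1 [e1 h1]]] := round_odd (qi (z * qconj q)) n0 qp.
have [k2 [d2 [e2 h2]]] := round_odd (qj (z * qconj q)) n0 qp.
have [k3 [d3 [e3 h3]]] := round_odd (qk (z * qconj q)) n0 qp.
pose k := Quat k0 k1 k2 k3; pose d := Quat d0 d1 d2 d3.
have e : z * qconj q = qz n * k + d by rewrite qz_mulE; apply: quat_eq.
have qc0 : qconj q != 0 by apply: contra_neq q0 => h; rewrite -[q]qconjK h.
have rem t : (z - t * q) * qconj q = d + qz n * k - qz n * t.
  by rewrite mulrBl e -mulrA qmul_conj -/n qzC (addrC d).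
have [dz|dn0] := eqVneq d 0.
  left; exists k; apply: (qmulIr qc0); apply/eqP; rewrite -subr_eq0 -mulrBl rem dz.
  by rewrite add0r subrr.
right.
have small t x : (z - t * q) * qconj q = x -> qnorm x < n ^+ 2 -> qnorm (z - t * q) < n.
  move=> <-; rewrite qnormM qnorm_conj -/n expr2; rewrite ltr_pM2r //.
have [p1|p1] := boolP (parz (qnorm (z - k * q))).
  exists k; split=> //; apply: (small _ d); first by rewrite rem addrK.
  rewrite /qnorm /=; clear -h0 h1 h2 h3 n0.
  have sq (t : int) : 2 * `|t| < n -> 4 * t ^+ 2 < n ^+ 2.
    move=> h; rewrite -[t ^+ 2]real_normK ?num_real //; have := normr_ge0 t.
    move: `|t| h => u h u0; have p : 0 < (n - 2 * u) * (n + 2 * u) by apply: mulr_gt0; lia.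
    by lra.
  by move: (sq _ h0) (sq _ h1) (sq _ h2) (sq _ h3); lra.
have [u [u1 hu]] := unit_shift dn0 n0 h0 h1 h2 h3.
exists (k + u); split.
  by rewrite mulrDl opprD addrA parz_normD parz_normN qnormM u1 mul1r qp addbT.
apply: (small _ (d - qz n * u)) => //.
by rewrite rem mulrDr opprD addrA addrK.
Qed.

(* Left ideals of the Lipschitz order containing an odd integer are principal. *)
Lemma left_gcd (x : quat) (f : int) : parz f ->
  exists q u v k k', [/\ q = u * x + v * qz f, x = k * q, qz f = k' * q & parz (qnorm q)].
Proof.
move=> fp.
suff H N q u v : q = u * x + v * qz f -> parz (qnorm q) -> qnorm q <= N%:Z ->
   exists q u v k k', [/\ q = u * x + v * qz f, x = k * q, qz f = k' * q & parz (qnorm q)].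
  apply: (H `|f ^+ 2|%N (qz f) 0 1); first by rewrite mul0r mul1r add0r.
    by rewrite qnorm_qz parzX.
  by rewrite qnorm_qz; lia.
elim: N q u v => [|N IH] q u v e qp hN.
  have q0 : qnorm q = 0 by have := qnorm_ge0 q; lia.
  by rewrite q0 in qp.
have [[k ek]|[k [rp rs]]] := qdiv_odd x qp; last first.
  apply: (IH (x - k * q) (1 - k * u) (- (k * v))) => //; last by lia.
  by rewrite e mulrBl mul1r mulrDr mulNr opprD addrA !mulrA.
have [[k' ek']|[k' [rp rs]]] := qdiv_odd (qz f) qp; last first.
  apply: (IH (qz f - k' * q) (- (k' * u)) (1 - k' * v)) => //; last by lia.
  by rewrite {1}e mulrBl mul1r mulrDr mulNr !mulrA opprD addrCA.
by exists q, u, v, k, k'.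
Qed.
End QuatTheory.

(** * Primitive quaternions and ideals of given norm *)

Section QuatPrim.
Local Open Scope ring_scope.
Implicit Types (x y z u v w q : quat) (m n : int).

(** Primitivity at the primes of [f] only. Every prime divides 0, so [qprim 0] is primitivity in the
    usual sense. *)
Definition qprim (f : int) x :=
  forall l : nat, prime l -> (l%:Z %| f)%Z -> ~ qdvd l%:Z x.

Lemma qprim_bezout f x : f != 0 -> qprim f x ->
  exists s t u v w : int,
    s * qre x + t * qi x + u * qj x + v * qk x + w * f = 1.
Proof.
move=> f0 hx.
have [w1 [w2 e1]] := Bezoutz (qk x) f.
have [w3 [w4 e2]] := Bezoutz (qj x) (gcdz (qk x) f).
have [w5 [w6 e3]] := Bezoutz (qi x) (gcdz (qj x) (gcdz (qk x) f)).
set g3 := gcdz (qi x) _ in e3.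
have [w7 [w8 e4]] := Bezoutz (qre x) g3.
have g1 : gcdz (qre x) g3 = 1.
  have g0 : gcdz (qre x) g3 = `|gcdz (qre x) g3|%N%:Z by rewrite gez0_abs.
  have [h|h|h] := ltngtP `|gcdz (qre x) g3|%N 1; last by rewrite g0 h.
    have : gcdz (qre x) g3 == 0 by rewrite g0; lia.
    rewrite gcdz_eq0 => /andP[_]; rewrite gcdz_eq0 => /andP[_].
    by rewrite gcdz_eq0 => /andP[_]; rewrite gcdz_eq0 => /andP[_]; rewrite (negPf f0).
  have pl := pdiv_prime h; have dl : ((pdiv `|gcdz (qre x) g3|)%:Z %| gcdz (qre x) g3)%Z.
    by rewrite dvdzE /= pdiv_dvd.
  move: dl; rewrite !dvdz_gcd => /and5P[d0 d1 d2 d3 d4].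
  by case: (hx _ pl d4); apply/qdvdP.
exists w7, (w8 * w5), (w8 * w6 * w3), (w8 * w6 * w4 * w1), (w8 * w6 * w4 * w2).
rewrite -g1 -e4 -e3 -e2 -e1; ring.
Qed.

Lemma parz_double f : parz f -> exists h, 2 * h = f + 1.
Proof.
move=> pf; have : (2 %| f + 1)%Z by rewrite -parz_dvd parzD pf.
by case/dvdzP=> h ->; exists h; ring.
Qed.

(** Bezout coefficients of the coordinates, with the signs of a conjugate, give a multiple of [x] of
    real part 1, and (f + 1) / 2 inverts 2. A multiple of trace 1 is wanted because it acts as an
    idempotent modulo [f]. *)
Lemma qprim_half f x : parz f -> qprim f x ->
  exists v, (f %| 2 * qre (v * x) - 1)%Z.
Proof.
move=> pf hx; have f0 : f != 0 by apply: contraTneq pf => ->.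
have [s [t [u [v [w e]]]]] := qprim_bezout f0 hx.
have [h eh] := parz_double pf.
exists (qz h * Quat s (- t) (- u) (- v)); apply/dvdzP; exists (1 - w * (f + 1)).
have e' : s * qre x + t * qi x + u * qj x + v * qk x = 1 - w * f by rewrite -e; ring.
rewrite qz_mulE !qE /=.
transitivity (2 * h * (s * qre x + t * qi x + u * qj x + v * qk x) - 1); first by ring.
by rewrite e' eh; ring.
Qed.

Lemma qtr_conj x : x + qconj x = qz (2 * qre x).
Proof. by qring. Qed.

(* Modulo [f] the element [v * x] is an idempotent generating the same left ideal as [x]. *)
Lemma qprim_idem f x : parz f -> qprim f x ->
  exists v, forall y, qdvd f (y * qconj x) -> qdvd f (y - y * v * x).
Proof.
move=> pf hx; have [v hv] := qprim_half pf hx; exists v => y hy.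
have -> : y - y * v * x = y * qconj x * qconj v - y * qz (2 * qre (v * x) - 1). by qring.
apply: qdvdB; first exact: qdvdMr.
by apply: qdvdMl; apply: qdvd_qz.
Qed.


(** The left ideal of [x] and [f] is recognized by [qconj x]: if [f] divides [y * qconj x], the
    idempotent gives y = y w x modulo f, and both [x] and [f] are multiples of [q]. *)
Lemma qprim_lideal f x y q u v k' : parz f -> qprim f x ->
  q = u * x + v * qz f -> x = k' * q -> (exists k'', qz f = k'' * q) ->
  qdvd f (y * qconj x) -> exists k, y = k * q.
Proof.
move=> pf hx eq ex [k'' ef] hy; have [w hw] := qprim_idem pf hx.
have [z ez] := hw _ hy; exists (y * w * k' + z * k'').
by rewrite mulrDl -!mulrA -ex -ef qzC -ez mulrA addrC subrK.
Qed.

(** [f] divides the norm of the generator because it divides that of [x]. If [g] is the quotient,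
    then [qconj q = g * k'], so [g] divides [q], hence [x], and it also divides [f]; primitivity
    leaves g = 1. *)
Lemma qprim_gcd_norm (f : nat) x : odd f -> qprim f%:Z x -> (f%:Z %| qnorm x)%Z ->
  exists q u v k k', [/\ q = u * x + v * qz f%:Z, x = k * q, qz f%:Z = k' * q &
    qnorm q = f%:Z].
Proof.
move=> fo hx hn; have pf : parz f%:Z by [].
have [q [u [v [k [k' [e1 e2 e3 _]]]]]] := left_gcd x pf.
exists q, u, v, k, k'; split=> //.
have f0 : f%:Z != 0 by apply: contraTneq pf => ->.
have /dvdzP[g eg] : (f%:Z %| qnorm q)%Z.
  rewrite e1 /qnorm; case/dvdzP: hn => t et.
  rewrite /qnorm in et; apply/dvdzP.
  have -> : u * x + v * qz f%:Z = u * x + qz f%:Z * v by rewrite qzC.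
  exists (qnorm u * t + 2 * (qre (u * x) * qre v + qi (u * x) * qi v + qj (u * x) * qj v
     + qk (u * x) * qk v) + f%:Z * qnorm v).
  have -> : (qnorm u * t + 2 * (qre (u * x) * qre v + qi (u * x) * qi v + qj (u * x) * qj v
     + qk (u * x) * qk v) + f%:Z * qnorm v) * f%:Z = qnorm u * (t * f%:Z) +
     f%:Z * (2 * (qre (u * x) * qre v + qi (u * x) * qi v + qj (u * x) * qj v
     + qk (u * x) * qk v) + f%:Z * qnorm v) by ring.
  by rewrite -et /qnorm qz_mulE !qE /=; ring.
have q0 : q != 0.
  by apply: contraNneq f0 => q0; move: e3; rewrite q0 mulr0 => -[->].
have n0 : 0 < qnorm q by apply: qnorm_gt0.
have kg : qnorm k' * g = 1 * f%:Z.
  apply: (mulIf f0); rewrite -mulrA -eg -qnormM -e3 qnorm_qz; ring.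
have qg : qconj q = qz g * k'.
  apply: (qz_mulI f0); rewrite mulrA -qzM mulrC -eg -qmul_conj.
  have -> : qz f%:Z * qconj q = k' * (q * qconj q) by rewrite mulrA -e3.
  by rewrite qmul_conj qzC.
have gx : qdvd g x.
  rewrite e2 -[q]qconjK; apply: qdvdMl; apply: qdvd_conj; by exists k'.
have gf : (g %| f%:Z)%Z by apply/dvdzP; exists (qnorm k'); rewrite kg mul1r.
have g0 : 0 < g by move: n0; rewrite eg pmulr_lgt0 //; lia.
have gg : g = `|g|%N%:Z by rewrite gez0_abs // ltW.
have [h|h|h] := ltngtP `|g|%N 1%N; [lia | | by rewrite eg gg h mul1r].
have dl : ((pdiv `|g|)%:Z %| g)%Z by rewrite {2}gg dvdzE /= pdiv_dvd.
case: (hx _ (pdiv_prime h) (dvdz_trans dl gf)).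
case/dvdzP: dl => t et; case: gx => z ez; exists (qz t * z).
by rewrite mulrA -qzM mulrC -et.
Qed.

End QuatPrim.

(** * Walks attached to pure quaternions *)

Section Moves.
Local Open Scope ring_scope.
Implicit Types (x y z w q a b : quat) (e u v : int).

Lemma dvdz_comb2 (f A B X c d : int) :
  (f %| A)%Z -> (f %| B)%Z -> X = c * A + d * B -> (f %| X)%Z.
Proof. by move=> hA hB ->; rewrite rpredD // dvdz_mull. Qed.
Lemma dvdz_comb3 (f A B C X c d g : int) :
  (f %| A)%Z -> (f %| B)%Z -> (f %| C)%Z -> X = c * A + d * B + g * C -> (f %| X)%Z.
Proof. by move=> hA hB hC ->; rewrite !rpredD // dvdz_mull. Qed.

Lemma qre_mulC x y : qre (x * y) = qre (y * x).
Proof. by rewrite !qE; ring. Qed.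

Lemma qconj_pure a : qre a = 0 -> qconj a = - a.
Proof. by move=> h; apply: quat_eq; rewrite ?qE /= ?h ?oppr0. Qed.

Lemma pure_sqr a : qre a = 0 -> a * a = - qz (qnorm a).
Proof. by move=> h; rewrite -qmul_conj qconj_pure // mulrN opprK. Qed.

(** Exchanging the factors of a + v = k q conjugates [a] into q a q^-1 and keeps it integral. This
    is one step of the walk. *)
Lemma ideal_move a v q k : qre a = 0 -> a + qz v = k * q -> q != 0 ->
  exists b, [/\ b + qz v = q * k, qre b = 0, b * q = q * a & qnorm b = qnorm a].
Proof.
move=> ha e q0; exists (q * k - qz v).
have e2 : (q * k - qz v) * q = q * a.
  by rewrite mulrBl -mulrA -e mulrDr (qzC v q) addrK.
split=> //; first by rewrite subrK.
  by rewrite qreD qreN qre_mulC -e qreD ha /= add0r subrr.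
apply: (mulIf (lt0r_neq0 (qnorm_gt0 q0))); rewrite -!qnormM e2 !qnormM; ring.
Qed.

(* Entries of the image of [x] under the map [i |-> diag(e,-e)], [j |-> (0,1;-1,0)],
   a ring morphism into 2x2 matrices modulo any divisor of [e ^+ 2 + 1]. *)
Definition f11 e x := qre x + e * qi x.
Definition f12 e x := qj x + e * qk x.
Definition f21 e x := - qj x + e * qk x.
Definition f22 e x := qre x - e * qi x.

Lemma f11M e x y : f11 e (x * y) = f11 e x * f11 e y + f12 e x * f21 e y
  + (e ^+ 2 + 1) * - (qi x * qi y + qk x * qk y).
Proof. by rewrite /f11 /f12 /f21 /f22 !qE; ring. Qed.
Lemma f12M e x y : f12 e (x * y) = f11 e x * f12 e y + f12 e x * f22 e y
  + (e ^+ 2 + 1) * (qk x * qi y - qi x * qk y).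
Proof. by rewrite /f11 /f12 /f21 /f22 !qE; ring. Qed.
Lemma f21M e x y : f21 e (x * y) = f21 e x * f11 e y + f22 e x * f21 e y
  + (e ^+ 2 + 1) * (qi x * qk y - qk x * qi y).
Proof. by rewrite /f11 /f12 /f21 /f22 !qE; ring. Qed.
Lemma f22M e x y : f22 e (x * y) = f21 e x * f12 e y + f22 e x * f22 e y
  + (e ^+ 2 + 1) * - (qi x * qi y + qk x * qk y).
Proof. by rewrite /f11 /f12 /f21 /f22 !qE; ring. Qed.
Lemma f_det e x : f11 e x * f22 e x - f12 e x * f21 e x =
  qnorm x - (e ^+ 2 + 1) * (qi x ^+ 2 + qk x ^+ 2).
Proof. by rewrite /f11 /f12 /f21 /f22 /qnorm; ring. Qed.

Lemma f_inj f e x : parz f -> (f %| e ^+ 2 + 1)%Z -> (f %| f11 e x)%Z -> (f %| f12 e x)%Z ->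
  (f %| f21 e x)%Z -> (f %| f22 e x)%Z -> qdvd f x.
Proof.
move=> pf he h11 h12 h21 h22.
have [h eh] := parz_double pf.
have half X : (f %| 2 * X)%Z -> (f %| X)%Z.
  move=> hX; apply: (dvdz_comb2 (c := h) (d := - X) hX (dvdzz f)).
  have -> : h * (2 * X) = (2 * h) * X by ring.
  by rewrite eh; ring.
(* Modulo [f] the inverse of [e] is [- e]. *)
have ei X : (f %| 2 * e * X)%Z -> (f %| X)%Z.
  move=> hX; apply: half; apply: (dvdz_comb2 (c := - e) (d := 2 * X) hX he); ring.
apply/qdvdP; split.
- by apply: half; apply: (dvdz_comb2 (c := 1) (d := 1) h11 h22); rewrite /f11 /f22; ring.
- by apply: ei; apply: (dvdz_comb2 (c := 1) (d := -1) h11 h22); rewrite /f11 /f22; ring.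
- by apply: half; apply: (dvdz_comb2 (c := 1) (d := -1) h12 h21); rewrite /f12 /f21; ring.
- by apply: ei; apply: (dvdz_comb2 (c := 1) (d := 1) h12 h21); rewrite /f12 /f21; ring.
Qed.

(* [line f e t x]: the column (-t, 1) is in the kernel of [x] modulo [f]. *)
Definition line f e t x :=
  (f %| f12 e x - t * f11 e x)%Z /\ (f %| f22 e x - t * f21 e x)%Z.

(** Both matrices have rows proportional to (1, t), and [qconj x] becomes the adjugate of the matrix
    of [x], which the row (1, t) kills from the left. *)
Lemma line_mulconj f e t x y : parz f -> (f %| e ^+ 2 + 1)%Z ->
  line f e t x -> line f e t y -> qdvd f (y * qconj x).
Proof.
move=> pf he [/dvdzP[a1 ha1] /dvdzP[a2 ha2]] [/dvdzP[b1 hb1] /dvdzP[b2 hb2]].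
have c11 : f11 e (qconj x) = f22 e x by rewrite /f11 /f22 /=; ring.
have c12 : f12 e (qconj x) = - f12 e x by rewrite /f12 /=; ring.
have c21 : f21 e (qconj x) = - f21 e x by rewrite /f21 /=; ring.
have c22 : f22 e (qconj x) = f11 e x by rewrite /f11 /f22 /=; ring.
move/eqP: ha1; rewrite subr_eq => /eqP ha1; move/eqP: ha2; rewrite subr_eq => /eqP ha2.
move/eqP: hb1; rewrite subr_eq => /eqP hb1; move/eqP: hb2; rewrite subr_eq => /eqP hb2.
have df := dvdzz f.
apply: (f_inj pf he).
- rewrite f11M c11 c21 ha2 hb1.
  apply: (dvdz_comb2 (c := f11 e y * a2 - b1 * f21 e x) (d := - (qi y * qi (qconj x) + qk y * qk (qconj x))) df he); ring.
- rewrite f12M c12 c22 ha1 hb1.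
  apply: (dvdz_comb2 (c := - f11 e y * a1 + b1 * f11 e x) (d := (qk y * qi (qconj x) - qi y * qk (qconj x))) df he); ring.
- rewrite f21M c11 c21 ha2 hb2.
  apply: (dvdz_comb2 (c := f21 e y * a2 - b2 * f21 e x) (d := (qi y * qk (qconj x) - qk y * qi (qconj x))) df he); ring.
- rewrite f22M c12 c22 ha1 hb2.
  apply: (dvdz_comb2 (c := - f21 e y * a1 + b2 * f11 e x) (d := - (qi y * qi (qconj x) + qk y * qk (qconj x))) df he); ring.
Qed.

Lemma line_mull f e t x y : (f %| e ^+ 2 + 1)%Z -> line f e t y -> line f e t (x * y).
Proof.
move=> he [h1 h2]; split.
  apply: (dvdz_comb3 (c := f11 e x) (d := f12 e x) (g := (qk x * qi y - qi x * qk y)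
     + t * (qi x * qi y + qk x * qk y)) h1 h2 he).
  by rewrite f12M f11M; ring.
apply: (dvdz_comb3 (c := f21 e x) (d := f22 e x) (g := - (qi x * qi y + qk x * qk y)
     - t * (qi x * qk y - qk x * qi y)) h1 h2 he).
by rewrite f22M f21M; ring.
Qed.
Lemma lineD f e t x y : line f e t x -> line f e t y -> line f e t (x + y).
Proof.
move=> [h1 h2] [h3 h4]; split.
  by apply: (dvdz_comb2 (c := 1) (d := 1) h1 h3); rewrite /f12 /f11 !qE; ring.
by apply: (dvdz_comb2 (c := 1) (d := 1) h2 h4); rewrite /f22 /f21 !qE; ring.
Qed.
Lemma line_qdvd f e t x : qdvd f x -> line f e t x.
Proof.
move=> [y ->]; split; apply/dvdzP.
  by exists (f12 e y - t * f11 e y); rewrite qz_mulE /f12 /f11 /=; ring.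
by exists (f22 e y - t * f21 e y); rewrite qz_mulE /f22 /f21 /=; ring.
Qed.

(** Commutators are divisible by 2, and an odd norm is invertible modulo 2. So parities of
    coordinates survive the moves of the walk. *)
Lemma parity_move a b q : parz (qnorm q) -> b * q = q * a -> qdvd 2 (b - a).
Proof.
move=> pq e.
have h1 : qdvd 2 ((b - a) * q).
  exists (Quat 0 (qj q * qk a - qk q * qj a) (qk q * qi a - qi q * qk a) (qi q * qj a - qj q * qi a)).
  rewrite mulrBl e; qring.
have h2 := qdvdMr (qconj q) h1; rewrite -mulrA qmul_conj qzC qz_mulE in h2.
move/qdvdP: h2 => /= [d0 d1 d2 d3].
have H t : (2 %| qnorm q * t)%Z -> (2 %| t)%Z by rewrite -!parz_dvd parzM pq.
by apply/qdvdP; split; apply: H.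
Qed.
End Moves.

Section Walk.
Local Open Scope ring_scope.
Implicit Types (x y z w q a b : quat) (e u v : int).

Lemma int_prime_ndvd_coprime (p : nat) k (m : int) : prime p -> ~~ (p%:Z %| m)%Z ->
  coprimez (p ^ k)%N%:Z m.
Proof.
move=> pp h; rewrite coprimezE /=.
by rewrite coprimeXl // prime_coprime // -dvdzE.
Qed.

Lemma solve_lin (p k : nat) (m w : int) : prime p -> ~~ (p%:Z %| m)%Z ->
  exists y : int, ((p ^ k)%N%:Z %| w - y * m)%Z.
Proof.
move=> pp h; have /coprimezP[[s t] /= st] := int_prime_ndvd_coprime k pp h.
exists (w * t); apply/dvdzP; exists (w * s).
have -> : w - w * t * m = w * (s * (p ^ k)%N%:Z + t * m) - w * t * m by rewrite st mulr1.
ring.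
Qed.

(* Among the lifts [t + f * y] of the line [t], one is forbidden: a quaternion on that
   line is conjugate to one whose first coordinate is a square root of [r] mod [p ^ k]. *)
Lemma walk_step (p k : nat) (f : nat) (r e u t : int) a :
  prime p -> odd p -> odd f ->
  (forall l : nat, prime l -> l %| f -> l = p)%N -> (0 < k)%N ->
  ~~ (p%:Z %| u)%Z ->
  ((f * p ^ k)%N%:Z %| u ^+ 2 + r)%Z -> ((f * p ^ k)%N%:Z %| e ^+ 2 + 1)%Z ->
  qre a = 0 -> qnorm a = r -> line f%:Z e t (a + qz u) ->
  exists y : int, forall b, qre b = 0 -> qnorm b = r ->
    line (f * p ^ k)%N%:Z e (t + f%:Z * y) (b + qz u) ->
    exists c, [/\ qre c = 0, qnorm c = r, qdvd 2 (c - b) & ((p ^ k)%N%:Z %| r - qi c ^+ 2)%Z].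
Proof.
move=> pp op of1 fl k0 pu hu he ha na la.
set P := (p ^ k)%N%:Z.
have F0 : (f * p ^ k)%N%:Z = f%:Z * P by rewrite PoszM.
rewrite F0 in hu he *.
have fF : (f%:Z %| f%:Z * P)%Z by rewrite dvdz_mulr.
have f0 : f%:Z != 0 by rewrite eqz_nat; apply: contraTneq of1 => ->.
have pf : parz f%:Z by [].
have fe := dvdz_trans fF he.
have hprim : qprim f%:Z (a + qz u).
  move=> l pl; rewrite dvdzE /= => /(fl _ pl) -> /qdvdP[] d0 _ _ _.
  by move: d0; rewrite !qE ha /= add0r (negPf pu).
have hn : (f%:Z %| qnorm (a + qz u))%Z.
  have -> : qnorm (a + qz u) = u ^+ 2 + r by rewrite -na /qnorm !qE ha /=; ring.
  exact: dvdz_trans fF hu.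
have [Q [x [v [m [m' [eQ ea efQ nQ]]]]]] := qprim_gcd_norm of1 hprim hn.
have Q0 : Q != 0 by apply: contraNneq f0 => h; move: nQ; rewrite h => <-.
have lQ : line f%:Z e t Q.
  rewrite eQ; apply: lineD; first exact: line_mull.
  by apply: line_qdvd; apply: qdvdMl; apply: qdvd_qz.
have [/dvdzP[w1 e1] /dvdzP[w2 e2]] := lQ.
have /dvdzP[ee hee] := he.
(* (w1, w2) is the image of the column (-t, 1) under [Q], divided by [f]. With the first column of
   [Q] it has determinant [qnorm Q / f], that is 1, modulo [P]. *)
have det : f11 e Q * w2 - f21 e Q * w1 = 1 - ee * (qi Q ^+ 2 + qk Q ^+ 2) * P.
  apply: (mulfI f0).
  transitivity (f11 e Q * (w2 * f%:Z) - f21 e Q * (w1 * f%:Z)); first by ring.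
  rewrite -e1 -e2.
  transitivity (f11 e Q * f22 e Q - f12 e Q * f21 e Q); first by ring.
  rewrite f_det nQ hee; ring.
have pP : (p%:Z %| P)%Z by rewrite /P dvdzE /= dvdn_exp.
(* The conjugate [c] of [b] by [Q] satisfies c + u = Q n where b + u = n Q. That [b] lies on the
   lift t + f y says that [n] kills (w1 - y f11 Q, w2 - y f21 Q) modulo [P]. *)
have key b (y : int) : qre b = 0 -> qnorm b = r ->
    line (f%:Z * P) e (t + f%:Z * y) (b + qz u) ->
    exists c n, [/\ qre c = 0, qnorm c = r, qdvd 2 (c - b), c + qz u = Q * n &
     (P %| f11 e n * (w1 - y * f11 e Q) + f12 e n * (w2 - y * f21 e Q))%Z /\
     (P %| f21 e n * (w1 - y * f11 e Q) + f22 e n * (w2 - y * f21 e Q))%Z].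
  move=> hb nb [l1 l2].
  have lb : line f%:Z e t (b + qz u).
    split.
      apply: (dvdz_comb2 (c := 1) (d := y * f11 e (b + qz u)) (dvdz_trans fF l1) (dvdzz f%:Z)); ring.
    apply: (dvdz_comb2 (c := 1) (d := y * f21 e (b + qz u)) (dvdz_trans fF l2) (dvdzz f%:Z)); ring.
  have hmul := line_mulconj pf fe la lb.
  have [n en] := qprim_lideal pf hprim eQ ea (ex_intro _ m' efQ) hmul.
  have [c [ec hc mc nc]] := ideal_move hb en Q0.
  exists c, n; split=> //; first by rewrite nc.
    by apply: parity_move mc; rewrite nQ.
  split.
  - rewrite en in l1; rewrite -(@dvdz_mul2l f%:Z) //=.
    apply: (dvdz_comb2 (c := 1) (d := - (qk n * qi Q - qi n * qk Q) - (t + f%:Z * y) * (qi n * qi Q + qk n * qk Q)) l1 he).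
    rewrite f12M f11M.
    have e1' : f12 e Q = w1 * f%:Z + t * f11 e Q by rewrite -e1; ring.
    have e2' : f22 e Q = w2 * f%:Z + t * f21 e Q by rewrite -e2; ring.
    rewrite e1' e2'; ring.
  - rewrite en in l2; rewrite -(@dvdz_mul2l f%:Z) //=.
    apply: (dvdz_comb2 (c := 1) (d := (qi n * qi Q + qk n * qk Q) + (t + f%:Z * y) * (qi n * qk Q - qk n * qi Q)) l2 he).
    rewrite f22M f21M.
    have e1' : f12 e Q = w1 * f%:Z + t * f11 e Q by rewrite -e1; ring.
    have e2' : f22 e Q = w2 * f%:Z + t * f21 e Q by rewrite -e2; ring.
    rewrite e1' e2'; ring.
have Pu : (P %| u ^+ 2 + r)%Z by apply: dvdz_trans hu; rewrite dvdz_mull.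
have Pe : (P %| e ^+ 2 + 1)%Z by apply: dvdz_trans he; rewrite dvdz_mull.
(* One of [f11 e Q], [f21 e Q] is a unit, so [y] can annihilate the corresponding entry of that
   column; by the determinant the other entry is then a unit. Hence a column of [n], and of c + u,
   vanishes. Its diagonal entry u + e qi c or u - e qi c is thus 0, and u^2 = - r, e^2 = - 1 give r
   = (qi c)^2. *)
have [p1|p1] := boolP (p%:Z %| f11 e Q)%Z.
  have p2 : ~~ (p%:Z %| f21 e Q)%Z.
    apply/negP => p2; have : (p%:Z %| 1)%Z.
      apply: (dvdz_comb3 (c := w2) (d := - w1) (g := ee * (qi Q ^+ 2 + qk Q ^+ 2)) p1 p2 pP).
      have -> : w2 * f11 e Q + - w1 * f21 e Q = f11 e Q * w2 - f21 e Q * w1 by ring.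
      by rewrite det; ring.
    by rewrite dvdzE /= dvdn1 => /eqP p1'; rewrite p1' in pp.
  have [y hy] := solve_lin k w2 pp p2; exists y => b hb nb lb.
  have [c [n [hc nc dc ec [k1 k2]]]] := key b y hb nb lb.
  exists c; split=> //.
  have un X : (P %| X * (w1 - y * f11 e Q))%Z -> (P %| X)%Z.
    move=> hX; apply: (dvdz_comb3 (c := - f21 e Q) (d := f11 e Q * X) (g := X * ee * (qi Q ^+ 2 + qk Q ^+ 2)) hX hy (dvdzz P)).
    transitivity (X * (f11 e Q * w2 - f21 e Q * w1) + X * ee * (qi Q ^+ 2 + qk Q ^+ 2) * P); last by ring.
    by rewrite det; ring.
  have n1 : (P %| f11 e n)%Z.
    apply: un; apply: (dvdz_comb2 (c := 1) (d := - f12 e n) k1 hy); ring.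
  have n2 : (P %| f21 e n)%Z.
    apply: un; apply: (dvdz_comb2 (c := 1) (d := - f22 e n) k2 hy); ring.
  have hz : (P %| u + e * qi c)%Z.
    have -> : u + e * qi c = f11 e (c + qz u) by rewrite /f11 !qE hc /=; ring.
    rewrite ec f11M.
    apply: (dvdz_comb3 (c := f11 e Q) (d := f12 e Q) (g := - (qi Q * qi n + qk Q * qk n)) n1 n2 Pe); ring.
  apply: (dvdz_comb3 (c := 1) (d := - (u - e * qi c)) (g := - qi c ^+ 2) Pu hz Pe); ring.
have [y hy] := solve_lin k w1 pp p1; exists y => b hb nb lb.
have [c [n [hc nc dc ec [k1 k2]]]] := key b y hb nb lb.
exists c; split=> //.
have un X : (P %| X * (w2 - y * f21 e Q))%Z -> (P %| X)%Z.
  move=> hX; apply: (dvdz_comb3 (c := f11 e Q) (d := - f21 e Q * X) (g := X * ee * (qi Q ^+ 2 + qk Q ^+ 2)) hX hy (dvdzz P)).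
  transitivity (X * (f11 e Q * w2 - f21 e Q * w1) + X * ee * (qi Q ^+ 2 + qk Q ^+ 2) * P); last by ring.
  by rewrite det; ring.
have n1 : (P %| f12 e n)%Z.
  apply: un; apply: (dvdz_comb2 (c := 1) (d := - f11 e n) k1 hy); ring.
have n2 : (P %| f22 e n)%Z.
  apply: un; apply: (dvdz_comb2 (c := 1) (d := - f21 e n) k2 hy); ring.
have hz : (P %| u - e * qi c)%Z.
  have -> : u - e * qi c = f22 e (c + qz u) by rewrite /f22 !qE hc /=; ring.
  rewrite ec f22M.
  apply: (dvdz_comb3 (c := f21 e Q) (d := f22 e Q) (g := - (qi Q * qi n + qk Q * qk n)) n1 n2 Pe); ring.
apply: (dvdz_comb3 (c := 1) (d := - (u + e * qi c)) (g := - qi c ^+ 2) Pu hz Pe); ring.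
Qed.
End Walk.

(** * Squarefree norms and uniqueness of moves *)

Definition sqfree (r : nat) := forall l, prime l -> ~~ (l ^ 2 %| r).

Lemma sqfree_gt0 r : sqfree r -> 0 < r.
Proof. by case: r => // /(_ 2 isT); rewrite dvdn0. Qed.

Lemma sqfree_dvd_sqr r s : sqfree r -> r %| s ^ 2 -> r %| s.
Proof.
move=> sr h; have r0 := sqfree_gt0 sr; apply/(dvdn_partP _ r0) => p pr.
have pp : prime p by move: pr; rewrite mem_primes => /andP[].
have pd : p %| r by move: pr; rewrite mem_primes => /and3P[].
have l1 : logn p r = 1%N.
  apply/eqP; rewrite eqn_leq; apply/andP; split; last by rewrite -pfactor_dvdn.
  by rewrite leqNgt -pfactor_dvdn // sr.
rewrite p_part l1 expn1; have := dvdn_trans pd h.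
by rewrite Euclid_dvdX // => /andP[].
Qed.

Section Pairs.
Local Open Scope ring_scope.
Implicit Types (x y z w q a b c : quat) (e u v : int).

(** The vector part of [x] is parallel to [a], so [r] times its norm [n] is a square; [r] being
    squarefree, n = r t^2, and n < r forces n = 0. *)
Lemma commute_small a x (r : nat) : sqfree r -> qre a = 0 -> qnorm a = r%:Z ->
  a * x = x * a -> qnorm x < r%:Z -> x = qz (qre x).
Proof.
move=> sr ha na cx nx.
have c1 : qj a * qk x = qk a * qj x by move: (congr1 qi cx); rewrite !qE ha; lra.
have c2 : qk a * qi x = qi a * qk x by move: (congr1 qj cx); rewrite !qE ha; lra.
have c3 : qi a * qj x = qj a * qi x by move: (congr1 qk cx); rewrite !qE ha; lra.
pose s := qi a * qi x + qj a * qj x + qk a * qk x.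
pose n := qi x ^+ 2 + qj x ^+ 2 + qk x ^+ 2.
have r0 : (0 < r)%N := sqfree_gt0 sr.
have e : r%:Z * n = s ^+ 2.
  rewrite -na /s /n /qnorm ha.
  transitivity ((qi a * qi x + qj a * qj x + qk a * qk x) ^+ 2 +
     (qj a * qk x - qk a * qj x) ^+ 2 + (qk a * qi x - qi a * qk x) ^+ 2 +
     (qi a * qj x - qj a * qi x) ^+ 2); first by ring.
  by rewrite c1 c2 c3 !subrr; ring.
have n0 : 0 <= n by rewrite /n !addr_ge0 ?sqr_ge0.
have nr : n < r%:Z.
  apply: le_lt_trans nx; rewrite /n /qnorm -!addrA lerDr; exact: sqr_ge0.
have : (r %| `|s| ^ 2)%N.
  by rewrite -abszX -e abszM /= dvdn_mulr.
move/(sqfree_dvd_sqr sr); rewrite -[(_ %| _)%N]/(r%:Z %| s)%Z => /dvdzP[t et].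
have en : n = r%:Z * t ^+ 2.
  apply: (@mulfI _ r%:Z); first by lia.
  by rewrite e et; ring.
have t0 : t = 0.
  apply/eqP; apply: contraTT nr => t0; rewrite -leNgt en.
  have : 1 <= t ^+ 2 by rewrite -gtz0_ge1 exprn_even_gt0.
  by move=> hT; rewrite ler_peMr.
have H1 : n = 0 by rewrite en t0; ring.
have [h1 h2 h3] : [/\ qi x ^+ 2 = 0, qj x ^+ 2 = 0 & qk x ^+ 2 = 0].
  by have := (sqr_ge0 (qi x), sqr_ge0 (qj x), sqr_ge0 (qk x)); rewrite /n in H1; case=> [[]]; split; lra.
by apply: quat_eq => //=; apply/eqP; rewrite -sqrf_eq0; apply/eqP.
Qed.

(** [qconj q' * q] commutes with [a] and has norm below [r], so it is an integer [c]. Then e' q = c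
    q' and e q' = c q, and primitivity makes both norms divide [c]; as c^2 = e e', they are
    equal. *)
Lemma move_inj a b q q' (r e e' : nat) : sqfree r -> qre a = 0 -> qre b = 0 ->
  qnorm a = r%:Z -> b * q = q * a -> b * q' = q' * a ->
  qnorm q = e%:Z -> qnorm q' = e'%:Z -> qprim e q -> qprim e' q' ->
  (0 < e)%N -> (0 < e')%N -> (e * e' < r)%N -> e = e'.
Proof.
move=> sr ha hb na bq bq' nq nq' pq pq' e0 e0' lt.
have b2 : qconj q' * b = a * qconj q'.
  have := congr1 qconj bq'; rewrite !qconjM (qconj_pure ha) (qconj_pure hb) mulrN mulNr.
  by move/oppr_inj.
have cx : a * (qconj q' * q) = qconj q' * q * a.
  by rewrite mulrA -b2 -!mulrA bq.
have nx : qnorm (qconj q' * q) = (e * e')%N%:Z.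
  by rewrite qnormM qnorm_conj nq nq' mulrC PoszM.
have ex := commute_small sr ha na cx; rewrite nx in ex.
have {}ex := ex lt; set c := qre _ in ex.
have e1 : qz e'%:Z * q = qz c * q'.
  by rewrite -nq' -qmul_conj -mulrA ex qzC.
have e2 : qz e%:Z * q' = qz c * q.
  have : qconj q * q' = qz c by rewrite -[RHS]qconj_qz -ex qconjM qconjK.
  by move=> h; rewrite -nq -qmul_conj -mulrA h qzC.
have nc : c ^+ 2 = (e * e')%N%:Z by rewrite -qnorm_qz -ex.
have ez : e%:Z != 0 by lia.
have ez' : e'%:Z != 0 by lia.
have div1 : (e'%:Z %| c)%Z.
  have [s [t [u [v [w h]]]]] := qprim_bezout (f := e'%:Z) (x := q') ez' pq'.
  have: qdvd e'%:Z (qz c * q') by exists q.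
  rewrite qz_mulE => /qdvdP /= [d0 d1 d2 d3].
  have -> : c = s * (c * qre q') + t * (c * qi q') + u * (c * qj q') + v * (c * qk q') + w * c * e'%:Z.
    by rewrite -[c in LHS]mulr1 -h; ring.
  by rewrite !rpredD // dvdz_mull.
have div2 : (e%:Z %| c)%Z.
  have [s [t [u [v [w h]]]]] := qprim_bezout (f := e%:Z) (x := q) ez pq.
  have: qdvd e%:Z (qz c * q) by exists q'.
  rewrite qz_mulE => /qdvdP /= [d0 d1 d2 d3].
  have -> : c = s * (c * qre q) + t * (c * qi q) + u * (c * qj q) + v * (c * qk q) + w * c * e%:Z.
    by rewrite -[c in LHS]mulr1 -h; ring.
  by rewrite !rpredD // dvdz_mull.
have c0 : (0 < `|c|)%N.
  rewrite absz_gt0; apply: contra_eq_neq nc => ->; rewrite expr0n /= eq_sym eqz_nat.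
  by rewrite -lt0n muln_gt0 e0.
have l1 := dvdn_leq c0 div1; have l2 := dvdn_leq c0 div2.
have nc' : (`|c| ^ 2 = e * e')%N by rewrite -abszX nc.
by apply/eqP; rewrite eqn_leq; move: l1 l2 nc'; rewrite /=; nia.
Qed.

End Pairs.

(** * Pairs of representations with the same walk *)

Section Intertwine.
Local Open Scope ring_scope.
Implicit Types (x y z w q a b c g h t : quat).

Definition qdot a b : int := qi a * qi b + qj a * qj b + qk a * qk b.

Lemma pure_anticomm a b : qre a = 0 -> qre b = 0 -> a * b + b * a = - qz (2 * qdot a b).
Proof. by move=> ha hb; apply: quat_eq; rewrite ?qE ?ha ?hb /qdot /=; ring. Qed.

Lemma qre_qz n x : qre (qz n * x) = n * qre x.
Proof. by rewrite qz_mulE. Qed.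
Lemma qzCA n x y : x * (qz n * y) = qz n * (x * y).
Proof. by rewrite mulrA qzC -mulrA. Qed.

(** A quaternion-valued trace: the sum of u^-1 F(u) over u = 1, i, j, k. It sends x |-> g x h to 4
    Re(g) h, and serves to show that an operator is not zero. *)
Definition bsum (F : quat -> quat) := F 1 - Quat 0 1 0 0 * F (Quat 0 1 0 0)
  - Quat 0 0 1 0 * F (Quat 0 0 1 0) - Quat 0 0 0 1 * F (Quat 0 0 0 1).

Lemma bsum_conj g h : bsum (fun x => g * x * h) = qz (4 * qre g) * h.
Proof.
rewrite /bsum !mulrA -!mulrBl; congr (_ * h).
by qring.
Qed.
Lemma bsumB F G : bsum (fun x => F x - G x) = bsum F - bsum G.
Proof.
rewrite /bsum !mulrBr; move: (F 1) (G 1) => a b.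
move: (_ * F _) (_ * F _) (_ * F _) (_ * G _) (_ * G _) (_ * G _) => c d e a' b' c'.
by apply: quat_eq; rewrite !qE; ring.
Qed.
Lemma bsumZ n F : bsum (fun x => qz n * F x) = qz n * bsum F.
Proof. by rewrite /bsum !qzCA -!mulrBr. Qed.
Lemma eq_bsum F G : F =1 G -> bsum F = bsum G.
Proof. by move=> h; rewrite /bsum !h. Qed.

(** [r a' - s a] is the component of [a'] orthogonal to [a], scaled to be integral; orthogonal pure
    quaternions anticommute. *)
Lemma pure_ortho (r s : int) a a' : qre a = 0 -> qre a' = 0 -> qnorm a = r -> qdot a a' = s ->
  a * (qz r * a' - qz s * a) = - ((qz r * a' - qz s * a) * a).
Proof.
move=> ha ha' na da; apply/eqP; rewrite -subr_eq0 opprK; apply/eqP.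
rewrite mulrBr mulrBl !qzCA -!mulrA (pure_sqr ha) na.
have -> : a' * a = - qz (2 * s) - a * a'.
  by rewrite -da -(pure_anticomm ha ha') addrAC subrr add0r.
by move: (a * a') => c; apply: quat_eq; rewrite ?qE /=; ring.
Qed.

Lemma ortho_norm (r s : int) a a' : qre a = 0 -> qre a' = 0 -> qnorm a = r -> qnorm a' = r ->
  qdot a a' = s -> qnorm (qz r * a' - qz s * a) = r * (r ^+ 2 - s ^+ 2).
Proof.
move=> ha ha' na na' da.
transitivity (r ^+ 2 * qnorm a' - 2 * r * s * qdot a a' + s ^+ 2 * qnorm a).
  by rewrite !qz_mulE /qnorm /qdot !qE /= ha ha' /=; ring.
by rewrite na na' da; ring.
Qed.

(** Pairs with the same Gram matrix differ by a rotation, which is conjugation by a quaternion. [T1]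
    maps into the solutions of b x = x a, and [T2] into those that satisfy q x = x p as well, being
    multiples of projections; the trace [bsum] of [T2] is not zero, so [T2] is nonzero at some basis
    element. *)
Lemma intertwiner_exists (r s : int) a a' b b' : 
  qre a = 0 -> qre a' = 0 -> qre b = 0 -> qre b' = 0 ->
  qnorm a = r -> qnorm a' = r -> qnorm b = r -> qnorm b' = r ->
  qdot a a' = s -> qdot b b' = s -> r != 0 -> r ^+ 2 != s ^+ 2 ->
  exists t, [/\ t != 0, b * t = t * a & b' * t = t * a'].
Proof.
move=> ha ha' hb hb' na na' nb nb' da db r0 rs.
have [p ep] : exists p, p = qz r * a' - qz s * a by exists (qz r * a' - qz s * a).
have [q eq] : exists q, q = qz r * b' - qz s * b by exists (qz r * b' - qz s * b).
have hp : qre p = 0 by rewrite ep qreD qreN !qz_mulE /= ha ha' !mulr0 subr0.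
have hq : qre q = 0 by rewrite eq qreD qreN !qz_mulE /= hb hb' !mulr0 subr0.
have ap := pure_ortho ha ha' na da; have bq := pure_ortho hb hb' nb db.
rewrite -ep in ap; rewrite -eq in bq.
have [B eB] : exists B, B = r * (r ^+ 2 - s ^+ 2) by exists (r * (r ^+ 2 - s ^+ 2)).
have np : qnorm p = B by rewrite ep eB; apply: ortho_norm.
have nq : qnorm q = B by rewrite eq eB; apply: ortho_norm.
have B0 : B != 0 by rewrite eB mulf_neq0 // subr_eq0.
have [T1 eT1] : exists T1, forall x, T1 x = qz r * x - b * x * a.
  by exists (fun x => qz r * x - b * x * a).
have [T2 eT2] : exists T2, forall x, T2 x = qz B * T1 x - q * T1 x * p.
  by exists (fun x => qz B * T1 x - q * T1 x * p).
have aa := pure_sqr ha; have bb := pure_sqr hb; have pp := pure_sqr hp; have qq := pure_sqr hq.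
rewrite na nb np nq in aa bb pp qq.
have i1 x : b * T1 x = T1 x * a.
  rewrite !eT1 mulrBr mulrBl qzCA -!mulrA aa (mulrA b b) bb mulNr !mulrN.
  rewrite !qzC !opprK addrC; congr (_ + _); by rewrite ?qzCA ?mulrA.
have pa : p * a = - (a * p) by rewrite ap opprK.
have i2 x : b * T2 x = T2 x * a.
  rewrite !eT2 mulrBr mulrBl qzCA i1 !mulrA. rewrite bq; congr (_ - _).
  by rewrite -(mulrA _ p a) pa mulrN !mulNr -(mulrA q b) i1 !mulrA.
have i3 x : q * T2 x = T2 x * p.
  rewrite !eT2 mulrBr mulrBl qzCA -![_ * p * p]mulrA pp -!mulrA (mulrA q q) qq.
  by rewrite mulNr !mulrN !opprK addrC !qzC qzCA.
have i4 x : b' * T2 x = T2 x * a'.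
  apply: (qz_mulI r0).
  have -> : qz r * (b' * T2 x) = (q + qz s * b) * T2 x by rewrite eq subrK mulrA.
  have -> : qz r * (T2 x * a') = T2 x * (p + qz s * a) by rewrite ep subrK qzCA.
  by rewrite mulrDl mulrDr i3 qzCA -mulrA i2.
have qb : qre (q * b) = 0.
  have e1 : qre (b' * b) = - s by rewrite -db /qdot !qE hb hb'; ring.
  rewrite eq mulrBl -!mulrA bb qreD qreN !qre_qz e1.
  by rewrite qreN /=; ring.
have [T0|T0] := eqVneq (T2 1) 0; last by exists (T2 1).
have [Ti|Ti] := eqVneq (T2 (Quat 0 1 0 0)) 0; last by exists (T2 (Quat 0 1 0 0)).
have [Tj|Tj] := eqVneq (T2 (Quat 0 0 1 0)) 0; last by exists (T2 (Quat 0 0 1 0)).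
have [Tk|Tk] := eqVneq (T2 (Quat 0 0 0 1)) 0; last by exists (T2 (Quat 0 0 0 1)).
(* Only the scalar term of [T2] contributes: the other terms have the left factors [b], [q] and
   [q * b], all of real part 0. *)
have S : bsum T2 = qz (4 * r * B).
  rewrite (eq_bsum eT2) (bsumB (fun x => qz B * T1 x)) bsumZ.
  have -> : bsum T1 = qz (4 * r).
    rewrite (eq_bsum eT1) (bsumB (fun x => qz r * x)) bsumZ (bsum_conj b a) hb.
    rewrite -(eq_bsum (F := fun x => 1 * x * 1)); last by move=> x; rewrite mul1r mulr1.
    by rewrite bsum_conj; apply: quat_eq; rewrite ?qE /= ?mulr0 ?mul0r; ring.
  rewrite -(eq_bsum (F := fun x => qz r * (q * x * p) - (q * b) * x * (a * p))); last first.
    by move=> x; rewrite eT1 mulrBr mulrBl qzCA !mulrA.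
  by rewrite bsumB bsumZ !bsum_conj hq qb; apply: quat_eq; rewrite ?qE /=; ring.
move: S; rewrite /bsum T0 Ti Tj Tk !mulr0 !subr0 => /esym/qz_inj/eqP.
by rewrite !mulf_eq0 (negPf r0) (negPf B0).
Qed.
End Intertwine.

(** * Intertwiners of odd norm *)

Section OddIntertwine.
Local Open Scope ring_scope.
Implicit Types (x y z w q a b c g h t : quat).

(* [rot s] is conjugation by [1], [1 + i], [1 + j], [1 + k] for [s = 0, 1, 2, 3]. *)
Definition rotq (s : 'I_4) : quat :=
  match val s with 0%N => 1 | 1%N => Quat 1 1 0 0 | 2%N => Quat 1 0 1 0 | _ => Quat 1 0 0 1 end.
Definition rot (s : 'I_4) x : quat :=
  match val s with
  | 0%N => x
  | 1%N => Quat (qre x) (qi x) (- qk x) (qj x)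
  | 2%N => Quat (qre x) (qk x) (qj x) (- qi x)
  | _ => Quat (qre x) (- qj x) (qi x) (qk x)
  end.
Definition unrot (s : 'I_4) x : quat :=
  match val s with
  | 0%N => x
  | 1%N => Quat (qre x) (qi x) (qk x) (- qj x)
  | 2%N => Quat (qre x) (- qk x) (qj x) (qi x)
  | _ => Quat (qre x) (qj x) (- qi x) (qk x)
  end.

Lemma unrotK s x : rot s (unrot s x) = x.
Proof. by case: s => [[|[|[|m]]]] /= hm; apply: quat_eq; rewrite /= ?opprK. Qed.
Lemma rot_mul s x : rotq s * x = rot s x * rotq s.
Proof.
case: s => [[|[|[|m]]]] /= hm; rewrite /rotq /rot /=; first by rewrite mul1r mulr1.
- by qring.
- by qring.
- by qring.
Qed.
Lemma unrot_mul s x : x * rotq s = rotq s * unrot s x.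
Proof. by rewrite rot_mul unrotK. Qed.
Lemma rotq_neq0 s : rotq s != 0.
Proof. by case: s => [[|[|[|m]]]] hm. Qed.
Lemma qre_rot s x : qre (rot s x) = qre x.
Proof. by case: s => [[|[|[|m]]]] hm. Qed.

Lemma intertwine_unrot s a b y : b * (rotq s * y) = rotq s * y * a -> unrot s b * y = y * a.
Proof.
rewrite mulrA unrot_mul -!mulrA => h; exact: qmulIl (rotq_neq0 s) h.
Qed.

Lemma qprim_exists t : t != 0 -> exists (n : int) y, [/\ n != 0, t = qz n * y & qprim 0 y].
Proof.
move: {2}`|qnorm t|%N (leqnn `|qnorm t|%N) => N.
elim: N t => [|N IH] t hN t0.
  by have := qnorm_gt0 t0; have := qnorm_ge0 t; lia.
pose g := gcdn `|qre t| (gcdn `|qi t| (gcdn `|qj t| `|qk t|)).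
have gd (l : nat) : (l %| g)%N -> qdvd l%:Z t.
  by rewrite !dvdn_gcd => /and4P[h0 h1 h2 h3]; apply/qdvdP.
have [g1|g1] := eqVneq g 1%N.
  exists 1, t; split=> //; first by rewrite mul1r.
  move=> l pl _ /qdvdP[h0 h1 h2 h3].
  have : (l %| g)%N by rewrite !dvdn_gcd; apply/and4P.
  by rewrite g1 dvdn1 => /eqP l1; rewrite l1 in pl.
have g2 : (1 < g)%N.
  have : g != 0%N.
    apply: contra_neq t0 => /eqP; rewrite -dvd0n => /gd /qdvdP.
    rewrite !dvd0z => -[/eqP h0 /eqP h1 /eqP h2 /eqP h3]; exact: quat_eq.
  by move: g1; lia.
have pl := pdiv_prime g2; have [y ey] := gd _ (pdiv_dvd g).
have l2 := prime_gt1 pl.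
have y0 : y != 0 by apply: contra_neq t0 => y0; rewrite ey y0 mulr0.
have [|n [z [n0 ez pz]]] := IH y _ y0.
  have ny := qnorm_gt0 y0; move: hN; rewrite ey qnormM qnorm_qz.
  move: (qnorm y) ny => m ny; rewrite abszM abszX /=.
  have h4 : (4 <= pdiv g ^ 2)%N by rewrite (@leq_exp2r 2 _ 2).
  move: (pdiv g ^ 2)%N h4 => P h4 hN; nia.
exists ((pdiv g)%:Z * n), z; split=> //; last by rewrite ey ez mulrA -qzM.
by rewrite mulf_neq0 //; lia.
Qed.

(** An even norm means that the coordinates fall into two pairs of equal parity. The partner of the
    real coordinate tells which of 1 + i, 1 + j, 1 + k is a left factor. *)
Lemma norm_even_split t : ~~ parz (qnorm t) -> exists s y, t = rotq s * y /\ qnorm t = 2 * qnorm y.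
Proof.
rewrite parz_norm => h.
have H (m n : int) : parz m = parz n -> exists u v : int, m + n = 2 * u /\ n - m = 2 * v.
  move=> e; have /dvdzP[u hu] : (2 %| m + n)%Z by rewrite -parz_dvd parzD e addbb.
  have /dvdzP[v hv] : (2 %| n - m)%Z by rewrite -parz_dvd parzD parzN e addbb.
  by exists u, v; rewrite hu hv; split; ring.
have [[e1 e2]|[[e1 e2]|[e1 e2]]] :
  (parz (qre t) = parz (qi t) /\ parz (qj t) = parz (qk t)) \/
  (parz (qre t) = parz (qj t) /\ parz (qk t) = parz (qi t)) \/
  (parz (qre t) = parz (qk t) /\ parz (qi t) = parz (qj t)).
- by move: h; case: (parz (qre t)) (parz (qi t)) (parz (qj t)) (parz (qk t)) => [] [] [] []; auto.
- have [u [v [h1 h2]]] := H _ _ e1; have [u' [v' [h3 h4]]] := H _ _ e2.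
  exists (inord 1), (Quat u v u' v').
  have [g0 g1 g2 g3] : [/\ qre t = u - v, qi t = u + v, qj t = u' - v' & qk t = u' + v'] by split; lra.
  rewrite /rotq /= inordK // /qnorm /=; split; last by rewrite g0 g1 g2 g3; ring.
  by apply: quat_eq; rewrite !qE /=; lra.
- have [u [v [h1 h2]]] := H _ _ e1; have [u' [v' [h3 h4]]] := H _ _ e2.
  exists (inord 2), (Quat u v' v u').
  have [g0 g1 g2 g3] : [/\ qre t = u - v, qj t = u + v, qk t = u' - v' & qi t = u' + v'] by split; lra.
  rewrite /rotq /= inordK // /qnorm /=; split; last by rewrite g0 g1 g2 g3; ring.
  by apply: quat_eq; rewrite !qE /=; lra.
have [u [v [h1 h2]]] := H _ _ e1; have [u' [v' [h3 h4]]] := H _ _ e2.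
exists (inord 3), (Quat u u' v' v).
have [g0 g1 g2 g3] : [/\ qre t = u - v, qk t = u + v, qi t = u' - v' & qj t = u' + v'] by split; lra.
rewrite /rotq /= inordK // /qnorm /=; split; last by rewrite g0 g1 g2 g3; ring.
by apply: quat_eq; rewrite !qE /=; lra.
Qed.

(** Squares are 0, 1 or 4 modulo 8, so four of them add up to 0 only if all are even. Hence at most
    two factors of norm 2 can be split off. *)
Lemma qprim0_norm8 t : qprim 0 t -> ~~ (8 %| qnorm t)%Z.
Proof.
move=> pt; apply/negP => h8.
have H (m : int) : exists k, m ^+ 2 = 8 * k + (parz m : nat)%:Z \/ (~~ parz m /\ m ^+ 2 = 8 * k + 4).
  have [p|p] := boolP (parz m).
    have [h eh] := parz_double p.
    have : (2 %| h * (h - 1))%Z by rewrite -parz_dvd parzM parzD; case: (parz h).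
    case/dvdzP=> k ek; exists k; left.
    rewrite /=; have -> : m = 2 * h - 1 by lra.
    by transitivity (4 * (h * (h - 1)) + 1); [ring | rewrite ek; ring].
  have /dvdzP[h eh] : (2 %| m)%Z by rewrite -parz_dvd.
  have [q|q] := boolP (parz h).
    have [k ek] := parz_double q.
    have : exists j, h ^+ 2 = 2 * j + 1.
      exists (2 * k ^+ 2 - 2 * k); have -> : h = 2 * k - 1 by lra.
      by ring.
    case=> j ej; exists j; right; split=> //.
    by rewrite eh exprMn ej; ring.
  have /dvdzP[k ek] : (2 %| h)%Z by rewrite -parz_dvd.
  by exists (2 * k ^+ 2); left; rewrite eh ek /=; ring.
apply: (pt 2%N) => //; apply/qdvdP; rewrite -!parz_dvd.
move: h8 => /dvdzP[n]; rewrite /qnorm.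
have [k0 h0] := H (qre t); have [k1 h1] := H (qi t); have [k2 h2] := H (qj t); have [k3 h3] := H (qk t).
move: h0 h1 h2 h3.
case: (parz (qre t)); case: (parz (qi t)); case: (parz (qj t)); case: (parz (qk t)) => /= h0 h1 h2 h3 h; split=> //; exfalso;
  case: h0 => [h0|[//]]; case: h1 => [h1|[//]]; case: h2 => [h2|[//]]; case: h3 => [h3|[//]]; lia.
Qed.

Lemma qprim_mull (f : int) x y : qprim f (x * y) -> qprim f y.
Proof. by move=> h l pl lf hy; apply: (h l pl lf); apply: qdvdMl. Qed.

(** After removing the content of [t], at most two left factors [rotq s] remain to be stripped, and
    each is absorbed by rotating the target. The index 0 is the identity and pads when fewer occur,
    which gives 16 choices in all. *)
Lemma odd_intertwiner a a' b b' t : t != 0 -> b * t = t * a -> b' * t = t * a' ->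
  exists s1 s2 c c' y, [/\ b = rot s1 (rot s2 c), b' = rot s1 (rot s2 c'),
     c * y = y * a, c' * y = y * a' & qprim 0 y /\ parz (qnorm y)].
Proof.
move=> t0 ht ht'; have [n [y [n0 ey py]]] := qprim_exists t0.
have cancel g g' : g * t = t * g' -> g * y = y * g'.
  by rewrite ey qzCA -mulrA => /(qz_mulI n0).
have {ht}h1 := cancel _ _ ht; have {ht'}h2 := cancel _ _ ht'.
have [p1|p1] := boolP (parz (qnorm y)).
  by exists ord0, ord0, b, b', y.
have [s1 [y1 [e1 n1]]] := norm_even_split p1.
rewrite e1 in h1 h2; have {}h1 := intertwine_unrot h1; have {}h2 := intertwine_unrot h2.
have q1 : qprim 0 y1 by rewrite e1 in py; apply: qprim_mull py.
have [p2|p2] := boolP (parz (qnorm y1)).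
  by exists s1, ord0, (unrot s1 b), (unrot s1 b'), y1; rewrite /= !unrotK.
have [s2 [y2 [e2 n2]]] := norm_even_split p2.
rewrite e2 in h1 h2; have {}h1 := intertwine_unrot h1; have {}h2 := intertwine_unrot h2.
have q2 : qprim 0 y2 by rewrite e2 in q1; apply: qprim_mull q1.
exists s1, s2, (unrot s2 (unrot s1 b)), (unrot s2 (unrot s1 b')), y2; rewrite !unrotK.
split=> //; split=> //; apply: contraT => p3.
have /dvdzP[k ek] : (2 %| qnorm y2)%Z by rewrite -parz_dvd.
case/negP: (qprim0_norm8 py); apply/dvdzP; exists k; rewrite n1 n2 ek; ring.
Qed.
End OddIntertwine.

(** * Counting by fibres, and square roots of - r *)

Section Counting.
Variables (A C : eqType).

Lemma seq_choice (s : seq A) (c0 : C) (R : A -> C -> Prop) :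
  (forall x, x \in s -> exists c, R x c) -> exists f, forall x, x \in s -> R x (f x).
Proof.
elim: s => [|x s IH] h; first by exists (fun _ => c0).
have [f hf] := IH (fun y ys => h y (mem_behead (s := x :: s) ys)).
have [c hc] := h x (mem_head x s).
exists (fun y => if y == x then c else f y) => y; rewrite inE.
by case: eqP => [-> //|_ /= /hf].
Qed.

Lemma size_fiber (s : seq A) (T : seq C) (f : A -> C) k :
  (forall x, x \in s -> f x \in T) ->
  (forall c, c \in T -> size [seq x <- s | f x == c] <= k) -> size s <= k * size T.
Proof.
elim: T s => [|c T IH] s h1 h2.
  by case: s h1 h2 => // x s /(_ x); rewrite inE eqxx => /(_ isT).
have := IH [seq x <- s | f x != c].
rewrite -(count_predC (fun x => f x == c) s) -!size_filter mulnS => H.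
apply: leq_add; first by apply: h2; rewrite mem_head.
apply: H => [x|c' hc'].
  by rewrite mem_filter => /andP[n /h1]; rewrite inE (negPf n).
rewrite -filter_predI; apply: leq_trans (h2 c' _); last by rewrite inE hc' orbT.
rewrite !size_filter; apply: sub_count => x /= /andP[]; by [].
Qed.

Lemma count_rel (s : seq A) (T : seq C) (R : A -> C -> Prop) k : uniq s ->
  (forall x, x \in s -> exists c, c \in T /\ R x c) ->
  (forall c s', c \in T -> uniq s' -> (forall x, x \in s' -> R x c) -> size s' <= k) ->
  size s <= k * size T.
Proof.
move=> us h1 h2; case: s us h1 => [//|x0 s'] us h1; set s := x0 :: s' in us h1 *.
have [c0 _] := h1 x0 (mem_head _ _).
have [f hf] := seq_choice c0 h1.
apply: (@size_fiber s T f) => [x /hf[]//|c hc].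
apply: (h2 c) => //; first exact: filter_uniq.
by move=> x; rewrite mem_filter => /andP[/eqP <- /hf[]].
Qed.
End Counting.

Lemma sqrt_roots_split (f r l l0 : nat) : 0 < f -> f %| l ^ 2 + r -> f %| l0 ^ 2 + r ->
  f %/ gcdn f `|(Posz l - Posz l0)%R|%N %| l + l0.
Proof.
move=> f0 h1 h2; set d := `|_ - _|%N.
have fd : f %| d * (l + l0).
  have -> : d * (l + l0) = `|(Posz (l ^ 2 + r) - Posz (l0 ^ 2 + r))%R|%N.
    by rewrite /d -(absz_nat (l + l0)) -abszM; congr `|_|%N; rewrite !PoszD -!mulnn !PoszM; ring.
  have: (Posz f %| (Posz (l ^ 2 + r) - Posz (l0 ^ 2 + r))%R)%Z by apply: rpredB; rewrite dvdzE.
  by rewrite dvdzE.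
set g := gcdn f d; have g0 : 0 < g by rewrite gcdn_gt0 f0.
have ef : f = f %/ g * g by rewrite divnK // dvdn_gcdl.
have ed : d = d %/ g * g by rewrite divnK // dvdn_gcdr.
have cop : coprime (f %/ g) (d %/ g).
  by rewrite /coprime -(eqn_pmul2r g0) muln_gcdl -ef -ed mul1n.
rewrite -(Gauss_dvdr _ cop) -(dvdn_pmul2r g0) -ef.
by rewrite mulnAC -ed.
Qed.

(** For a fixed root [l0] the map from [l] to g = gcd(f, l - l0) is injective: [l] is determined
    modulo g and modulo f / g, which are coprime, for a common prime would divide [l0] and its
    square would divide [r]. *)
Lemma sqrt_roots_sqfree (r f : nat) : sqfree r -> odd f ->
  size [seq l <- iota 0 f | f %| l ^ 2 + r] <= size (divisors f).
Proof.
move=> sr fo; have f0 : 0 < f by case: f fo.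
set s := [seq _ <- _ | _].
have us : uniq s by rewrite filter_uniq ?iota_uniq.
case Es: s => [//|l0 s']; rewrite -Es.
have : l0 \in s by rewrite Es mem_head.
rewrite mem_filter => /andP[h0 _].
pose F1 l := gcdn f `|(Posz l - Posz l0)%R|%N.
have F1d l : F1 l %| f by rewrite dvdn_gcdl.
have F0 l : 0 < F1 l by rewrite gcdn_gt0 f0.
rewrite -(size_map F1); apply: uniq_leq_size; last first.
  by move=> x /mapP[l _ ->]; rewrite -dvdn_divisors.
rewrite map_inj_in_uniq // => l l'.
rewrite !mem_filter !mem_iota /= !add0n => /andP[hl lf] /andP[hl' lf'] e.
have d1 := sqrt_roots_split f0 hl h0; have d2 := sqrt_roots_split f0 hl' h0.
rewrite -/(F1 l) in d1; rewrite -/(F1 l') -e in d2.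
have cop : coprime (F1 l) (f %/ F1 l).
  rewrite coprime_has_primes //; last by rewrite divn_gt0 // dvdn_leq.
  apply/hasPn => q; rewrite !mem_primes => /and3P[pq _ q2]; apply/negP => /and3P[_ _ q1].
  have q3 : q %| l + l0 := dvdn_trans q2 d1.
  have q4 : q %| `|(Posz l - Posz l0)%R|%N := dvdn_trans q1 (dvdn_gcdr _ _).
  have qo : odd q by apply: dvdn_odd (dvdn_trans q1 (F1d l)) fo.
  have q5 : q %| 2 * l0.
    have: (Posz q %| (Posz (l + l0) - (Posz l - Posz l0))%R)%Z by apply: rpredB; rewrite dvdzE.
    have -> : (Posz (l + l0) - (Posz l - Posz l0))%R = Posz (2 * l0) by rewrite PoszM PoszD; ring.
    by rewrite dvdzE.
  have q6 : q %| l0.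
    by move: q5; rewrite Gauss_dvdr // coprimen2.
  have q7 : q ^ 2 %| f by rewrite -mulnn -(divnK (F1d l)) dvdn_mul.
  have q8 : q ^ 2 %| l0 ^ 2 by rewrite dvdn_exp2r.
  by move: (sr q pq); rewrite -(dvdn_addr _ q8) (dvdn_trans q7 h0).
have e1 : F1 l %| `|(Posz l - Posz l')%R|%N.
  have: (Posz (F1 l) %| ((Posz l - Posz l0) - (Posz l' - Posz l0))%R)%Z.
    by apply: rpredB; rewrite dvdzE /= ?dvdn_gcdr // e dvdn_gcdr.
  have -> : ((Posz l - Posz l0) - (Posz l' - Posz l0))%R = (Posz l - Posz l')%R by ring.
  by rewrite dvdzE.
have e2 : f %/ F1 l %| `|(Posz l - Posz l')%R|%N.
  have: (Posz (f %/ F1 l) %| (Posz (l + l0) - Posz (l' + l0))%R)%Z by apply: rpredB; rewrite dvdzE.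
  have -> : (Posz (l + l0) - Posz (l' + l0))%R = (Posz l - Posz l')%R by rewrite !PoszD; ring.
  by rewrite dvdzE.
have : f %| `|(Posz l - Posz l')%R|%N.
  by rewrite -(divnK (F1d l)) Gauss_dvd 1?coprime_sym // e2.
move=> h; have lt : `|(Posz l - Posz l')%R|%N < f by clear -lf lf'; lia.
case: (posnP `|(Posz l - Posz l')%R|%N) => [z|p]; first by clear -z; lia.
by move: lt; rewrite ltnNge (dvdn_leq p h).
Qed.

(** * Pairs of representations with a given inner product *)

Section PairCount.
Local Open Scope ring_scope.
Implicit Types (x y z w q a b c g h t : quat).

Lemma sandwich x w : x * w * x = qz (2 * qre (x * w)) * x - qconj w * qz (qnorm x).
Proof.
rewrite -qtr_conj mulrDl qconjM -(qconj_mul x) -!mulrA.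
by rewrite [qconj w * _]mulrA addrK.
Qed.

(** Modulo [f], [qconj y] equals [qconj y * v * qconj y], so [a * qconj y] is
    [qconj y * (c * v) * qconj y], which [sandwich] reduces to an integer times [qconj y]. So [a]
    acts on [qconj y] as a scalar - l, and multiplying (a + l) [qconj y] by [y] shows that [y] is a
    right factor of a + l. *)
Lemma intertwiner_root (f : nat) a c y : odd f -> qprim f%:Z y -> qnorm y = f%:Z ->
  qre a = 0 -> qre c = 0 -> c * y = y * a ->
  exists2 l : nat, (l < f)%N & exists k, a + qz l%:Z = k * y.
Proof.
move=> fo py ny ha hc e.
have f0 : f%:Z != 0 by rewrite eqz_nat; apply: contraTneq fo => ->.
have pf : parz f%:Z by [].
have py' : qprim f%:Z (qconj y).
  by move=> l pl lf /qdvd_conj; rewrite qconjK; apply: py.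
have e' : a * qconj y = qconj y * c.
  by have := congr1 qconj e; rewrite !qconjM (qconj_pure ha) (qconj_pure hc) mulrN mulNr => /oppr_inj.
have [v hv] := qprim_idem pf py'.
have [z ez] : qdvd f%:Z (qconj y - qconj y * v * qconj y).
  by apply: hv; rewrite qconjK qconj_mul ny; exists 1; rewrite mulr1.
pose l0 := - (2 * qre (qconj y * (c * v))).
have [k ek] : exists k, a + qz l0 = k * y.
  have E : (a + qz l0) * qconj y = qz f%:Z * (a * z - qconj (c * v)).
    rewrite mulrDl; apply/eqP; rewrite -subr_eq0; apply/eqP.
    have -> : a * qconj y = qz f%:Z * (a * z) + qconj y * (c * v) * qconj y.
      have h : a * (qconj y * v * qconj y) = qconj y * (c * v) * qconj y by rewrite !mulrA e'.
      by rewrite -qzCA -ez mulrBr h subrK.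
    rewrite sandwich qnorm_conj ny /l0 qzN mulNr (mulrBr (qz f%:Z)) (qzC f%:Z).
    move: (qz f%:Z * (a * z)) (qz _ * qconj y) (qz f%:Z * qconj _) => A B D.
    by apply: quat_eq; rewrite !qE /=; ring.
  exists (a * z - qconj (c * v)); apply: (qz_mulI f0).
  by rewrite mulrA -E -mulrA qconj_mul ny qzC.
exists `|(l0 %% f%:Z)%Z|%N.
  by have := ltz_pmod l0 (d := f%:Z); have := modz_ge0 l0 f0; lia.
exists (k - qz (l0 %/ f%:Z)%Z * qconj y).
rewrite gez0_abs ?modz_ge0 // mulrBl -ek -mulrA qconj_mul ny -qzM.
have -> : qz l0 = qz ((l0 %/ f%:Z)%Z * f%:Z) + qz (l0 %% f%:Z)%Z by rewrite -qzD -divz_eq.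
by rewrite [qz _ + qz _]addrC addrA addrK.
Qed.

(** Both [y1] and [y2] generate the left ideal of a + l and [f]. Primitivity holds because a prime
    dividing a + l would enter the squarefree norm of [a] with its square. *)
Lemma intertwiner_unique (r f l : nat) a y1 y2 k1 k2 : sqfree r -> odd f -> qre a = 0 ->
  qnorm a = r%:Z -> (f %| l ^ 2 + r)%N ->
  a + qz l%:Z = k1 * y1 -> a + qz l%:Z = k2 * y2 -> qnorm y1 = f%:Z -> qnorm y2 = f%:Z ->
  exists2 e, qnorm e = 1 & y1 = e * y2.
Proof.
move=> sr fo ha na fl e1 e2 n1 n2.
have f0 : f%:Z != 0 by rewrite eqz_nat; apply: contraTneq fo => ->.
have pf : parz f%:Z by [].
have hp : qprim f%:Z (a + qz l%:Z).
  move=> q pq qf /qdvdP[]; rewrite !qE /= !addr0 => _ d1 d2 d3.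
  have: (q%:Z ^+ 2 %| qnorm a)%Z.
    by rewrite /qnorm ha expr0n add0r !rpredD // dvdz_exp2r.
  by rewrite na dvdzE abszX /=; apply/negP; apply: sr.
have hn : (f%:Z %| qnorm (a + qz l%:Z))%Z.
  have -> : qnorm (a + qz l%:Z) = (l ^ 2 + r)%N%:Z.
    by rewrite PoszD -na -mulnn PoszM /qnorm !qE ha /=; ring.
  by [].
have [q [u [v [k [k' [eq1 eq2 eq3 nq]]]]]] := qprim_gcd_norm fo hp hn.
have H y kk : a + qz l%:Z = kk * y -> qnorm y = f%:Z -> exists2 e, qnorm e = 1 & y = e * q.
  move=> ey ny; have [e ee] : exists e, y = e * q.
    apply: (qprim_lideal pf hp eq1 eq2); first by exists k'.
    by rewrite ey qconjM mulrA qmul_conj ny; exists (qconj kk).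
  exists e => //; apply: (mulIf f0); rewrite mul1r -{1}nq -qnormM -ee //.
have [x1 nx1 ex1] := H _ _ e1 n1; have [x2 nx2 ex2] := H _ _ e2 n2.
exists (x1 * qconj x2); first by rewrite qnormM qnorm_conj nx1 nx2.
by rewrite ex2 -mulrA (mulrA (qconj x2)) qconj_mul nx2 mul1r.
Qed.

Definition qunits := [:: Quat 1 0 0 0; Quat (-1) 0 0 0; Quat 0 1 0 0; Quat 0 (-1) 0 0;
  Quat 0 0 1 0; Quat 0 0 (-1) 0; Quat 0 0 0 1; Quat 0 0 0 (-1)].

Lemma qnorm1_units e : qnorm e = 1 -> e \in qunits.
Proof.
case: e => a b c d; rewrite /qnorm /= => h.
have S (m : int) : m = 0 \/ m = 1 \/ m = -1 \/ 4 <= m ^+ 2.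
  have [h1|h1] := leP 2 `|m|; last by lia.
  right; right; right; rewrite -[m ^+ 2]real_normK ?num_real //.
  by rewrite (_ : 4 = 2 ^+ 2) // lerXn2r ?nnegrE.
have Z (m : int) : m ^+ 2 <= 0 -> m = 0.
  by move=> hm; apply/eqP; rewrite -sqrf_eq0 eq_le hm sqr_ge0.
have := (sqr_ge0 a, sqr_ge0 b, sqr_ge0 c, sqr_ge0 d) => -[[[a0 b0] c0] d0].
have [ea|[ea|[ea|ea]]] := S a; last by lra.
- have [eb|[eb|[eb|eb]]] := S b; last by lra.
  + have [ec|[ec|[ec|ec]]] := S c; last by lra.
    * have [ed|[ed|[ed|ed]]] := S d; last by lra.
      by rewrite ea eb ec ed in h *.
      by rewrite ea eb ec ed in h *.
      by rewrite ea eb ec ed in h *.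
    * have -> : d = 0 by apply: Z; rewrite ec in h; clear -h a0 b0; lra.
    by rewrite ea eb ec.
    * have -> : d = 0 by apply: Z; rewrite ec in h; clear -h a0 b0; lra.
    by rewrite ea eb ec.
  + have -> : d = 0 by apply: Z; rewrite eb in h; clear -h a0 c0; lra.
    have -> : c = 0 by apply: Z; rewrite eb in h; clear -h a0 d0; lra.
    by rewrite ea eb.
  + have -> : d = 0 by apply: Z; rewrite eb in h; clear -h a0 c0; lra.
    have -> : c = 0 by apply: Z; rewrite eb in h; clear -h a0 d0; lra.
    by rewrite ea eb.
- have -> : d = 0 by apply: Z; rewrite ea in h; clear -h b0 c0; lra.
  have -> : c = 0 by apply: Z; rewrite ea in h; clear -h b0 d0; lra.
  have -> : b = 0 by apply: Z; rewrite ea in h; clear -h c0 d0; lra.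
    by rewrite ea.
- have -> : d = 0 by apply: Z; rewrite ea in h; clear -h b0 c0; lra.
  have -> : c = 0 by apply: Z; rewrite ea in h; clear -h b0 d0; lra.
  have -> : b = 0 by apply: Z; rewrite ea in h; clear -h c0 d0; lra.
    by rewrite ea.
Qed.

Definition root_pairs (r M : nat) : seq (nat * nat) :=
  [seq (f, l) | f <- [seq f <- divisors M | odd f], l <- [seq l <- iota 0 f | f %| l ^ 2 + r]%N].

Lemma size_root_pairs r M : sqfree r -> (0 < M)%N ->
  (size (root_pairs r M) <= size (divisors M) ^ 2)%N.
Proof.
move=> sr M0; rewrite size_allpairs_dep -mulnn.
apply: (@leq_trans (sumn [seq size (divisors M) | f <- [seq f <- divisors M | odd f]])).
  have : all (fun f => odd f && (f %| M)%N) [seq f <- divisors M | odd f].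
    by apply/allP => f; rewrite mem_filter -dvdn_divisors.
  elim: [seq f <- divisors M | odd f] => //= f fs IH /andP[/andP[fo fM] /IH h].
  apply: leq_add h; apply: leq_trans (sqrt_roots_sqfree sr fo) _.
  apply: uniq_leq_size; first exact: divisors_uniq.
  by move=> d; rewrite -!dvdn_divisors // ?(dvdn_gt0 M0) // => /dvdn_trans ->.
rewrite sumnE big_map big_const_seq iter_addn_0 leq_mul2l; apply/orP; right.
by rewrite count_predT size_filter count_size.
Qed.

(** One pair is fixed, and every other one arises from it by an intertwiner, of odd norm [f] after
    one of 16 double rotations. With its root [l] this norm determines the intertwiner up to 8
    units, whence 128; and [f] divides r^2 - s^2, so divisors bound the choices of [f] and [l]. *)
Lemma pair_count (r : nat) (s : int) (S : seq (quat * quat)) : sqfree r ->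
  r%:Z ^+ 2 != s ^+ 2 -> uniq S ->
  (forall p, p \in S -> [/\ qre p.1 = 0, qre p.2 = 0, qnorm p.1 = r%:Z, qnorm p.2 = r%:Z &
    qdot p.1 p.2 = s]) ->
  (size S <= 128 * size (divisors `|r%:Z ^+ 2 - s ^+ 2|) ^ 2)%N.
Proof.
move=> sr rs uS hS; set M := `|_|%N.
have M0 : (0 < M)%N by rewrite absz_gt0 subr_eq0.
have r0 : r%:Z != 0 by rewrite eqz_nat -lt0n sqfree_gt0.
case ES : S => [//|[a a'] S']; rewrite -ES.
have [/= ha ha' na na' da] : [/\ qre (a, a').1 = 0, qre (a, a').2 = 0, qnorm (a, a').1 = r%:Z, qnorm (a, a').2 = r%:Z & qdot (a, a').1 (a, a').2 = s].
  by apply: hS; rewrite ES mem_head.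
pose T := [seq (u, p) | u <- enum {: 'I_4 * 'I_4}, p <- root_pairs r M].
pose R (p : quat * quat) (c : ('I_4 * 'I_4) * (nat * nat)) :=
  exists c1 c2 y k, [/\ p = (rot c.1.1 (rot c.1.2 c1), rot c.1.1 (rot c.1.2 c2)),
    c1 * y = y * a, c2 * y = y * a', qnorm y = c.2.1%:Z & a + qz c.2.2%:Z = k * y].
have sT : size T = (16 * size (root_pairs r M))%N.
  by rewrite size_allpairs -cardE card_prod card_ord.
apply: (@leq_trans (8 * size T)); last first.
  by rewrite sT mulnA leq_mul2l size_root_pairs.
apply: (@count_rel _ _ S T R) => //.
- move=> [b b'] /hS[/= hb hb' nb nb' db].
  have [t [t0 t1 t2]] := intertwiner_exists ha ha' hb hb' na na' nb nb' da db r0 rs.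
  have [s1 [s2 [c [c' [y [e1 e2 e3 e4 [py oy]]]]]]] := odd_intertwiner t0 t1 t2.
  have hc : qre c = 0 by move: hb; rewrite e1 !qre_rot.
  have hc' : qre c' = 0 by move: hb'; rewrite e2 !qre_rot.
  pose f := `|qnorm y|%N; have ef : qnorm y = f%:Z by rewrite gez0_abs // qnorm_ge0.
  have pyf : qprim f%:Z y by move=> l pl _; apply: (py l pl); rewrite dvdz0.
  have [l lf [k ek]] := intertwiner_root oy pyf ef ha hc e3.
  have [m mf [k' ek']] := intertwiner_root oy pyf ef ha' hc' e4.
  have d1 : (f%:Z %| l%:Z ^+ 2 + r%:Z)%Z.
    apply/dvdzP; exists (qnorm k); rewrite -ef -qnormM -ek -na /qnorm !qE ha /=; ring.
  have d2 : (f%:Z %| m%:Z ^+ 2 + r%:Z)%Z.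
    apply/dvdzP; exists (qnorm k'); rewrite -ef -qnormM -ek' -na' /qnorm !qE ha' /=; ring.
  (* Both a + l and a' + m have the right factor [y], so the first times the conjugate of the second
     is divisible by the norm of [y]; its real part is l m + s. *)
  have d3 : (f%:Z %| l%:Z * m%:Z + s)%Z.
    have : qdvd f%:Z ((a + qz l%:Z) * qconj (a' + qz m%:Z)).
      by rewrite ek ek' qconjM mulrA -(mulrA k) qmul_conj ef qzC -mulrA; exists (k * qconj k').
    have E : qre ((a + qz l%:Z) * qconj (a' + qz m%:Z)) = l%:Z * m%:Z + s.
      by rewrite -da /qdot !qE /= ha ha'; ring.
    by case/qdvdP; rewrite E.
  exists ((s1, s2), (f, l)); split; last first.
    by exists c, c', y, k; split=> //=; rewrite -e1 -e2.
  apply/allpairsP; exists ((s1, s2), (f, l)); split=> //=; first by rewrite mem_enum.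
  apply/allpairsPdep; exists f, l; split=> //.
    rewrite mem_filter -dvdn_divisors // andbC; apply/andP; split; last exact: oy.
    change (f%:Z %| r%:Z ^+ 2 - s ^+ 2)%Z.
    apply: (dvdz_comb3 (c := r%:Z) (d := - l%:Z ^+ 2) (g := l%:Z * m%:Z - s) d1 d2 d3).
    by ring.
  by rewrite mem_filter mem_iota /= add0n lf andbT; move: d1; rewrite dvdzE.
- move=> [[s1 s2] [f l]] S1 cT uS1 hS1.
  case ES1 : S1 => [//|p0 S1']; rewrite -ES1.
  have [c1 [c2 [y [k [/= ep ec1 ec2 ny ek]]]]] : R p0 ((s1, s2), (f, l)).
    by apply: hS1; rewrite ES1 mem_head.
  pose G (e : quat) : quat * quat := (rot s1 (rot s2 (e * c1 * qconj e)), rot s1 (rot s2 (e * c2 * qconj e))).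
  apply: (@leq_trans (size (map G qunits))); last by rewrite size_map.
  apply: uniq_leq_size => // p /hS1 [c3 [c4 [y' [k' [/= ep' ec3 ec4 ny' ek']]]]].
  move: cT => /allpairsP[[u [f' l']]] /= [_ /allpairsPdep[f1 [l1 [h1 h2 [-> ->]]]] [_ ef el]].
  subst f1 l1.
  move: h1 h2; rewrite mem_filter => /andP[fo _]; rewrite mem_filter => /andP[fl _].
  have [e ne ee] := intertwiner_unique sr fo ha na fl ek' ek ny' ny.
  suff -> : p = G e by exact: (map_f G (qnorm1_units ne)).
  have y0 : y != 0.
    by apply: contraTneq fo => y0; move: ny; rewrite y0 /= => -[<-].
  have F g h b : g * y' = y' * b -> h * y = y * b -> g = e * h * qconj e.
    move=> eg eh; have e0 : g * e = e * h.
      by apply: (qmulIr y0); rewrite -!mulrA eh -ee eg ee mulrA.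
    by rewrite -e0 -mulrA qmul_conj ne mulr1.
  by rewrite ep' /G (F _ _ _ ec3 ec1) (F _ _ _ ec4 ec2).
Qed.
End PairCount.

(** * The ergodic inequality *)

Lemma absz_modz_lt (x : int) (F : nat) : 0 < F -> `|(x %% Posz F)%Z|%N < F.
Proof.
move=> F0; have Fz : Posz F != 0%R by case: F F0.
by have := ltz_pmod x (d := Posz F); have := modz_ge0 x Fz; lia.
Qed.

Section CauchySeq.
Variables (A C : eqType) (f : A -> C).

Lemma cauchy_seq (T : seq C) (c : C -> nat) :
  (\sum_(x <- T) c x) ^ 2 <= size T * \sum_(x <- T) c x ^ 2.
Proof.
rewrite -(leq_pmul2l (isT : 0 < 2)) -mulnn big_distrlr /= big_distrr /=.
have -> : 2 * (size T * \sum_(x <- T) c x ^ 2) = \sum_(x <- T) \sum_(y <- T) (c x ^ 2 + c y ^ 2).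
  under [RHS]eq_bigr do rewrite big_split /= big_const_seq iter_addn_0 count_predT mulnC.
  rewrite big_split /= -big_distrr /= [X in _ = _ + X]big_const_seq iter_addn_0 count_predT.
  by rewrite [X in _ = _ + X]mulnC addnn mul2n.
apply: leq_sum => x _; rewrite big_distrr /=; apply: leq_sum => y _; exact: nat_Cauchy.
Qed.

Definition fiber_pairs (s : seq A) :=
  [seq p <- [seq (a, b) | a <- s, b <- s] | f p.1 == f p.2].

Lemma sum_count_fiber (s t : seq A) (T : seq C) : uniq T -> (forall x, x \in s -> f x \in T) ->
  \sum_(x <- s) count (fun b => f x == f b) t = 
  \sum_(c <- T) count (fun b => f b == c) s * count (fun b => f b == c) t.
Proof.
move=> uT; elim: s => [|x s IH] h.
  by rewrite big_nil big1 // => c _; rewrite mul0n.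
rewrite big_cons IH; last by move=> y ys; apply: h; rewrite inE ys orbT.
under [RHS]eq_bigr do rewrite /= mulnDl.
rewrite big_split /=; congr (_ + _).
rewrite (bigD1_seq (f x)) //=; last by apply: h; rewrite mem_head.
rewrite eqxx mul1n big1 ?addn0; first by apply: eq_count => b /=; rewrite eq_sym.
by move=> c; rewrite eq_sym => /negPf ->.
Qed.

Lemma size_fiber_pairs (s : seq A) (T : seq C) : uniq T -> (forall x, x \in s -> f x \in T) ->
  size (fiber_pairs s) = \sum_(c <- T) count (fun b => f b == c) s ^ 2.
Proof.
move=> uT h; rewrite -(eq_bigr _ (fun c _ => esym (mulnn _))) -sum_count_fiber //.
rewrite /fiber_pairs size_filter.
have E (t : seq A) : count (fun p : A * A => f p.1 == f p.2) [seq (a, b) | a <- t, b <- s]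
   = \sum_(x <- t) count (fun b => f x == f b) s.
  elim: t => [|x t IH]; first by rewrite big_nil.
  by rewrite big_cons allpairs_cons count_cat IH count_map.
exact: E.
Qed.

Lemma size_sum_fiber (s : seq A) (T : seq C) : uniq T -> (forall x, x \in s -> f x \in T) ->
  size s = \sum_(c <- T) count (fun b => f b == c) s.
Proof.
move=> uT; elim: s => [|x s IH] h; first by rewrite big1.
rewrite /= IH; last by move=> y ys; apply: h; rewrite inE ys orbT.
rewrite big_split /= -add1n; congr (_ + _).
rewrite (bigD1_seq (f x)) //=; last by apply: h; rewrite mem_head.
rewrite eqxx big1 // => c; by rewrite eq_sym => /negPf ->.
Qed.

Lemma sqr_size_le (s : seq A) : size s ^ 2 <= size (undup (map f s)) * size (fiber_pairs s).
Proof.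
have uT := undup_uniq (map f s).
have h x : x \in s -> f x \in undup (map f s) by move=> xs; rewrite mem_undup map_f.
rewrite (size_fiber_pairs uT h); apply: leq_trans (cauchy_seq _ _).
by rewrite -size_sum_fiber.
Qed.
End CauchySeq.

Section WalkCount.
Local Open Scope ring_scope.
Implicit Types (a b c : quat) (e u : int).

(** The matrix of a + u is singular modulo [F], and the condition on u + e qi a makes its first
    diagonal entry a unit, so its kernel contains a column with last entry 1: the line at infinity
    is excluded. *)
Lemma line_exists (F p : nat) (r e u : int) a : prime p -> (forall l, prime l -> l %| F -> l = p)%N ->
  (0 < F)%N -> qre a = 0 -> qnorm a = r -> (F%:Z %| u ^+ 2 + r)%Z -> (F%:Z %| e ^+ 2 + 1)%Z ->
  ~~ (p%:Z %| u + e * qi a)%Z ->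
  exists2 x : nat, (x < F)%N & line F%:Z e x (a + qz u).
Proof.
move=> pp Fp F0 ha na hu he hg; set g := u + e * qi a in hg.
have cop : coprimez g F%:Z.
  rewrite coprimezE /=; rewrite coprime_sym coprime_has_primes ?absz_gt0 //; last first.
    by apply: contraNneq hg => ->; rewrite dvdz0.
  apply/hasPn => q; rewrite !mem_primes => /and3P[pq _ qg]; apply/negP => /and3P[_ _ qF].
  by move: hg; rewrite dvdzE /= -(Fp q pq qF) qg.
have /coprimezP[[s t] /= st] := cop.
have F0' : F%:Z != 0 by lia.
pose x0 := s * f12 e (a + qz u).
have eg : f11 e (a + qz u) = g by rewrite /f11 !qE ha /= /g; ring.
have l1 : (F%:Z %| f12 e (a + qz u) - x0 * f11 e (a + qz u))%Z.
  rewrite eg /x0; apply/dvdzP; exists (t * f12 e (a + qz u)).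
  rewrite -[X in X - _]mul1r -st; ring.
have l2 : (F%:Z %| f22 e (a + qz u) - x0 * f21 e (a + qz u))%Z.
  suff: (F%:Z %| g * (f22 e (a + qz u) - x0 * f21 e (a + qz u)))%Z.
    by rewrite Gauss_dvdzr // coprimez_sym.
  have /dvdzP[k hk] := l1.
  apply: (dvdz_comb3 (c := 1) (d := - (qi a ^+ 2 + qk a ^+ 2)) (g := f21 e (a + qz u)) hu he l1).
  have hn : qnorm (a + qz u) = u ^+ 2 + r by rewrite -na /qnorm !qE ha /=; ring.
  have := f_det e (a + qz u); rewrite hn !qE /= eg addr0 addr0 => hd.
  move/eqP: hd; rewrite subr_eq => /eqP hd.
  rewrite mulrBr hd; ring.
exists `|(x0 %% F%:Z)%Z|%N.
  exact: absz_modz_lt.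
rewrite gez0_abs ?modz_ge0 //; split.
  apply: (dvdz_comb2 (c := 1) (d := (x0 %/ F%:Z)%Z * f11 e (a + qz u)) l1 (dvdzz F%:Z)).
  by rewrite /modz; ring.
apply: (dvdz_comb2 (c := 1) (d := (x0 %/ F%:Z)%Z * f21 e (a + qz u)) l2 (dvdzz F%:Z)).
by rewrite /modz; ring.
Qed.
End WalkCount.

Section WalkCount2.
Local Open Scope ring_scope.
Implicit Types (a b c : quat) (e u : int).

Lemma line_cong (F : int) e x x' a : (F %| x - x')%Z -> line F e x a -> line F e x' a.
Proof.
move=> hF [h1 h2]; split.
  apply: (dvdz_comb2 (c := 1) (d := f11 e a) h1 hF); ring.
apply: (dvdz_comb2 (c := 1) (d := f21 e a) h2 hF); ring.
Qed.
Lemma line_dvd (F G : int) e x a : (F %| G)%Z -> line G e x a -> line F e x a.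
Proof. by move=> h [h1 h2]; split; apply: dvdz_trans h _. Qed.

(** The scalar [u] cancels in the difference, which still kills the common line; so its determinant,
    the norm, vanishes. *)
Lemma same_line_norm (F : int) e u x a b : (F %| e ^+ 2 + 1)%Z ->
  line F e x (a + qz u) -> line F e x (b + qz u) -> (F %| qnorm (a - b))%Z.
Proof.
move=> he ha hb.
have [h1 h2] : line F e x (a - b).
  have -> : a - b = (a + qz u) + (-1) * (b + qz u).
    by rewrite mulN1r opprD addrACA subrr addr0.
  by apply: lineD => //; apply: line_mull.
have -> : qnorm (a - b) = f11 e (a - b) * (f22 e (a - b) - x * f21 e (a - b))
    - f21 e (a - b) * (f12 e (a - b) - x * f11 e (a - b))
    + (e ^+ 2 + 1) * (qi (a - b) ^+ 2 + qk (a - b) ^+ 2).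
  move: (f_det e (a - b)) => hd; lra.
apply: rpredD; last exact: dvdz_mulr.
by apply: rpredB; apply: dvdz_mull.
Qed.

Section Fixed.
Variables (p k r J : nat) (e u : int) (A : seq quat) (X : quat -> nat).
Hypotheses (pp : prime p) (po : odd p) (k0 : (0 < k)%N) (pu : ~~ (p%:Z %| u)%Z).
Let P := (p ^ k)%N.
Hypothesis (hu : ((P ^ J)%N%:Z %| u ^+ 2 + r%:Z)%Z).
Hypothesis (he : ((P ^ J)%N%:Z %| e ^+ 2 + 1)%Z).
Hypothesis (hA : forall a, a \in A ->
  [/\ qre a = 0, qnorm a = r%:Z & (2 %| qi a - r%:Z)%Z]).
Hypothesis nogood : forall c, qre c = 0 -> qnorm c = r%:Z -> (2 %| qi c - r%:Z)%Z ->
  ~ (P%:Z %| r%:Z - qi c ^+ 2)%Z.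
Hypothesis hX : forall a, a \in A -> line (P ^ J)%N%:Z e (X a)%:Z (a + qz u).

Let P1 : (1 < P)%N. Proof. by rewrite -(exp1n k) ltn_exp2r ?prime_gt1. Qed.
Let P0 : (0 < P)%N. Proof. exact: ltnW P1. Qed.

Let primeP i l : prime l -> (l %| P ^ i)%N -> l = p.
Proof. by move=> pl; rewrite -expnM Euclid_dvdX // dvdn_prime2 // => /andP[/eqP]. Qed.

(** The lift forbidden by [walk_step] would yield a representation [c] with r = (qi c)^2 modulo [P];
    its parity is that of [b], so [nogood] excludes it and P - 1 of the P lifts remain. *)
Lemma walk_fiber i x : (i < J)%N -> 
  (size [seq x' <- undup (map (fun a => X a %% P ^ i.+1) A) | x' %% P ^ i == x] <= P.-1)%N.
Proof.
move=> iJ; set S := [seq _ <- _ | _].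
case ES : S => [//|x1 S']; rewrite -ES.
have : x1 \in S by rewrite ES mem_head.
rewrite mem_filter mem_undup => /andP[/eqP ex1 /mapP[a aA ea]].
have Pi0 j : (0 < P ^ j)%N by rewrite expn_gt0 P0.
have xa : (X a %% P ^ i)%N = x.
  by rewrite -ex1 ea modn_dvdm // dvdn_exp2l.
have [ha na pa] := hA aA.
have dvJ j : (j <= J)%N -> ((P ^ j)%N%:Z %| (P ^ J)%N%:Z)%Z.
  by move=> hj; rewrite dvdzE /= dvdn_exp2l.
have cg j n : ((P ^ j)%N%:Z %| n%:Z - (n %% P ^ j)%N%:Z)%Z.
  by rewrite {1}(divn_eq n (P ^ j)) PoszD PoszM addrK dvdz_mull.
have la : line (P ^ i)%N%:Z e x (a + qz u).
  by rewrite -xa; apply: line_cong (cg _ _) _; apply: line_dvd (hX aA); apply: dvJ; exact: ltnW.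
have eP : (P ^ i * p ^ k = P ^ i.+1)%N by rewrite expnSr.
have [y hy] : exists y : int, forall b, qre b = 0 -> qnorm b = r%:Z ->
    line (P ^ i.+1)%N%:Z e (x%:Z + (P ^ i)%N%:Z * y) (b + qz u) ->
    exists c, [/\ qre c = 0, qnorm c = r%:Z, qdvd 2 (c - b) & (P%:Z %| r%:Z - qi c ^+ 2)%Z].
  rewrite -eP; apply: (walk_step (f := (P ^ i)%N) pp po _ _ k0 pu _ _ ha na la).
  - by rewrite !oddX po !orbT.
  - exact: primeP.
  - by rewrite eP; apply: dvdz_trans hu; apply: dvJ.
  - by rewrite eP; apply: dvdz_trans he; apply: dvJ.
have Pz : P%:Z != 0 by rewrite eqz_nat -lt0n.
pose y0 := `|(y %% P%:Z)%Z|%N.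
have y0P : (y0 < P)%N by exact: absz_modz_lt.
have ey : y0%:Z = (y %% P%:Z)%Z by rewrite /y0 gez0_abs ?modz_ge0.
have xPi : (x < P ^ i)%N by rewrite -ex1 ltn_pmod.
apply: (@leq_trans (size [seq (x + P ^ i * z)%N | z <- rem y0 (iota 0 P)])); last first.
  by rewrite size_map size_rem ?size_iota // mem_iota.
apply: uniq_leq_size; first by rewrite filter_uniq ?undup_uniq.
move=> x'; rewrite mem_filter mem_undup => /andP[/eqP ex' /mapP[b bA eb]].
have x'P : (x' < P ^ i.+1)%N by rewrite eb ltn_pmod.
have ed : x' = (x + P ^ i * (x' %/ P ^ i))%N by rewrite -ex' mulnC addnC -divn_eq.
rewrite {1}ed; apply: (map_f (fun z => (x + P ^ i * z)%N)).
rewrite rem_filter ?iota_uniq // mem_filter mem_iota /= add0n andbC.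
rewrite ltn_divLR // -expnS x'P /=; apply/negP => /eqP ez.
have [hb nb pb] := hA bA.
have lb : line (P ^ i.+1)%N%:Z e (x%:Z + (P ^ i)%N%:Z * y) (b + qz u).
  have h1 : line (P ^ i.+1)%N%:Z e x'%:Z (b + qz u).
    by rewrite eb; apply: line_cong (cg _ _) _; apply: line_dvd (hX bA); apply: dvJ.
  apply: line_cong h1; rewrite ed ez PoszD PoszM ey.
  rewrite /modz; apply/dvdzP; exists (- (y %/ P%:Z)%Z).
  rewrite expnSr PoszM; ring.
have [c [hc nc dc gc]] := hy b hb nb lb.
apply: (nogood hc nc _ gc).
have /qdvdP[_ d1 _ _] := dc; move: d1; rewrite !qE => d1.
by apply: (dvdz_comb2 (c := 1) (d := 1) d1 pb); ring.
Qed.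

Lemma walk_count i : (i <= J)%N ->
  (size (undup (map (fun a => X a %% P ^ i)%N A)) <= P.-1 ^ i)%N.
Proof.
elim: i => [|i IH] iJ.
  apply: (@leq_trans (size [:: 0%N])) => //; apply: uniq_leq_size; first exact: undup_uniq.
  by move=> x; rewrite mem_undup => /mapP[a _ ->]; rewrite modn1 inE.
rewrite [X in (_ <= X)%N]expnS; apply: leq_trans (leq_mul (leqnn _) (IH (ltnW iJ))).
apply: (@size_fiber _ _ _ _ (fun x => x %% P ^ i)%N).
  move=> x; rewrite !mem_undup => /mapP[a aA ->].
  by rewrite modn_dvdm ?dvdn_exp2l //; apply: (map_f (fun a => X a %% P ^ i)%N).
by move=> x _; apply: walk_fiber.
Qed.
End Fixed.
End WalkCount2.

Section CountIneq.
Local Open Scope ring_scope.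
Implicit Types (a b c : quat) (e u : int).

Lemma qnormB_dot (r : int) a b : qre a = 0 -> qre b = 0 -> qnorm a = r -> qnorm b = r ->
  qnorm (a - b) = 2 * (r - qdot a b).
Proof.
move=> ha hb na nb; transitivity (qnorm a + qnorm b - 2 * qdot a b); last by rewrite na nb; ring.
by rewrite /qnorm /qdot !qE ha hb; ring.
Qed.

Lemma qdot_le (r : int) a b : qre a = 0 -> qre b = 0 -> qnorm a = r -> qnorm b = r ->
  - r <= qdot a b <= r.
Proof.
move=> ha hb na nb; apply/andP; split; last first.
  have := qnorm_ge0 (a - b); rewrite (qnormB_dot ha hb na nb); lra.
have hb' : qre (- b) = 0 by rewrite qreN hb oppr0.
have nb' : qnorm (- b) = r by rewrite -nb /qnorm !qE; ring.
have := qnorm_ge0 (a - (- b)); rewrite (qnormB_dot ha hb' na nb').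
have -> : qdot a (- b) = - qdot a b by rewrite /qdot !qE; ring.
by lra.
Qed.

(** By Cauchy's inequality |A|^2 is at most the number of walks times the number of pairs with the
    same walk. A pair off the diagonal has norm of difference 2 (r - s) divisible by P^J, so r - s
    is j P^J with j at most 2 r / P^J, and [pair_count] bounds the pairs for each j. *)
Lemma count_ineq (p k r J D : nat) (e u : int) (A : seq quat) :
  prime p -> odd p -> (0 < k)%N -> (0 < J)%N -> sqfree r -> ~~ (p%:Z %| u)%Z ->
  (((p ^ k) ^ J)%N%:Z %| u ^+ 2 + r%:Z)%Z -> (((p ^ k) ^ J)%N%:Z %| e ^+ 2 + 1)%Z ->
  uniq A ->
  (forall a, a \in A -> [/\ qre a = 0, qnorm a = r%:Z, (2 %| qi a - r%:Z)%Z &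
     ~~ (p%:Z %| u + e * qi a)%Z]) ->
  (forall c, qre c = 0 -> qnorm c = r%:Z -> (2 %| qi c - r%:Z)%Z ->
     ~ ((p ^ k)%N%:Z %| r%:Z - qi c ^+ 2)%Z) ->
  (forall M, 0 < M -> M <= r ^ 2 -> size (divisors M) <= D)%N ->
  (size A ^ 2 <= (p ^ k).-1 ^ J * (size A + 128 * D ^ 2 * (2 * r %/ (p ^ k) ^ J)))%N.
Proof.
move=> pp po k0 J0 sr pu hu he uA hA nogood hD.
set P := (p ^ k)%N in hu he nogood *.
have P0 : (0 < P)%N by rewrite expn_gt0 prime_gt0.
have F0 : (0 < P ^ J)%N by rewrite expn_gt0 P0.
have Fp l : prime l -> (l %| P ^ J)%N -> l = p.
  by move=> pl; rewrite -expnM Euclid_dvdX // dvdn_prime2 // => /andP[/eqP].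
have oF : odd (P ^ J) by rewrite !oddX po !orbT.
have [X hX'] : exists X : quat -> nat, forall a, a \in A ->
    (X a < P ^ J)%N /\ line (P ^ J)%N%:Z e (X a)%:Z (a + qz u).
  apply: (@seq_choice _ _ A 0%N (fun a x => (x < P ^ J)%N /\ line (P ^ J)%N%:Z e x%:Z (a + qz u))).
  move=> a /hA[h1 h2 h3 h4].
  by have [x xl hx] := line_exists pp Fp F0 h1 h2 hu he h4; exists x.
have hX a : a \in A -> line (P ^ J)%N%:Z e (X a)%:Z (a + qz u) by move=> /hX'[].
have sB : (size (undup (map X A)) <= P.-1 ^ J)%N.
  have hA' a : a \in A -> [/\ qre a = 0, qnorm a = r%:Z & (2 %| qi a - r%:Z)%Z].
    by move=> /hA[].
  have ltX a : a \in A -> (X a < P ^ J)%N by move=> /hX'[].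
  have := walk_count pp po k0 pu hu he hA' nogood hX (leqnn J).
  rewrite (_ : map (fun a => X a %% P ^ J)%N A = map X A) //.
  by apply/eq_in_map => a /ltX; apply: modn_small.
apply: leq_trans (sqr_size_le X A) _; apply: leq_mul => //.
have up : uniq [seq (a, b) | a <- A, b <- A] by apply: allpairs_uniq => // -[a b] [c d].
rewrite -(count_predC (fun q : quat * quat => q.1 == q.2) (fiber_pairs X A)) leq_add //.
  rewrite -size_filter -(size_map (fun a => (a, a)) A).
  apply: uniq_leq_size; first by rewrite !filter_uniq.
  move=> [a b]; rewrite !mem_filter /= => /andP[/eqP <- /andP[_ /allpairsP[[a' b'] /= [h _ [-> _]]]]].
  exact: (map_f (fun a => (a, a)) h).
rewrite -size_filter; set O := [seq _ <- _ | _].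
have uO : uniq O by rewrite !filter_uniq.
have hO q : q \in O -> [/\ q.1 \in A, q.2 \in A, q.1 != q.2 & X q.1 = X q.2].
  case: q => a b; rewrite !mem_filter /= => /andP[ab /andP[/eqP hx /allpairsP[[a' b'] /= [h h' [ea eb]]]]].
  by subst a' b'.
have info q : q \in O -> exists j : nat, [/\ (0 < j)%N, (j <= 2 * r %/ P ^ J)%N,
   r%:Z - qdot q.1 q.2 = (j * P ^ J)%N%:Z & r%:Z ^+ 2 != (r%:Z - (j * P ^ J)%N%:Z) ^+ 2].
  move=> /hO[/[dup] a1 /hA[h1 n1 _ _] /[dup] a2 /hA[h2 n2 _ _] ne ex].
  have l1 := hX _ a1; have l2 := hX _ a2; rewrite -ex in l2.
  have := same_line_norm he l1 l2; rewrite (qnormB_dot h1 h2 n1 n2) => dv.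
  have {}dv : ((P ^ J)%N%:Z %| r%:Z - qdot q.1 q.2)%Z.
    by move: dv; rewrite Gauss_dvdzr // coprimezE /= coprimen2.
  have /andP[ql qu] := qdot_le h1 h2 n1 n2.
  have lt : qdot q.1 q.2 < r%:Z.
    have : 0 < qnorm (q.1 - q.2) by apply: qnorm_gt0; rewrite subr_eq0.
    by rewrite (qnormB_dot h1 h2 n1 n2); lra.
  have [t et] := dvdzP dv.
  have Fz : 0 < (P ^ J)%N%:Z by [].
  have t0 : 0 < t by rewrite -(pmulr_lgt0 _ Fz) -et subr_gt0.
  have tt : t = `|t|%N%:Z by rewrite gez0_abs // ltW.
  exists `|t|%N; rewrite PoszM -tt -et; split=> //.
  - by rewrite absz_gt0 gt_eqF.
  - rewrite leq_divRL // -lez_nat PoszM -tt -et PoszM; lra.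
  (* s = r would mean equal quaternions. For s = - r the power of [p] divides 2 r, so [p] divides
     [r] and then [u]. *)
  - rewrite subKr; apply/negP; rewrite eqf_sqr => /orP[/eqP h|/eqP h].
      by move: lt; rewrite -h ltxx.
    have hq : qdot q.1 q.2 = - r%:Z by rewrite h opprK.
    have : (p%:Z %| r%:Z)%Z.
      have pF : (p%:Z %| (P ^ J)%N%:Z)%Z.
        rewrite dvdzE /= -expnM dvdn_exp // muln_gt0 k0 //.
      have := dvdz_trans pF dv; rewrite hq opprK -[X in (_ %| X)%Z]/(r%:Z + r%:Z).
      have -> : r%:Z + r%:Z = 2 * r%:Z by ring.
      by rewrite Gauss_dvdzr // coprimezE /= coprimen2.
    move=> pr; have pF : (p%:Z %| u ^+ 2)%Z.
      have pF : (p%:Z %| u ^+ 2 + r%:Z)%Z.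
        apply: dvdz_trans hu; rewrite dvdzE /= -expnM dvdn_exp // muln_gt0 k0 //.
      by apply: (dvdz_comb2 (c := 1) (d := -1) pF pr); ring.
    move: pu; rewrite dvdzE /= in pF; rewrite dvdzE /=.
    by move: pF; rewrite abszX Euclid_dvdX // => /andP[->].
rewrite mulnC -[X in (_ <= X * _)%N](size_iota 1) mulnC.
apply: (@count_rel _ _ O _ (fun q (j : nat) => q \in O /\ r%:Z - qdot q.1 q.2 = (j * P ^ J)%N%:Z
   /\ r%:Z ^+ 2 != (r%:Z - (j * P ^ J)%N%:Z) ^+ 2)) => //.
  move=> q qO; have [j [j0 j1 j2 j3]] := info q qO; exists j; split=> //.
  by rewrite mem_iota j0 add1n ltnS.
move=> j S _ uS hS.
case ES : S => [//|q0 S']; rewrite -ES.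
have [_ [e0 ne0]] : q0 \in O /\ r%:Z - qdot q0.1 q0.2 = (j * P ^ J)%N%:Z
   /\ r%:Z ^+ 2 != (r%:Z - (j * P ^ J)%N%:Z) ^+ 2 by apply: hS; rewrite ES mem_head.
have hS' q : q \in S -> [/\ qre q.1 = 0, qre q.2 = 0, qnorm q.1 = r%:Z, qnorm q.2 = r%:Z &
    qdot q.1 q.2 = r%:Z - (j * P ^ J)%N%:Z].
  move=> /hS[/hO[/hA[h1 n1 _ _] /hA[h2 n2 _ _] _ _] [<- _]]; split=> //; ring.
apply: leq_trans (pair_count sr ne0 uS hS') _.
rewrite leq_mul2l leq_sqr hD ?orbT //; first by rewrite absz_gt0 subr_eq0.
have q0S : q0 \in S by rewrite ES mem_head.
have [h1 h2 n1 n2 <-] := hS' _ q0S.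
have /andP[l1 l2] := qdot_le h1 h2 n1 n2.
move: (qdot _ _) l1 l2 => s l1 l2.
have s2 : s ^+ 2 <= r%:Z ^+ 2.
  have : 0 <= (r%:Z - s) * (r%:Z + s) by apply: mulr_ge0; lra.
  by lra.
rewrite -lez_nat gez0_abs ?subr_ge0 // -mulnn PoszM.
by have := sqr_ge0 s; lra.
Qed.
End CountIneq.

(** * Representations obtained from split primes *)

Lemma crt_root (D e1 e2 v1 v2 : nat) : coprime e1 e2 -> e1 %| v1 ^ 2 + D -> e2 %| v2 ^ 2 + D ->
  exists v, e1 * e2 %| v ^ 2 + D.
Proof.
move=> co h1 h2; exists (chinese e1 e2 v1 v2); rewrite Gauss_dvd //; apply/andP; split.
  by rewrite /dvdn -modnDml -modnXm chinese_modl // modnXm modnDml.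
by rewrite /dvdn -modnDml -modnXm chinese_modr // modnXm modnDml.
Qed.

Lemma prod_root (D : nat) (s : seq nat) : uniq s -> {in s, forall q, prime q} ->
  {in s, forall q, exists v, q %| v ^ 2 + D} -> exists v, \prod_(q <- s) q %| v ^ 2 + D.
Proof.
elim: s => [|q s IH] /=; first by exists 0; rewrite big_nil dvd1n.
move=> /andP[nq us] ps hs; have pq : prime q by apply: ps; rewrite inE eqxx.
have ps' : {in s, forall q, prime q} by move=> x xs; apply: ps; rewrite inE xs orbT.
have [v hv] := IH us ps' (fun x xs => hs x (mem_behead (s := q :: s) xs)).
have [w hw] := hs q (mem_head _ _).
rewrite big_cons; apply: crt_root hw hv.
rewrite big_seq; apply: (big_ind (fun x => coprime q x)) => [|x y hx hy|j js].
- exact: coprimen1.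
- by rewrite coprimeMr hx.
have pj := ps' _ js; rewrite prime_coprime // dvdn_prime2 //.
by apply/eqP => e; move: nq; rewrite e js.
Qed.

Section RepCount.
Local Open Scope ring_scope.
Implicit Types (a b c q : quat).

Definition moved (a : quat) (e : nat) (b : quat) := exists q, [/\ qre b = 0, qnorm b = qnorm a,
  b * q = q * a, qnorm q = e%:Z & qprim e%:Z q].

Lemma moved_exists a (r e v : nat) : qre a = 0 -> qnorm a = r%:Z -> odd e -> coprime e r ->
  (e %| v ^ 2 + r)%N -> exists b, moved a e b.
Proof.
move=> ha na oe co ev.
have e0 : (0 < e)%N by case: e oe {co ev}.
have hp : qprim e%:Z (a + qz v%:Z).
  move=> l pl le /qdvdP[h _ _ _]; move: h; rewrite !qE ha /= add0r => lv.
  have lr : (l %| r)%N.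
    rewrite -(dvdn_addr _ (m := v ^ 2)%N); first exact: dvdn_trans le ev.
    by rewrite dvdn_exp.
  have : (l %| gcdn e r)%N by rewrite dvdn_gcd lr andbT.
  by rewrite (eqP co) dvdn1 => /eqP l1; rewrite l1 in pl.
have hn : (e%:Z %| qnorm (a + qz v%:Z))%Z.
  have -> : qnorm (a + qz v%:Z) = (v ^ 2 + r)%N%:Z.
    by rewrite PoszD -na -mulnn PoszM /qnorm !qE ha /=; ring.
  by [].
have [q [u [w [k [k' [e1 e2 e3 nq]]]]]] := qprim_gcd_norm oe hp hn.
have q0 : q != 0 by apply: contraTneq e0 => q0; move: nq; rewrite q0 => -[<-].
have [b [eb hb mb nb]] := ideal_move ha e2 q0.
exists b, q; split=> // l pl le lq; apply: (hp l pl le).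
by rewrite e2; apply: qdvdMl.
Qed.

(** Each set of K primes gives an ideal of norm their product, hence a representation. Two products
    are at most X^K, so their product is below [r] and [move_inj] separates the representations. *)
Lemma rep_count a (r L K X : nat) (q : 'I_L -> nat) : sqfree r -> qre a = 0 -> qnorm a = r%:Z ->
  injective q -> (forall i, prime (q i)) -> (forall i, odd (q i)) ->
  (forall i, ~~ (q i %| r)%N) -> (forall i, exists v, q i %| v ^ 2 + r)%N ->
  (forall i, q i <= X)%N -> (X ^ (2 * K) < r)%N ->
  exists A : seq quat, [/\ uniq A, (forall b, b \in A -> qre b = 0 /\ qnorm b = r%:Z) &
    size A = 'C(L, K)].
Proof.
move=> sr ha na iq pq oq nq vq qX XK.
pose T := enum [set S : {set 'I_L} | (S \subset setT) && (#|S| == K)].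
pose e (S : {set 'I_L}) := (\prod_(i in S) q i)%N.
have eE S : e S = (\prod_(x <- [seq q i | i <- enum S]) x)%N by rewrite big_map big_enum.
have oe S : odd (e S).
  by rewrite /e; elim/big_ind: _ => [//|x y ox oy|i _ //]; rewrite oddM ox oy.
have e0 S : (0 < e S)%N by have := oe S; case: (e S).
have he S : exists v, (e S %| v ^ 2 + r)%N.
  by rewrite eE; apply: prod_root; [rewrite map_inj_uniq ?enum_uniq | |] => // x /mapP[i _ ->].
have ce S : coprime (e S) r.
  rewrite /e; apply: (big_ind (fun x => coprime x r)) => [|x y hx hy|i _].
  - exact: coprime1n.
  - by rewrite coprimeMl hx.
  by rewrite prime_coprime.
have mem_e S i : (q i %| e S)%N = (i \in S).
  apply/idP/idP => [|iS]; last by rewrite /e (bigD1 i) //= dvdn_mulr.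
  rewrite /e; elim/big_rec: _ => [|j x jS IH].
    by rewrite dvdn1 => /eqP h; have := pq i; rewrite h.
  by rewrite Euclid_dvdM // dvdn_prime2 // => /orP[/eqP/iq ->|/IH].
have eX S : S \in T -> (e S <= X ^ K)%N.
  rewrite mem_enum inE subsetT /= => /eqP <-.
  by rewrite /e -prod_nat_const; apply: leq_prod => i _.
have [f hf] : exists f : {set 'I_L} -> quat, forall S, S \in T -> moved a (e S) (f S).
  apply: (@seq_choice _ _ T (0 : quat) (fun S b => moved a (e S) b)) => S _.
  by have [v hv] := he S; exact: moved_exists ha na (oe S) (ce S) hv.
exists (map f T); split.
- rewrite map_inj_in_uniq ?enum_uniq // => S S' ST ST' ef.
  have [x [h1 h2 h3 h4 h5]] := hf S ST; have [y [k1 k2 k3 k4 k5]] := hf S' ST'.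
  rewrite -ef in k3; have E : e S = e S'.
    apply: (move_inj sr ha h1 na h3 k3 h4 k4 h5 k5) => //.
    apply: leq_ltn_trans XK; rewrite mul2n -addnn expnD; apply: leq_mul; exact: eX.
  by apply/setP => i; rewrite -!mem_e E.
- by move=> b /mapP[S /hf[x [h1 h2 _ _ _]] ->]; rewrite h2.
rewrite size_map -cardE cards_draws cardsT card_ord //.
Qed.
End RepCount.

(** * Divisors *)

Section Divisors.

Lemma perm_divisors_pfactor (q k e : nat) : prime q -> 0 < e -> ~~ (q %| e) ->
  perm_eq (divisors (q ^ k * e)) [seq q ^ i * b | i <- iota 0 k.+1, b <- divisors e].
Proof.
move=> pq e0 qe; have q0 := prime_gt0 pq; have q1 := prime_gt1 pq.
have qk0 n : 0 < q ^ n by rewrite expn_gt0 q0.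
have nd b : b %| e -> ~~ (q %| b) by move=> be; apply: contra qe => h; exact: dvdn_trans h be.
have lg i b : b %| e -> logn q (q ^ i * b) = i.
  move=> be; have b0 := dvdn_gt0 e0 be.
  by rewrite lognM // pfactorK // lognE (negPf (nd _ be)) !andbF addn0.
apply: uniq_perm; first exact: divisors_uniq.
  apply: allpairs_uniq; [exact: iota_uniq|exact: divisors_uniq|].
  move=> [i b] [i' b'] /allpairsP[[x y] [_ hy [-> ->]]] /allpairsP[[x' y'] [_ hy' [-> ->]]].
  rewrite /= in hy hy' *.
  rewrite -!dvdn_divisors // in hy hy' *; move=> E.
  have ex : x = x' by rewrite -(lg x y hy) E lg.
  by rewrite ex in E *; move/eqP: E; rewrite eqn_pmul2l // => /eqP ->.
move=> b; rewrite -dvdn_divisors ?muln_gt0 ?qk0 //; apply/idP/allpairsP => [h|[[x y] [hx hy ->]]].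
  have b0 : 0 < b by apply: dvdn_gt0 h; rewrite muln_gt0 qk0.
  have [c [i [ec eb]]] : exists c i, ~~ (q %| c) /\ b = q ^ i * c.
    by case: (pfactor_coprime pq b0) => c cc eb; exists c, (logn q b); rewrite -prime_coprime // mulnC.
  exists (i, c); split=> //.
    rewrite mem_iota add0n /= ltnS -(pfactorK k pq).
    have -> : i = logn q (q ^ i) by rewrite pfactorK.
    apply: dvdn_leq_log => //; rewrite -(@Gauss_dvdl _ _ e); last by rewrite coprimeXl // prime_coprime.
    by apply: dvdn_trans h; rewrite eb dvdn_mulr.
  rewrite -dvdn_divisors //= -(@Gauss_dvdr _ (q ^ k)); last first.
    by rewrite coprimeXr // coprime_sym prime_coprime.
  by apply: dvdn_trans h; rewrite eb dvdn_mull.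
rewrite mem_iota add0n /= ltnS in hx; rewrite -dvdn_divisors // in hy.
by apply: dvdn_mul => //; rewrite dvdn_exp2l.
Qed.

Lemma prime_power_ind (P : nat -> Prop) : P 1 ->
  (forall q k e, prime q -> 0 < k -> 0 < e -> ~~ (q %| e) -> P e -> P (q ^ k * e)) ->
  forall n, 0 < n -> P n.
Proof.
move=> P1 PM n; have [m] := ubnP n; elim: m n => // m IH n; rewrite ltnS => nm n0.
have [->//|n1] := eqVneq n 1.
have pq : prime (pdiv n) by apply: pdiv_prime; rewrite ltn_neqAle eq_sym n1.
have l0 : 0 < logn (pdiv n) n by rewrite logn_gt0 mem_primes pq n0 pdiv_dvd.
case: (pfactor_coprime pq n0) => c cc en; move: en; set k := logn _ _ => en.
have c0 : 0 < c by move: n0; rewrite en muln_gt0 => /andP[].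
rewrite en mulnC; apply: PM => //; first by rewrite -prime_coprime.
apply: IH => //; apply: leq_trans nm; rewrite [X in _ < X]en -[X in X < _]muln1 ltn_pmul2l //.
by rewrite -(exp1n k) ltn_exp2r // prime_gt1.
Qed.

Lemma size_divisors_pfactor (q k e : nat) : prime q -> 0 < e -> ~~ (q %| e) ->
  size (divisors (q ^ k * e)) = k.+1 * size (divisors e).
Proof.
by move=> pq e0 qe; rewrite (perm_size (perm_divisors_pfactor k pq e0 qe)) size_allpairs size_iota.
Qed.

(** The power is at most a rising factorial, t! times the binomial of k + t over t, and that
    binomial is at most 2^(k + t). *)
Lemma succ_exp_le (t k : nat) : k.+1 ^ t <= t`! * 2 ^ t * 2 ^ k.
Proof.
have h1 : k.+1 ^ t <= (k + t) ^_ t.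
  elim: t => [|t IH]; first by rewrite expn0 ffactn0.
  rewrite expnS addnS ffactSS leq_mul //.
  by rewrite ltnS leq_addr.
apply: leq_trans h1 _; rewrite -bin_ffact mulnC -mulnA leq_pmul2l ?fact_gt0 //.
have lt : t < (t + k).+1 by lia.
rewrite -expnD (addnC t k) -[2]/(1 + 1) expnDn (addnC k t) (bigD1 (Ordinal lt)) //=.
by rewrite !exp1n !muln1 leq_addr.
Qed.

(** Prime by prime: for q >= 2^t one has (k + 1)^t <= 2^(k t) <= q^k, and each of the fewer than 2^t
    smaller primes costs at most a factor [b], by [succ_exp_le]. *)
Lemma divisor_bound (t : nat) : exists c, 0 < c /\
  forall n, 0 < n -> size (divisors n) ^ t <= c * n.
Proof.
pose b := t`! * 2 ^ t; have b0 : 0 < b by rewrite muln_gt0 fact_gt0 expn_gt0.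
pose small n := [seq q <- primes n | q < 2 ^ t].
exists (b ^ (2 ^ t)); split; first by rewrite expn_gt0 b0.
move=> n n0; apply: (@leq_trans (b ^ size (small n) * n)); last first.
  rewrite leq_mul2r leq_pexp2l ?orbT // -[leqRHS](size_iota 0); apply: uniq_leq_size.
    by rewrite filter_uniq // primes_uniq.
  by move=> q; rewrite mem_filter mem_iota => /andP[].
move: n n0; apply: prime_power_ind => [|q k e pq k0 e0 qe IH]; first by rewrite !exp1n.
have q0 := prime_gt0 pq.
have sz : size (small (q ^ k * e)) = (q < 2 ^ t) + size (small e).
  have pe : perm_eq (primes (q ^ k * e)) (q :: primes e).
    apply: uniq_perm; first exact: primes_uniq.
      by rewrite /= primes_uniq mem_primes (negPf qe) !andbF.
    by move=> x; rewrite primesM ?expn_gt0 ?q0 // primesX // primes_prime // !inE.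
  by rewrite /small (perm_size (perm_filter _ pe)) /=; case: ifP.
rewrite size_divisors_pfactor // expnMn sz expnD.
apply: (@leq_trans ((b ^ (q < 2 ^ t) * q ^ k) * (b ^ size (small e) * e))); last first.
  by rewrite mulnACA.
apply: leq_mul => //; case: ltnP => [_|h]; rewrite ?expn1 ?expn0 ?mul1n.
  apply: leq_trans (succ_exp_le t k) _; rewrite leq_mul2l; apply/orP; right.
  by rewrite leq_exp2r ?prime_gt1.
apply: (@leq_trans ((2 ^ k) ^ t)); first by case: (posnP t) => [->//|t0]; rewrite leq_exp2r // ltn_expl.
by rewrite -expnM mulnC expnM leq_exp2r.
Qed.
End Divisors.

(** * Quadratic reciprocity *)

Section Legendre.
Local Open Scope ring_scope.

(** The Legendre symbol written additively, as a bit: products become [addb]. *)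
Definition nonres (p a : nat) : bool := ~~ [exists x : 'F_p, x ^+ 2 == a%:R].

Section Gauss.
Variable p : nat.
Hypotheses (pp : prime p) (po : odd p).
Let h := p./2.

Lemma half_prime : p = (h.*2).+1.
Proof. by rewrite -[LHS]odd_double_half po. Qed.
Let ep := half_prime.

Lemma Fp_eq0 (n : nat) : (n%:R == 0 :> 'F_p) = (p %| n)%N.
Proof. by rewrite (dvdn_pcharf (pchar_Fp pp)). Qed.

Lemma Fp_eqP (m n : nat) : reflect (m%:R = n%:R :> 'F_p) (m == n %[mod p])%N.
Proof.
apply: (iffP idP) => [/eqP e|e].
  by rewrite -(Fp_nat_mod pp m) -(Fp_nat_mod pp n) e.
wlog le : m n e / (m <= n)%N => [H|].
  by case: (leqP m n) => [|/ltnW] le; [exact: H | rewrite eq_sym; exact: H].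
by rewrite eq_sym (eqn_mod_dvd p le) -Fp_eq0 natrB // e subrr.
Qed.

Lemma neq1N1 : (1 != -1 :> 'F_p).
Proof.
rewrite -subr_eq0 opprK -[1 + 1]/(2%:R) Fp_eq0; apply/negP => /dvdn_leq => /(_ isT).
by have := prime_gt1 pp; rewrite ep; lia.
Qed.

Lemma Fp_sign_inj (b c : bool) : (-1) ^+ b = (-1) ^+ c :> 'F_p -> b = c.
Proof.
have n1 := neq1N1; have n2 := n1; rewrite eq_sym in n2.
by case: b; case: c => //= /eqP; rewrite expr0 expr1 ?(negPf n1) ?(negPf n2).
Qed.

Variable a : nat.
Hypothesis pa : ~~ (p %| a)%N.

Let r (k : 'I_h) := ((a * k.+1) %% p)%N.
Let big_r k := (h < r k)%N.

Lemma r_gt0 k : (0 < r k)%N.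
Proof.
rewrite lt0n; apply: contra pa => /eqP e; have : (p %| a * k.+1)%N by rewrite /dvdn -/(r k) e.
rewrite Euclid_dvdM // => /orP[//|] /dvdn_leq => /(_ isT).
by have := ltn_ord k; clear e; rewrite ep; lia.
Qed.
Lemma r_lt k : (r k < p)%N. Proof. by rewrite ltn_pmod // prime_gt0. Qed.

Let sv (k : 'I_h) := if big_r k then (p - r k)%N else r k.
Lemma sv_bound k : (0 < sv k <= h)%N.
Proof.
move: (r_gt0 k) (r_lt k) ep; rewrite /sv /big_r; move: (r k) h => R H.
by case: (ltnP H R); clear; lia.
Qed.
Lemma sv_proof k : ((sv k).-1 < h)%N. Proof. by have := sv_bound k; lia. Qed.
Let sg (k : 'I_h) : 'I_h := Ordinal (sv_proof k).

Lemma sv_mod k : ((sv k)%:R : 'F_p) = (-1) ^+ big_r k * (a * k.+1)%:R.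
Proof.
have er : ((r k)%:R : 'F_p) = (a * k.+1)%:R by rewrite Fp_nat_mod.
rewrite /sv; case: (big_r k); last by rewrite expr0 mul1r er.
rewrite expr1 mulN1r natrB; last exact: ltnW (r_lt k).
by rewrite pchar_Fp_0 // sub0r er.
Qed.

Lemma sg_inj : injective sg.
Proof.
move=> k l e; have {}e : sv k = sv l.
  by have := sv_bound k; have := sv_bound l; move: (congr1 val e) => /=; lia.
have e2 : ((a * k.+1)%:R : 'F_p) ^+ 2 = (a * l.+1)%:R ^+ 2.
  by have := congr1 (fun n => (n%:R : 'F_p) ^+ 2) e; rewrite !sv_mod !exprMn !sqrr_sign !mul1r.
move/eqP: e2; rewrite !natrM !exprMn -subr_eq0 -mulrBr mulf_eq0 sqrf_eq0 Fp_eq0 (negPf pa) /=.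
rewrite subr_eq0 eqf_sqr => /orP[/eqP/Fp_eqP/eqP|].
  by rewrite !modn_small //; [move=> [] /val_inj | have := ltn_ord l; rewrite ep; lia
    | have := ltn_ord k; rewrite ep; lia].
rewrite -subr_eq0 opprK -natrD Fp_eq0 => /dvdn_leq; have := ltn_ord l; have := ltn_ord k; rewrite ep; lia.
Qed.

Definition gauss_mu := (\sum_(k < h) (h < (a * k.+1) %% p))%N.

Lemma gauss_lemma : (a%:R : 'F_p) ^+ h = (-1) ^+ gauss_mu.
Proof.
have nz : \prod_(k < h) (k.+1%:R : 'F_p) != 0.
  rewrite prodf_seq_neq0; apply/allP => k _ /=; rewrite Fp_eq0; apply/negP => /dvdn_leq.
  by have := ltn_ord k; rewrite ep; lia.
have E : \prod_(k < h) ((sv k)%:R : 'F_p) = \prod_(k < h) (k.+1%:R : 'F_p).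
  rewrite [RHS](reindex_inj sg_inj) /=; apply: eq_bigr => k _.
  by rewrite prednK //; case/andP: (sv_bound k).
have := E; rewrite (eq_bigr _ (fun k _ => sv_mod k)) big_split /= -expr_sum -/gauss_mu.
under [X in _ * X]eq_bigr do rewrite natrM.
rewrite big_split /= prodr_const card_ord mulrA -[X in _ = X]mul1r => /(mulIf nz).
rewrite -[X in X = _]/((-1) ^+ gauss_mu * a%:R ^+ h) => e1.
by apply: (can_inj (signrMK gauss_mu)); rewrite e1 -expr2 sqrr_sign.
Qed.

Lemma odd_sum (I : finType) (F : I -> nat) :
  odd (\sum_i F i)%N = \big[addb/false]_i odd (F i).
Proof. exact: (big_morph odd oddD). Qed.

Lemma sum_sv : (\sum_(k < h) sv k = \sum_(k < h) k.+1)%N.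
Proof.
rewrite [RHS](reindex_inj sg_inj) /=; apply: eq_bigr => k _.
by rewrite prednK //; case/andP: (sv_bound k).
Qed.

Lemma eisenstein : odd a -> odd gauss_mu = odd (\sum_(k < h) (a * k.+1) %/ p)%N.
Proof.
move=> oa; have := congr1 odd sum_sv; rewrite /gauss_mu !odd_sum => E.
have K (k : 'I_h) : odd k.+1 = odd ((a * k.+1) %/ p) (+) (odd (sv k) (+) odd (big_r k)).
  have := congr1 odd (divn_eq (a * k.+1) p); rewrite oddM oa oddD oddM po andbT /= -/(r k) => ->.
  congr addb; rewrite /sv; case: (big_r k); rewrite ?addbF //= addbT.
  by rewrite (oddB (ltnW (r_lt k))) po addTb negbK.
move: E; rewrite [X in _ = X](eq_bigr _ (fun k _ => K k)) !big_split /=.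
by do 3!case: (\big[_/_]_(_ < _) _).
Qed.

(** A nonresidue with value 1 would be one more root of X^h - 1 besides the h nonzero squares. *)
Lemma euler_criterion : (a%:R : 'F_p) ^+ h = (-1) ^+ (nonres p a).
Proof.
have a0 : (a%:R : 'F_p) != 0 by rewrite Fp_eq0.
have fl (x : 'F_p) : x != 0 -> x ^+ (h.*2) = 1.
  move=> x0; apply: (mulfI x0); rewrite -exprS -ep mulr1 -[RHS]expf_card card_Fp //.
rewrite /nonres; case: existsP => [[x /eqP ex]|nx] /=.
  rewrite -ex -exprM mul2n fl ?expr0 //; apply: contra_neq a0 => x0.
  by rewrite -ex x0 expr0n.
rewrite expr1; have /eqP := fl _ a0; rewrite -muln2 exprM sqrf_eq1 => /orP[/eqP e1|/eqP //].
pose P : {poly 'F_p} := 'X^h - 1; pose s := a%:R :: [seq (k.+1%:R : 'F_p) ^+ 2 | k : 'I_h].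
have h0 : (0 < h)%N by have := prime_gt1 pp; rewrite ep; clear; lia.
have sP : size P = h.+1 by rewrite size_XnsubC.
have P0 : P != 0 by rewrite -size_poly_eq0 sP.
have kl (k : 'I_h) : (k.+1 < p)%N by have := ltn_ord k; rewrite ep; clear; lia.
have k0 (k : 'I_h) : (k.+1%:R : 'F_p) != 0.
  by rewrite Fp_eq0; apply/negP => /dvdn_leq => /(_ isT); rewrite leqNgt kl.
have us : uniq s.
  rewrite /= map_inj_uniq ?enum_uniq ?andbT.
    by apply/mapP => -[k _ e]; apply: nx; exists k.+1%:R; rewrite e.
  move=> k l /eqP; rewrite eqf_sqr => /orP[/eqP/Fp_eqP/eqP|].
    by rewrite !modn_small // => -[] /val_inj.
  rewrite -subr_eq0 opprK -natrD Fp_eq0 => /dvdn_leq; have := ltn_ord l; have := ltn_ord k.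
  by rewrite ep; lia.
have rs : all (root P) s.
  apply/allP => x; rewrite inE => /orP[/eqP->|/mapP[k _ ->]];
    rewrite /root !hornerE ?hornerXn; first by rewrite e1 subrr.
  by rewrite -exprM mul2n fl // subrr.
have := max_poly_roots P0 rs us; rewrite sP /= size_map size_enum_ord ltnn //.
Qed.

Lemma nonres_gauss : nonres p a = odd gauss_mu.
Proof.
by apply: Fp_sign_inj; rewrite signr_odd -gauss_lemma euler_criterion.
Qed.
End Gauss.

Lemma nonresM p a b : prime p -> odd p -> ~~ (p %| a)%N -> ~~ (p %| b)%N ->
  nonres p (a * b)%N = nonres p a (+) nonres p b.
Proof.
move=> pp po pa pb; have pab : ~~ (p %| a * b)%N by rewrite Euclid_dvdM // negb_or pa.
have := euler_criterion pp po pab; rewrite natrM exprMn !euler_criterion //.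
by rewrite -signr_addb => /(Fp_sign_inj pp po) ->.
Qed.

Lemma nonres_mod p a b : prime p -> a = b %[mod p] -> nonres p a = nonres p b.
Proof.
move=> pp e; rewrite /nonres; suff -> : (a%:R : 'F_p) = b%:R by [].
by apply/(Fp_eqP pp); apply/eqP.
Qed.

Lemma nonresN1 p : prime p -> odd p -> nonres p p.-1 = (p %% 4 == 3)%N.
Proof.
move=> pp po; have p1 := prime_gt1 pp.
have pa : ~~ (p %| p.-1)%N by apply/negP => /dvdn_leq; lia.
have := euler_criterion pp po pa.
have -> : (p.-1%:R : 'F_p) = -1 by rewrite -subn1 natrB ?pchar_Fp_0 ?sub0r //; lia.
have -> : (p %% 4 == 3)%N = odd p./2 by have := modn2 p; rewrite po; lia.
by rewrite -[LHS]signr_odd => /(Fp_sign_inj pp po) ->.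
Qed.

Lemma nonres2 p : prime p -> odd p -> nonres p 2 = (p %% 8 \in [:: 3; 5])%N.
Proof.
move=> pp po; have p1 := prime_gt1 pp; have ep := half_prime po.
have pa : ~~ (p %| 2)%N by apply/negP => /dvdn_leq => /(_ isT); move: po; case: p pp p1 ep => [|[|[]]].
rewrite (nonres_gauss pp po pa) /gauss_mu.
have -> : (\sum_(k < p./2) (p./2 < (2 * k.+1) %% p) = \sum_(0 <= k < p./2) (p./2./2 <= k))%N.
  rewrite big_mkord; apply: eq_bigr => k _; congr nat_of_bool.
  by have lk := ltn_ord k; rewrite modn_small; lia.
have -> : forall n m, (m <= n)%N -> (\sum_(0 <= k < n) (m <= k) = n - m)%N.
  move=> n m le; rewrite (big_cat_nat (leq0n m) le) //= big_nat_cond big1 ?add0n => [|k].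
    rewrite big_nat_cond (eq_bigr (fun _ => 1%N)) => [|k /andP[/andP[-> _] _] //].
    by rewrite -big_nat_cond sum_nat_const_nat muln1.
  by case: leqP => //; lia.
- by rewrite !inE; have := modn2 p; rewrite po; lia.
by lia.
Qed.

Lemma lattice_count p q : prime p -> odd p -> prime q -> odd q -> p != q ->
  (\sum_(k < p./2) (q * k.+1) %/ p + \sum_(l < q./2) (p * l.+1) %/ q = p./2 * q./2)%N.
Proof.
have cnt p' q' (k : 'I_(p'./2)) : prime p' -> odd p' -> prime q' -> odd q' ->
    ((q' * k.+1) %/ p' = \sum_(l < q'./2) (p' * l.+1 <= q' * k.+1))%N.
  move=> pp po pq oq; have lk := ltn_ord k; have e1 := half_prime po; have e2 := half_prime oq.
  have p0 := prime_gt0 pp.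
  set n := (_ %/ _)%N; have ln : (n <= q'./2)%N.
    rewrite -ltnS ltn_divLR //; move: p'./2 q'./2 (nat_of_ord k) lk e1 e2 => u v w; clear; nia.
  rewrite -(big_mkord predT (fun l => nat_of_bool (p' * l.+1 <= q' * k.+1)%N)).
  rewrite (big_cat_nat (leq0n n) ln) //= [X in (_ + X)%N]big_nat_cond [X in (_ + X)%N]big1 ?addn0.
    rewrite big_nat_cond (eq_bigr (fun _ => 1%N)) => [|l /andP[/andP[_ ll] _]].
      by rewrite -big_nat_cond sum_nat_const_nat muln1 subn0.
    by rewrite mulnC -leq_divRL // -/n ll.
  by move=> l /andP[/andP[ll _] _]; rewrite mulnC -leq_divRL // -/n ltnNge ll.
move=> pp po pq oq npq; rewrite (eq_bigr _ (fun k _ => cnt p q k pp po pq oq)).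
rewrite (eq_bigr _ (fun k _ => cnt q p k pq oq pp po)) [X in (_ + X)%N]exchange_big -big_split /=.
rewrite (eq_bigr (fun _ => q./2)) ?sum_nat_const ?card_ord // => k _.
rewrite -big_split /= (eq_bigr (fun _ => 1%N)) ?sum1_card ?card_ord // => l _.
case: ltngtP => // e; have : (p %| q * k.+1)%N by rewrite -e dvdn_mulr.
rewrite Euclid_dvdM // dvdn_prime2 // (negPf npq) /= => /dvdn_leq => /(_ isT).
by have := ltn_ord k; have := half_prime po; clear; lia.
Qed.

Lemma quadratic_reciprocity p q : prime p -> odd p -> prime q -> odd q -> p != q ->
  nonres p q = nonres q p (+) ((p %% 4 == 3)%N && (q %% 4 == 3)%N).
Proof.
move=> pp po pq oq npq; have := congr1 odd (lattice_count pp po pq oq npq).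
have pq' : ~~ (p %| q)%N by rewrite dvdn_prime2.
have qp' : ~~ (q %| p)%N by rewrite dvdn_prime2 // eq_sym.
rewrite oddD oddM (nonres_gauss pp po pq') (nonres_gauss pq oq qp') !eisenstein // => e.
have -> : (p %% 4 == 3)%N = odd p./2 by have := modn2 p; rewrite po; clear; lia.
have -> : (q %% 4 == 3)%N = odd q./2 by have := modn2 q; rewrite oq; clear; lia.
by rewrite -e addbCA addbb addbF.
Qed.
End Legendre.

(** * Non-vanishing for real characters *)

Section NonVanishing.
Local Open Scope ring_scope.
Variable R : rcfType.

Lemma abel_bound (f w : nat -> R) (B : R) (n : nat) :
  (forall m, `|\sum_(0 <= i < m) f i| <= B) -> (forall i, 0 <= w i) ->
  (forall i, w i.+1 <= w i) -> `|\sum_(0 <= i < n) f i * w i| <= B * w 0%N.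
Proof.
move=> hf w0 wd; pose S m := \sum_(0 <= i < m) f i.
have E : \sum_(0 <= i < n) f i * w i =
   \sum_(0 <= i < n) S i.+1 * (w i - w i.+1) + S n * w n.
  elim: n => [|n IH]; first by rewrite !big_geq // /S big_geq // mul0r addr0.
  rewrite !(@big_nat_recr _ _ _ n) //= IH /S (@big_nat_recr _ _ _ n) //=; ring.
rewrite E; apply: (@le_trans _ _ (B * (w 0%N - w n) + B * w n)); last by rewrite -mulrDr subrK.
apply: le_trans (ler_normD _ _) _; apply: lerD; last first.
  by rewrite normrM (ger0_norm (w0 n)); apply: ler_wpM2r => //; apply: hf.
have -> : B * (w 0%N - w n) = \sum_(0 <= i < n) B * (w i - w i.+1).
  rewrite -big_distrr /=; congr (_ * _).
  by rewrite -[RHS]opprK -sumrN; under eq_bigr do rewrite opprB; rewrite telescope_sumr // opprB.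
apply: le_trans (ler_norm_sum _ _ _) _; apply: ler_sum => i _.
have h : 0 <= w i - w i.+1 by rewrite subr_ge0.
by rewrite normrM (ger0_norm h); apply: ler_wpM2r => //; apply: hf.
Qed.

Variable N : nat.
Hypothesis N0 : (0 < N)%N.

(** What the analytic argument needs of a non-principal real character. *)
Definition periodic0 (f : nat -> int) :=
  [/\ forall a, f (a + N)%N = f a, forall a, `|f a| <= 1 & \sum_(0 <= a < N) f a = 0].

Lemma periodic0_shift f b : periodic0 f -> \sum_(0 <= i < N) f (b + i)%N = 0.
Proof.
case=> hp _ h0; elim: b => [|b IH]; first by under eq_bigr do rewrite add0n.
rewrite -[RHS]IH; case: N N0 hp => // n _ hp.
rewrite big_nat_recr //= [in RHS]big_nat_recl //= addn0 addrC; congr (_ + _).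
  by rewrite -[RHS]hp addSnnS.
by apply: eq_bigr => i _; rewrite addSnnS.
Qed.

Lemma periodic0_sum f b m : periodic0 f -> `|\sum_(0 <= i < m) f (b + i)%N| <= N%:Z.
Proof.
move=> hf; elim/ltn_ind: m b => m IH b.
have [mN|mN] := leqP N m.
  rewrite (@big_cat_nat _ _ _ N) //= periodic0_shift // add0r.
  rewrite -{1}[N]add0n big_addn; under eq_bigr do rewrite addnCA addnC -addnA.
  under eq_bigr do rewrite addnA.
  rewrite (_ : \sum_(_ <= _ < _) _ = \sum_(0 <= i < m - N) f ((b + N) + i)%N); last first.
    by apply: eq_bigr => i _; congr f; lia.
  by apply: IH; lia.
apply: le_trans (ler_norm_sum _ _ _) _.
apply: (@le_trans _ _ (\sum_(0 <= i < m) (1 : int))).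
  by apply: ler_sum => i _; case: hf.
by rewrite big_const_nat subn0 iter_addr_0 -[1 *+ m]/(m%:R) ; lia.
Qed.

(** The weight e^(-1/2) is 1/k at e = k^2, so that the squares alone diverge, while the sums of a
    character stay bounded. *)
Let s (n : nat) : R := Num.sqrt n%:R.
Let w (n : nat) : R := (s n)^-1.

Lemma wM a b : w (a * b) = w a * w b.
Proof. by rewrite /w /s natrM sqrtrM ?ler0n // invfM. Qed.
Lemma w_sqr k : w (k ^ 2) = (k%:R)^-1.
Proof. by rewrite /w /s natrX sqrtr_sqr ger0_norm ?ler0n. Qed.
Lemma w_ge0 k : 0 <= w k. Proof. by rewrite invr_ge0 sqrtr_ge0. Qed.
Lemma s_gt0 k : (0 < k)%N -> 0 < s k. Proof. by move=> k0; rewrite sqrtr_gt0 ltr0n. Qed.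
Lemma w_le a b : (0 < a)%N -> (a <= b)%N -> w b <= w a.
Proof.
move=> a0 ab; rewrite lef_pV2 ?posrE ?s_gt0 ?(leq_trans a0) //.
by rewrite ler_wsqrtr // ler_nat.
Qed.

Lemma sum_w y : \sum_(1 <= a < y.+1) w a <= 2 * s y.
Proof.
elim: y => [|y IH]; first by rewrite big_geq // mulr_ge0 // sqrtr_ge0.
rewrite big_nat_recr //=; apply: le_trans (lerD IH (lexx _)) _.
rewrite -lerBrDl -mulrBr.
have p : 0 < s y.+1 by apply: s_gt0.
have q : 0 <= s y by apply: sqrtr_ge0.
have e1 : s y.+1 ^+ 2 = y.+1%:R by rewrite sqr_sqrtr ?ler0n.
have e2 : s y ^+ 2 = y%:R by rewrite sqr_sqrtr ?ler0n.
have e3 : s y.+1 ^+ 2 - s y ^+ 2 = 1 by rewrite e1 e2 -natrB // subSnn.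
rewrite /w -(ler_pM2l p) mulfV ?gt_eqF //.
have -> : s y.+1 * (2 * (s y.+1 - s y)) = (s y.+1 - s y) ^+ 2 + (s y.+1 ^+ 2 - s y ^+ 2) by ring.
by rewrite e3 lerDr sqr_ge0.
Qed.

Section Conv.
Variables f g : nat -> int.
Hypotheses (hf : periodic0 f) (hg : periodic0 g).

Lemma tail_bound h a b : periodic0 h -> (0 < a)%N ->
  `|\sum_(a <= i < b) (h i)%:~R * w i| <= N%:R * w a.
Proof.
move=> hh a0; rewrite -{1}[a]add0n big_addn.
have := @abel_bound (fun i => (h (a + i)%N)%:~R) (fun i => w (a + i)) N%:R (b - a).
rewrite addn0 /=; under eq_bigr do rewrite addnC; apply.
- move=> m; rewrite -rmorph_sum /= -intr_norm -[N%:R]/(N%:Z%:~R) ler_int.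
  exact: periodic0_sum.
- by move=> i; apply: w_ge0.
- by move=> i; apply: w_le; [exact: ltn_addr | rewrite addnS].
Qed.

Definition conv (e : nat) : int := \sum_(1 <= a < e.+1 | (a %| e)%N) f a * g (e %/ a)%N.

Lemma reindex_mul (Y a : nat) (G : nat -> R) : (0 < a)%N ->
  \sum_(1 <= b < Y.+1 | (a * b <= Y)%N) G b = \sum_(1 <= e < Y.+1 | (a %| e)%N) G (e %/ a)%N.
Proof.
move=> a0.
have inY b : b \in index_iota 1 Y.+1 -> (0 < b)%N && (b < Y.+1)%N by rewrite mem_index_iota.
transitivity (\sum_(1 <= b < Y.+1) \sum_(1 <= e < Y.+1 | (e == a * b)%N) G b).
  rewrite big_mkcond /= big_seq [RHS]big_seq; apply: eq_bigr => b /inY /andP[b0 bY].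
  rewrite big_mkcond /=; case: leqP => h.
    rewrite (bigD1_seq (a * b)%N) ?iota_uniq //=; last first.
      by rewrite mem_index_iota muln_gt0 a0 b0.
    by rewrite eqxx big1 ?addr0 // => e /negPf ->.
  rewrite big_seq big1 // => e /inY /andP[_ eY]; case: eqP => // ee.
  by move: eY; rewrite ee ltnS leqNgt h.
rewrite (exchange_big_dep xpredT) //= [RHS]big_mkcond /= big_seq [RHS]big_seq.
apply: eq_bigr => e /inY /andP[e0 eY]; case: ifP => [ae|nae].
  rewrite big_mkcond /= (bigD1_seq (e %/ a)%N) ?iota_uniq //=; last first.
    by rewrite mem_index_iota divn_gt0 // (dvdn_leq e0 ae) (leq_ltn_trans (leq_div _ _) eY).
  rewrite mulnC divnK // eqxx big1 ?addr0 // => b hb; case: eqP => // eb.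
  by move: hb; rewrite eb mulKn // eqxx.
rewrite big1 // => b /eqP eb; by move: nae; rewrite eb dvdn_mulr.
Qed.

Lemma conv_sum Y : \sum_(1 <= e < Y.+1) (conv e)%:~R * w e =
  \sum_(1 <= a < Y.+1) \sum_(1 <= b < Y.+1 | (a * b <= Y)%N)
    ((f a)%:~R * w a) * ((g b)%:~R * w b).
Proof.
transitivity (\sum_(1 <= e < Y.+1) \sum_(1 <= a < Y.+1 | (a %| e)%N)
    ((f a)%:~R * w a) * ((g (e %/ a)%N)%:~R * w (e %/ a))).
  rewrite big_seq [RHS]big_seq; apply: eq_bigr => e; rewrite mem_index_iota => /andP[e0 eY].
  rewrite /conv rmorph_sum /= big_distrl /=.
  rewrite (@big_nat_widen _ _ _ _ _ Y.+1) //.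
  apply: congr_big_nat => // a /andP[a0 aY].
    by apply: andb_idr => ae; rewrite ltnS dvdn_leq.
  move: a0 => /andP[ae _]; rewrite rmorphM /=.
  have -> : w e = w a * w (e %/ a)%N by rewrite -wM mulnC divnK.
  ring.
rewrite (exchange_big_dep xpredT) //=; rewrite big_seq [RHS]big_seq.
apply: eq_bigr => a; rewrite mem_index_iota => /andP[a0 _].
by rewrite (reindex_mul Y (fun b => ((f a)%:~R * w a) * ((g b)%:~R * w b))).
Qed.

Lemma range_div (Y a : nat) (G : nat -> R) : (0 < a)%N ->
  \sum_(1 <= b < Y.+1 | (a * b <= Y)%N) G b = \sum_(1 <= b < (Y %/ a).+1) G b.
Proof.
move=> a0; rewrite [RHS](@big_nat_widen _ _ _ _ _ Y.+1) ?ltnS ?leq_div //.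
by apply: eq_bigl => b; rewrite ltnS leq_divRL // mulnC.
Qed.

(** The inner tail starts beyond [y] and is at most N / sqrt(y + 1), whatever its end; against it
    stands the sum of 1 / sqrt(a) up to [y], at most 2 sqrt(y). *)
Lemma side_bound (h k : nat -> int) (y : nat) : periodic0 k -> (forall a, `|h a| <= 1) ->
  `|\sum_(1 <= a < y.+1) ((h a)%:~R * w a) *
      (\sum_(y.+1 <= b < (y ^ 2 %/ a).+1) (k b)%:~R * w b)| <= 2 * N%:R.
Proof.
move=> hk hh; apply: le_trans (ler_norm_sum _ _ _) _.
apply: (@le_trans _ _ (\sum_(1 <= a < y.+1) w a * (N%:R * w y.+1))).
  apply: ler_sum => a _; rewrite normrM; apply: ler_pM => //; last exact: tail_bound.
  rewrite normrM (ger0_norm (w_ge0 a)) -[leRHS]mul1r ler_wpM2r ?w_ge0 //.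
  by rewrite -intr_norm -[1]/(1%:~R) ler_int.
rewrite -big_distrl /=; apply: (@le_trans _ _ ((2 * s y) * (N%:R * w y.+1))).
  by rewrite ler_wpM2r ?mulr_ge0 ?ler0n ?w_ge0 ?sum_w.
rewrite mulrACA -[leRHS]mulr1 ler_wpM2l ?mulr_ge0 ?ler0n //.
by rewrite ler_pdivrMr ?s_gt0 // mul1r ler_wsqrtr // ler_nat.
Qed.

(** Under the hyperbola a b <= y^2 the square a, b <= y gives a product of two bounded sums, at most
    N^2, and each of the two arms at most 2 N. *)
Lemma conv_bound y : (0 < y)%N ->
  `|\sum_(1 <= e < (y ^ 2).+1) (conv e)%:~R * w e| <= 4 * N%:R + N%:R ^+ 2.
Proof.
move=> y0; rewrite conv_sum; set Y := (y ^ 2)%N.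
have yY : (y.+1 <= Y.+1)%N by rewrite ltnS /Y -mulnn leq_pmulr.
have [_ hf1 _] := hf; have [_ hg1 _] := hg.
pose al a := (f a)%:~R * w a; pose be b := (g b)%:~R * w b.
rewrite -/(al _); rewrite (@big_cat_nat _ _ _ y.+1) //=.
have -> : \sum_(1 <= a < y.+1) \sum_(1 <= b < Y.+1 | (a * b <= Y)%N) al a * be b =
   (\sum_(1 <= a < y.+1) al a) * (\sum_(1 <= b < y.+1) be b) +
   \sum_(1 <= a < y.+1) al a * (\sum_(y.+1 <= b < (Y %/ a).+1) be b).
  rewrite big_distrl -big_split /= big_seq [RHS]big_seq; apply: eq_bigr => a.
  rewrite mem_index_iota => /andP[a0 ay]; rewrite range_div // -mulrDr -big_distrr /=.
  congr (_ * _); rewrite -big_cat_nat //=; rewrite ltnS leq_divRL // /Y -mulnn leq_mul2l.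
  by rewrite -ltnS ay orbT.
have -> : \sum_(y.+1 <= a < Y.+1) \sum_(1 <= b < Y.+1 | (a * b <= Y)%N) al a * be b =
   \sum_(1 <= b < y.+1) be b * (\sum_(y.+1 <= a < (Y %/ b).+1) al a).
  rewrite (exchange_big_dep xpredT) //= (@big_cat_nat _ _ _ y.+1) //=.
  rewrite [X in _ + X]big_seq [X in _ + X]big1 ?addr0; last first.
    move=> b; rewrite mem_index_iota => /andP[yb _]; rewrite big_seq_cond big1 // => a.
    rewrite mem_index_iota => /andP[/andP[ya _]]; rewrite leqNgt /Y -mulnn => /negP[].
    by rewrite ltn_mul.
  rewrite big_seq [RHS]big_seq; apply: eq_bigr => b; rewrite mem_index_iota => /andP[b0 _].
  rewrite big_distrr /= [RHS](@big_nat_widen _ _ _ _ _ Y.+1) ?ltnS ?leq_div //.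
  by apply: eq_big => [a|a _]; [rewrite ltnS leq_divRL | rewrite mulrC].
apply: le_trans (ler_normD _ _) _.
have b1 := side_bound y hg hf1; have b2 := side_bound y hf hg1.
have t1 : `|\sum_(1 <= a < y.+1) al a| <= N%:R.
  by have := tail_bound y.+1 hf (isT : (0 < 1)%N); rewrite /w /s sqrtr1 invr1 mulr1.
have t2 : `|\sum_(1 <= a < y.+1) be a| <= N%:R.
  by have := tail_bound y.+1 hg (isT : (0 < 1)%N); rewrite /w /s sqrtr1 invr1 mulr1.
have : `|(\sum_(1 <= a < y.+1) al a) * (\sum_(1 <= b < y.+1) be b)| <= N%:R ^+ 2.
  by rewrite normrM expr2 ler_pM.
have := ler_normD ((\sum_(1 <= a < y.+1) al a) * (\sum_(1 <= b < y.+1) be b))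
  (\sum_(1 <= a < y.+1) al a * (\sum_(y.+1 <= b < (Y %/ a).+1) be b)).
rewrite -/Y in b1 b2; rewrite -/al -/be in b1 b2.
move: b1 b2; rewrite /al /be => b1 b2 b3 b4; lra.
Qed.

Hypothesis conv_ge0 : forall e, (0 < e)%N -> 0 <= conv e.
Hypothesis conv_sqr : forall j, 1 <= conv ((j * N + 1) ^ 2)%N.

Lemma conv_lower j : \sum_(0 <= i < j.+1) ((i * N + 1)%N%:R)^-1 <=
   \sum_(1 <= e < ((j * N + 1) ^ 2).+1) (conv e)%:~R * w e.
Proof.
have step j' m : (m < (j' * N + 1) ^ 2)%N ->
   ((j' * N + 1)%N%:R)^-1 <= \sum_(m.+1 <= e < ((j' * N + 1) ^ 2).+1) (conv e)%:~R * w e.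
  move=> hm; rewrite big_nat_recr //= -[leLHS]add0r lerD //.
    rewrite big_seq sumr_ge0 // => e; rewrite mem_index_iota => /andP[he _].
    by rewrite mulr_ge0 ?w_ge0 // ler0z conv_ge0 //; case: e he.
  rewrite w_sqr -[leLHS]mul1r ler_wpM2r ?invr_ge0 ?ler0n // -[1]/(1%:~R) ler_int.
  exact: conv_sqr.
elim: j => [|j IH].
  by rewrite big_nat1 mul0n add0n; have := step 0%N 0%N; rewrite mul0n add0n; apply.
have le : ((j * N + 1) ^ 2 <= (j.+1 * N + 1) ^ 2)%N.
  by rewrite leq_sqr leq_add2r leq_mul2r leqnSn orbT.
rewrite [leRHS](@big_cat_nat _ _ _ ((j * N + 1) ^ 2).+1) // [leLHS]big_nat_recr //=.
by apply: lerD => //; apply: step; rewrite ltn_sqr ltn_add2r ltn_mul2r N0 ltnS leqnn.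
Qed.

Lemma harmonic_lower i : i%:R / 2 <= \sum_(0 <= k < 2 ^ i) (k.+1%:R : R)^-1.
Proof.
elim: i => [|i IH]; first by rewrite mul0r big_nat1 invr1 ler01.
have e2 : (2 ^ i.+1 = 2 ^ i + 2 ^ i)%N by rewrite expnS mul2n addnn.
rewrite (@big_cat_nat _ _ _ (2 ^ i)) //=; last by rewrite e2 leq_addr.
have : (1 : R) / 2 <= \sum_(2 ^ i <= k < 2 ^ i.+1) (k.+1%:R : R)^-1.
  apply: (@le_trans _ _ (\sum_(2 ^ i <= k < 2 ^ i.+1) ((2 ^ i.+1)%:R : R)^-1)).
    rewrite big_const_nat iter_addr_0 e2 addnK -[leRHS]mulr_natr natrD.
    have t0 : (2 ^ i)%:R != 0 :> R by rewrite pnatr_eq0 expn_eq0.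
    move: ((2 ^ i)%:R : R) t0 => t t0.
    have -> : (t + t)^-1 * t = 1 / 2 by rewrite (_ : t + t = 2 * t) ?invfM -?mulrA ?mulVf ?mulr1 ?div1r //; ring.
    by [].
  rewrite big_seq [leRHS]big_seq; apply: ler_sum => k; rewrite mem_index_iota => /andP[_ hk].
  by rewrite lef_pV2 ?posrE ?ltr0n ?expn_gt0 // ler_nat.
by rewrite -[i.+1%:R]natr1 mulrDl; move: IH; lra.
Qed.

(* Evaluating the sum of conv(e) / sqrt(e) over e <= Y by the hyperbola method gives O(1),
   while the squares e = (j N + 1)^2 contribute a divergent harmonic sum: an elementary
   form of the non-vanishing of L(1, chi). *)
Lemma conv_contradiction : False.
Proof.
(* The first 2^i harmonic terms add up to at least i / 2, and 1 / (k N + 1) >= 1 / (N (k + 1)); this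
   [i] makes i / (2 N) exceed 4 N + N^2. *)
pose i := (2 * N * (4 * N + N ^ 2) + 1)%N.
have := conv_lower (2 ^ i).-1; rewrite prednK ?expn_gt0 //.
set y := (_ * N + 1)%N => low.
have y0 : (0 < y)%N by rewrite /y addn1.
have up := le_trans (ler_norm _) (conv_bound y0).
have {low up} h := le_trans low up.
have : i%:R / 2 / N%:R <= (4 * N%:R + N%:R ^+ 2 : R).
  apply: le_trans h; rewrite ler_pdivrMr ?ltr0n //; apply: le_trans (harmonic_lower i) _.
  rewrite big_distrl /=; apply: ler_sum => k _.
  rewrite -ler_pdivrMr ?ltr0n // -invfM -natrM lef_pV2 ?posrE ?ltr0n ?muln_gt0 ?addn1 //.
  by rewrite ler_nat mulSn; lia.
rewrite !ler_pdivrMr ?ltr0n //.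
have -> : (4 * N%:R + N%:R ^+ 2 : R) * N%:R * 2 = (2 * N * (4 * N + N ^ 2))%N%:R.
  by rewrite !natrM natrD natrM natrX; ring.
by rewrite ler_nat /i addn1 ltnn.
Qed.
End Conv.
End NonVanishing.

(** * Reduction of ternary forms *)

Section Ternary.
Local Open Scope ring_scope.
Implicit Types a b c d e f x y z k s t u : int.

Lemma round_int (b a : int) : 0 < a -> exists k, - a <= 2 * (b - k * a) <= a.
Proof.
move=> a0; have e := divz_eq b a; have h1 := modz_ge0 b (lt0r_neq0 a0); have h2 := ltz_pmod b a0.
move: e h1 h2; move: (b %/ a)%Z (b %% a)%Z => k d e h1 h2.
have [h|h] := leP (2 * d) a.
  by exists k; rewrite e; apply/andP; split; lra.
by exists (k + 1); rewrite e; apply/andP; split; lra.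
Qed.

Lemma sqr_half (b a : int) : - a <= 2 * b <= a -> 4 * b ^+ 2 <= a ^+ 2.
Proof.
move=> /andP[h1 h2]; have : 0 <= (a - 2 * b) * (a + 2 * b) by apply: mulr_ge0; lra.
by lra.
Qed.

Lemma binary_unimodular a b d : 0 < a -> a * d - b ^+ 2 = 1 ->
  forall x y, exists s t, a * x ^+ 2 + 2 * b * x * y + d * y ^+ 2 = s ^+ 2 + t ^+ 2.
Proof.
move: {2}`|a|%N (leqnn `|a|%N) => N.
elim: N a b d => [|N IH] a b d hN a0 det x y; first by lia.
have [k hk] := round_int b a0; have hq := sqr_half hk.
set b' := b - k * a in hk hq; pose d' := d - 2 * k * b + k ^+ 2 * a.
have det' : a * d' - b' ^+ 2 = 1 by rewrite /d' /b' -[RHS]det; ring.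
have E : a * x ^+ 2 + 2 * b * x * y + d * y ^+ 2
   = a * (x + k * y) ^+ 2 + 2 * b' * (x + k * y) * y + d' * y ^+ 2.
  by rewrite /d' /b'; ring.
have [a1|a1] := eqVneq a 1.
  exists (x + k * y + b' * y), y; rewrite E a1 in det' *.
  have -> : d' = 1 + b' ^+ 2 by lra.
  by ring.
have a2 : 2 <= a by lia.
have d0 : 0 < d'.
  by rewrite -(pmulr_rgt0 _ a0); have := sqr_ge0 b'; lra.
have da : d' < a.
  rewrite -(ltr_pM2l a0); have : 0 <= (a - 2) * a by apply: mulr_ge0; lra.
  by lra.
have [||s [t est]] := IH d' b' a _ d0 _ y (x + k * y).
- by clear -hN da d0 a0; lia.
- by rewrite -[RHS]det'; ring.
by exists s, t; rewrite E -est; ring.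
Qed.

(** Two nested descents, on a and on A = a d - b^2. When neither can be lowered, A <= C gives 3 A^2
    <= 4 a and a <= d2 gives 3 a^2 <= 4 A, so a = 1; completing the square leaves a binary form of
    determinant 1. *)
Lemma ternary_unimodular a b c d e f : 0 < a -> 0 < a * d - b ^+ 2 ->
  a * d * f + 2 * b * c * e - a * e ^+ 2 - d * c ^+ 2 - f * b ^+ 2 = 1 ->
  forall x y z, exists s t u,
    a * x ^+ 2 + 2 * b * x * y + 2 * c * x * z + d * y ^+ 2 + 2 * e * y * z + f * z ^+ 2
    = s ^+ 2 + t ^+ 2 + u ^+ 2.
Proof.
move: {2}`|a|%N (leqnn `|a|%N) => N.
elim: N a b c d e f => [|N IH] a b c d e f hN a0; first by lia.
move: {2}`|(a * d - b ^+ 2)%R|%N (leqnn `|(a * d - b ^+ 2)%R|%N) => M.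
elim: M b c d e f => [|M IHM] b c d e f hM A0 det x y z; first by lia.
have [A eA0] : exists A, A = a * d - b ^+ 2 by exists (a * d - b ^+ 2).
rewrite -eA0 in hM A0.
have [k hk] := round_int (a * e - b * c) A0.
pose c' := c - k * b; pose e' := e - k * d; pose f' := f - 2 * k * e + k ^+ 2 * d.
have hq := sqr_half hk.
have eB : a * e' - b * c' = a * e - b * c - k * A by rewrite /e' /c' eA0; ring.
rewrite -eB in hk hq.
have det1 : a * d * f' + 2 * b * c' * e' - a * e' ^+ 2 - d * c' ^+ 2 - f' * b ^+ 2 = 1.
  by rewrite -[RHS]det /c' /e' /f'; ring.
have E1 : a * x ^+ 2 + 2 * b * x * y + 2 * c * x * z + d * y ^+ 2 + 2 * e * y * z + f * z ^+ 2
  = a * x ^+ 2 + 2 * b * x * (y + k * z) + 2 * c' * x * z + d * (y + k * z) ^+ 2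
    + 2 * e' * (y + k * z) * z + f' * z ^+ 2 by rewrite /c' /e' /f'; ring.
have detg : A * (a * f' - c' ^+ 2) = a + (a * e' - b * c') ^+ 2.
  by rewrite -[a in X in _ = X + _]mulr1 -{1}det1 eA0; ring.
set C := a * f' - c' ^+ 2 in detg.
have C0 : 0 < C.
  by rewrite -(pmulr_rgt0 _ A0) detg; have := sqr_ge0 (a * e' - b * c'); lra.
(* Exchanging y and z turns the minor A into C. *)
have [CA|AC] := ltP C A.
  have [||s [t [u est]]] := IHM c' b f' e' d _ C0 _ x z (y + k * z).
  - by clear -hM CA C0 A0; rewrite /C in CA C0; lia.
  - by rewrite -[RHS]det1; ring.
  by exists s, t, u; rewrite E1 -est; ring.
have hA : 3 * A ^+ 2 <= 4 * a.
  have : A * A <= A * C by rewrite ler_pM2l.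
  by rewrite detg; lra.
have [m hm] := round_int b a0; have hmq := sqr_half hm.
pose b2 := b - m * a; pose c2 := c'; pose d2 := d - 2 * m * b + m ^+ 2 * a.
pose e2 := e' - m * c'.
rewrite -/b2 in hm hmq.
have eA : a * d2 - b2 ^+ 2 = A by rewrite /d2 /b2 eA0; ring.
have det2 : a * d2 * f' + 2 * b2 * c' * e2 - a * e2 ^+ 2 - d2 * c' ^+ 2 - f' * b2 ^+ 2 = 1.
  by rewrite -[RHS]det1 /b2 /d2 /e2; ring.
have E2 : a * x ^+ 2 + 2 * b * x * (y + k * z) + 2 * c' * x * z + d * (y + k * z) ^+ 2
    + 2 * e' * (y + k * z) * z + f' * z ^+ 2 =
   a * (x + m * (y + k * z)) ^+ 2 + 2 * b2 * (x + m * (y + k * z)) * (y + k * z)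
   + 2 * c' * (x + m * (y + k * z)) * z + d2 * (y + k * z) ^+ 2
    + 2 * e2 * (y + k * z) * z + f' * z ^+ 2 by rewrite /b2 /d2 /e2; ring.
rewrite E1 E2; move: (x + m * (y + k * z)) => X; move: (y + k * z) => Y.
have d0 : 0 < d2.
  by rewrite -(pmulr_rgt0 _ a0); have := sqr_ge0 b2; lra.
(* Exchanging x and y turns the coefficient a into d2. *)
have [da|ad] := ltP d2 a.
  have [|||s [t [u est]]] := IH d2 b2 e2 a c' f' _ d0 _ _ Y X z.
  - by clear -hN da d0 a0; lia.
  - by rewrite mulrC eA.
  - by rewrite -[RHS]det2; ring.
  by exists s, t, u; rewrite -est; ring.
have a1 : a = 1.
  have h1 : a * a <= a * d2 by rewrite ler_pM2l.
  have h2 : 3 * a ^+ 2 <= 4 * A by lra.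
  apply/eqP; rewrite eq_le; apply/andP; split; last by clear -a0; lia.
  rewrite leNgt; apply/negP => a2; clear -a2 h2 hA; move: A a2 h2 hA => A a2 h2 hA.
  have k1 : 0 <= a * (a - 2) by apply: mulr_ge0; lia.
  have k2 : 3 * a <= 2 * A by lra.
  have k3 : 0 <= A * (2 * A - 3 * a) by apply: mulr_ge0; lia.
  have k4 : 0 <= a * (A - 3) by apply: mulr_ge0; lia.
  by lra.
rewrite a1 in det2 *.
have [||s [t est]] := @binary_unimodular (d2 - b2 ^+ 2) (e2 - b2 * c') (f' - c' ^+ 2) _ _ Y z.
- by move: A0; rewrite -eA a1 mul1r.
- by rewrite -[RHS]det2; ring.
by exists (X + b2 * Y + c' * z), s, t; rewrite -[RHS]addrA -est; ring.
Qed.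

(** A form of determinant 1 is built with last coefficient [r], so that it takes the value [r] at
    (0, 0, 1). Its remaining entries are (A + l^2) / r, (B + l l2) / r and (C + l2^2) / r, with [l2]
    chosen to make the second one integral; its determinant is (A C - B^2) / r. *)
Lemma three_squares_criterion (r A B C l : int) : 0 < r -> 0 < A -> coprimez A r ->
  A * C = B ^+ 2 + r -> (r %| l ^+ 2 + A)%Z ->
  exists s t u, r = s ^+ 2 + t ^+ 2 + u ^+ 2.
Proof.
move=> r0 A0 co hAC hl.
have r1 : r != 0 by rewrite gt_eqF.
have col : coprimez l r.
  have : (gcdz l r %| gcdz A r)%Z.
    rewrite dvdz_gcd dvdz_gcdr andbT.
    have h1 : (gcdz l r %| l ^+ 2 + A)%Z := dvdz_trans (dvdz_gcdr _ _) hl.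
    have h2 : (gcdz l r %| l ^+ 2)%Z by rewrite expr2 dvdz_mulr // dvdz_gcdl.
    by have := rpredB h1 h2; rewrite addrAC subrr add0r.
  by rewrite (eqP co) dvdz1 => /eqP h; rewrite /coprimez /gcdz; apply/eqP; congr Posz.
have /coprimezP[[l' m] /= hl'] := col.
have /dvdzP[a11 h11] := hl.
pose l2 := - B * l'.
have /dvdzP[a12 h12] : (r %| B + l * l2)%Z.
  apply/dvdzP; exists (B * m); rewrite /l2.
  by transitivity (B * (l' * l + m * r) + l * (- B * l')); [rewrite hl' mulr1 | ring].
have /dvdzP[a22 h22] : (r %| C + l2 ^+ 2)%Z.
  rewrite -(Gauss_dvdzr _ (n := A)) 1?coprimez_sym //.
  apply/dvdzP; exists (1 + l2 ^+ 2 * a11 + B * a12 - l * l2 * a12).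
  have -> : (1 + l2 ^+ 2 * a11 + B * a12 - l * l2 * a12) * r =
     r + l2 ^+ 2 * (a11 * r) + (B - l * l2) * (a12 * r) by ring.
  rewrite -h11 -h12 mulrDr hAC; ring.
have det : a11 * a22 * r + 2 * a12 * l * l2 - a11 * l2 ^+ 2 - a22 * l ^+ 2 - r * a12 ^+ 2 = 1.
  apply: (mulIf r1); rewrite mul1r.
  transitivity ((a11 * r) * (a22 * r) + 2 * (a12 * r) * l * l2 - (a11 * r) * l2 ^+ 2
     - (a22 * r) * l ^+ 2 - (a12 * r) ^+ 2); first by ring.
  rewrite -h11 -h12 -h22.
  transitivity (A * C - B ^+ 2); first by ring.
  by rewrite hAC; ring.
have a0 : 0 < a11.
  by rewrite -(pmulr_lgt0 _ r0) -h11; have := sqr_ge0 l; lra.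
have d0 : 0 < a11 * a22 - a12 ^+ 2.
  rewrite -(pmulr_lgt0 _ (exprn_gt0 2 r0)).
  have -> : (a11 * a22 - a12 ^+ 2) * r ^+ 2 = (a11 * r) * (a22 * r) - (a12 * r) ^+ 2 by ring.
  rewrite -h11 -h12 -h22 -(pmulr_rgt0 _ A0).
  have -> : A * ((l ^+ 2 + A) * (C + l2 ^+ 2) - (B + l * l2) ^+ 2) =
    (A * l2 - B * l) ^+ 2 + (A * C - B ^+ 2) * (l ^+ 2 + A) by ring.
  have -> : A * C - B ^+ 2 = r by rewrite hAC; ring.
  have h1 : 0 < r * (l ^+ 2 + A) by apply: mulr_gt0 => //; have := sqr_ge0 l; lra.
  by have := sqr_ge0 (A * l2 - B * l); lra.
have [s [t [u est]]] := ternary_unimodular a0 d0 det 0 0 1.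
by exists s, t, u; rewrite -est; ring.
Qed.
End Ternary.

(** * Real characters *)

Section Characters.
Local Open Scope ring_scope.
Variable N : nat.
Hypothesis N0 : (0 < N)%N.

(** Real Dirichlet characters with values in bits, so that prescribing several of them becomes
    linear algebra over F_2. *)
Definition additive_char (k : nat -> bool) := (forall a, k (a + N)%N = k a) /\
  (forall a b, coprime a N -> coprime b N -> k (a * b)%N = k a (+) k b).

Definition charz (k : nat -> bool) (a : nat) : int := if coprime a N then (-1) ^+ k a else 0.

Lemma addb_char k l : additive_char k -> additive_char l -> additive_char (fun a => k a (+) l a).
Proof.
case=> k1 k2 [l1 l2]; split=> [a|a b ha hb]; first by rewrite k1 l1.
by rewrite k2 // l2 // addbACA.
Qed.

Lemma char1 k : additive_char k -> k 1 = false.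
Proof. by case=> _ /(_ 1 1 (coprime1n _) (coprime1n _))%N; rewrite muln1; case: (k _). Qed.

Lemma char_prod k (s : seq nat) : additive_char k -> {in s, forall q, coprime q N} ->
  k (\prod_(q <- s) q)%N = \big[addb/false]_(q <- s) k q.
Proof.
move=> hk; have [_ kM] := hk; elim: s => [|q s IH] hs; first by rewrite !big_nil char1.
have hs' : {in s, forall q, coprime q N} by move=> x xs; apply: hs; rewrite inE xs orbT.
have hq := hs q (mem_head _ _); rewrite !big_cons kM ?(IH hs') //.
rewrite big_seq; apply: (big_ind (fun x => coprime x N)) => [|x y hx hy|x xs].
- exact: coprime1n.
- by rewrite coprimeMl hx.
exact: hs'.
Qed.

Lemma charX k q i : additive_char k -> coprime q N -> k (q ^ i)%N = odd i && k q.
Proof.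
move=> hk hq; have [_ kM] := hk; elim: i => [|i IH]; first by rewrite expn0 char1.
by rewrite expnS kM ?coprimeXl // IH /=; case: (odd i); case: (k q).
Qed.

Lemma charz_periodic0 k w : additive_char k -> coprime w N -> k w -> periodic0 N (charz k).
Proof.
move=> [kp kM] hw kw.
have fp a : charz k (a + N)%N = charz k a by rewrite /charz kp -coprime_modl modnDr coprime_modl.
have fm a : charz k (a %% N)%N = charz k a.
  by rewrite [in RHS](divn_eq a N); elim: (a %/ N)%N => // n IH; rewrite mulSn -addnA addnC fp.
have fw a : charz k (w * a)%N = - charz k a.
  rewrite /charz coprimeMl hw /=; case: ifP => ha; last by rewrite oppr0.
  by rewrite kM // kw signr_addb expr1 mulN1r.
split=> // [a|]; first by rewrite /charz; case: ifP => _; rewrite ?normr_sign // normr0.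
pose g (a : 'I_N) := Ordinal (ltn_pmod (w * a)%N N0).
have ig : injective g.
  have mono (a b : 'I_N) : (a <= b)%N -> (w * a = w * b %[mod N])%N -> a = b.
    move=> le /esym/eqP; rewrite eqn_mod_dvd ?leq_mul2l ?le ?orbT // -mulnBr.
    rewrite Gauss_dvdr; last by rewrite coprime_sym.
    move=> dv; apply: val_inj => /=; apply/eqP; rewrite eqn_leq le /= -subn_eq0.
    move: dv; have := ltn_ord b; case: (b - a)%N (leq_subr a b) => // n ln lb /dvdn_leq -/(_ isT).
    by rewrite leqNgt (leq_ltn_trans ln lb).
  move=> a b /(congr1 val) /= e; case: (leqP a b) => [|/ltnW] le; first exact: mono.
  by apply/esym/mono => //; rewrite e.
rewrite big_mkord; set S := \sum_(_ < N) _.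
have : S = - S.
  rewrite {1}/S (reindex_inj ig) /= -sumrN; apply: eq_bigr => a _.
  by rewrite fm fw.
by clear; lia.
Qed.

Variables (k l : nat -> bool).
Hypotheses (hk : additive_char k) (hl : additive_char l).
Hypothesis split_k : forall q, prime q -> coprime q N -> ~~ l q -> ~~ k q.

Definition divsum (e : nat) : int := \sum_(b <- divisors e) (-1) ^+ l b.

(** At a divisor [a] of [e] the exponents add up to k(e) + l(a). So [divsum] is the coefficient of
    the product of the zeta function and the L-function of [l], twisted here by [k]. *)
Lemma conv_charz e : (0 < e)%N -> conv (charz (fun a => k a (+) l a)) (charz k) e =
  if coprime e N then (-1) ^+ k e * divsum e else 0.
Proof.
move=> e0; rewrite /conv.
have pe : perm_eq (filter (fun a => a %| e)%N (index_iota 1 e.+1)) (divisors e).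
  apply: uniq_perm; [by rewrite filter_uniq ?iota_uniq | exact: divisors_uniq |].
  move=> a; rewrite mem_filter mem_index_iota -dvdn_divisors // ltnS.
  by case de: (a %| e)%N => //=; rewrite (dvdn_gt0 e0 de) dvdn_leq.
rewrite -big_filter (perm_big _ pe) /= mulr_sumr; case: ifP => [he|he].
  rewrite big_seq [RHS]big_seq; apply: eq_bigr => a; rewrite -dvdn_divisors // => de.
  have ee : e = (a * (e %/ a))%N by rewrite mulnC divnK.
  have [ha hb] : coprime a N /\ coprime (e %/ a) N by apply/andP; rewrite -coprimeMl -ee.
  rewrite /charz ha hb {2}ee (proj2 hk) // !signr_addb.
  by rewrite mulrAC.
rewrite big_seq big1 // => a; rewrite -dvdn_divisors // => de.
have ee : e = (a * (e %/ a))%N by rewrite mulnC divnK.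
rewrite /charz; move: he; rewrite {1}ee coprimeMl.
by case: (coprime a N) => //=; rewrite ?mul0r // => ->; rewrite mulr0.
Qed.

Lemma divsumM q i e : prime q -> (0 < e)%N -> ~~ (q %| e)%N -> coprime (q ^ i.+1 * e) N ->
  divsum (q ^ i.+1 * e) = (if l q then (~~ odd i.+1 : nat)%:Z else i.+2%:Z) * divsum e.
Proof.
move=> pq e0 qe; rewrite coprimeMl coprime_pexpl // => /andP[hq he].
rewrite /divsum (perm_big _ (perm_divisors_pfactor i.+1 pq e0 qe)) big_allpairs_dep.
have -> : \sum_(j <- iota 0 i.+2) \sum_(b <- divisors e) (-1) ^+ l (q ^ j * b)%N =
   \sum_(j <- iota 0 i.+2) (-1) ^+ (odd j && l q) * divsum e.
  apply: eq_bigr => j _; rewrite mulr_sumr big_seq [RHS]big_seq; apply: eq_bigr => b.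
  rewrite -dvdn_divisors // => be.
  by rewrite (proj2 hl) ?charX ?signr_addb // ?coprimeXl // (coprime_dvdl be).
rewrite -mulr_suml; congr (_ * _); rewrite -/(index_iota 0 i.+2) big_mkord.
case: (l q); last by under eq_bigr do rewrite andbF expr0; rewrite sumr_const card_ord natz.
elim: i.+1 => [|n IH]; first by rewrite big_ord1 /= expr0.
by rewrite big_ord_recr /= IH andbT; case: (odd n).
Qed.

(** A nonzero coefficient requires an even exponent at every prime with [l q], and at the other
    primes [split_k] gives [~~ k q]. Either way the prime contributes nothing to [k e]. *)
Lemma divsum_sign e : (0 < e)%N -> coprime e N -> divsum e = 0 \/ 0 < divsum e /\ k e = false.
Proof.
move: e; apply: prime_power_ind => [_|q [//|i] e pq _ e0 qe IH he].
  by right; rewrite /divsum big_cons big_nil (char1 hk) (char1 hl) addr0.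
rewrite (divsumM pq e0 qe he); move: he; rewrite coprimeMl => /andP[hqi he].
have hq : coprime q N by move: hqi; rewrite coprime_pexpl.
case: (IH he) => [->|[d0 ke]]; first by left; rewrite mulr0.
rewrite (proj2 hk) // charX // ke addbF.
case lq: (l q); last by right; rewrite (negPf (split_k pq hq (negbT lq))) andbF mulr_gt0.
by case: (odd i.+1) => /=; [left; rewrite mul0r | right; rewrite mul1r].
Qed.

Lemma divsum_sqr e : (0 < e)%N -> coprime e N -> 0 < divsum (e ^ 2).
Proof.
move: e; apply: prime_power_ind => [_|q [//|i] e pq _ e0 qe IH he].
  by rewrite /divsum big_cons big_nil (char1 hl) addr0.
have ee : ((q ^ i.+1 * e) ^ 2 = q ^ (i.*2.+1).+1 * e ^ 2)%N.
  by rewrite expnMn -expnM muln2.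
have hs : coprime (q ^ (i.*2.+1).+1 * e ^ 2) N by rewrite -ee coprimeXl.
rewrite ee divsumM ?expn_gt0 ?e0 //; last by rewrite Euclid_dvdX // negb_and qe.
move: he; rewrite coprimeMl => /andP[_ he]; rewrite mulr_gt0 ?IH //.
by case: (l q); rewrite //= odd_double.
Qed.

(* If every prime with [~~ l q] also had [~~ k q], the convolution of the characters [k + l] and
   [k] would be nonnegative, as for the zeta function of a biquadratic field. *)
Lemma nonvanishing w : coprime w N -> k w -> ~~ l w -> False.
Proof.
move=> hw kw lw; have hf : periodic0 N (charz (fun a => k a (+) l a)).
  by apply: (charz_periodic0 (w := w)) => //; [exact: addb_char | rewrite kw (negPf lw)].
have hg := charz_periodic0 hk hw kw.
apply: (@conv_contradiction realalg N N0 _ _ hf hg) => [e e0|j].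
  rewrite conv_charz //; case: ifP => // he.
  by case: (divsum_sign e0 he) => [->|[d0 ->]]; rewrite ?mulr0 // expr0 mul1r ltW.
have co : coprime (j * N + 1) N.
  by rewrite -coprime_modl modnMDl coprime_modl coprime1n.
have e0 : (0 < j * N + 1)%N by rewrite addn1.
have e2 : (0 < (j * N + 1) ^ 2)%N by rewrite expn_gt0 e0.
rewrite conv_charz // coprimeXl //; have d0 := divsum_sqr e0 co.
case: (divsum_sign e2 (coprimeXl 2 co)) => [h|[_ ->]]; first by rewrite h in d0.
by rewrite expr0 mul1r -gtz0_ge1.
Qed.
End Characters.

(** * The three squares theorem *)

Section ThreeSquares.
Local Open Scope ring_scope.

(** Over F_2 a linear combination is a sum of distinct vectors; outside the span a column of the
    cokernel is a separating functional. *)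
Lemma span_separation (m : nat) (W : 'rV['F_2]_m -> Prop) (t : 'rV['F_2]_m) :
  (exists s : seq 'rV['F_2]_m, [/\ uniq s, {in s, forall x, W x} & t = \sum_(x <- s) x]) \/
  exists c : 'cV['F_2]_m, (forall x, W x -> x *m c = 0) /\ t *m c != 0.
Proof.
have [b hb] : exists b : 'rV['F_2]_m -> bool, forall x, b x <-> W x.
  apply: (fin_all_exists (P := fun x (y : bool) => y <-> W x)) => x; case: (classic (W x)) => h; first by exists true.
  by exists false.
pose S := [set x | b x]; pose M := \matrix_(i < #|S|) (enum_val i : 'rV['F_2]_m).
have [/submxP[D eD]|nM] := boolP (t <= M)%MS; [left|right].
  exists [seq enum_val i | i <- enum 'I_#|S| & D 0 i != 0]; split.
  - by rewrite map_inj_uniq ?filter_uniq -?enumT ?enum_uniq //; move=> i j /enum_val_inj.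
  - by move=> x /mapP[i _ ->]; apply/hb; have := enum_valP i; rewrite inE.
  rewrite big_map big_filter eD mulmx_sum_row big_enum_cond /= [LHS](bigID (fun i => D 0 i != 0)) /=.
  rewrite [X in _ + X]big1 => [|i /negPn/eqP ->]; last by rewrite scale0r.
  rewrite addr0; apply: eq_bigr => i; rewrite rowK.
  by case: (D 0 i) => [[|[|//]] lt] h //; rewrite (_ : Ordinal lt = 1) ?scale1r //; apply: val_inj.
move: nM; rewrite submxE => /rV0Pn[j hj]; exists (col j (cokermx M)); split=> [x|].
  move=> /hb bx; have xS : x \in S by rewrite inE.
  have : row (enum_rank_in xS x) (M *m cokermx M) = 0 by rewrite mulmx_coker row0.
  rewrite row_mul rowK enum_rankK_in // => e.
  by rewrite colE mulmxA e mul0mx.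
by rewrite colE mulmxA -colE; apply: contraNneq hj => /matrixP/(_ 0 0); rewrite !mxE => ->.
Qed.

Lemma F2_addb (x y : 'F_2) : (x + y != 0) = (x != 0) (+) (y != 0).
Proof. by case: x y => [[|[|//]] ?] [[|[|//]] ?]. Qed.

Lemma F2_boolD (b c : bool) : ((b (+) c : nat)%:R : 'F_2) = b%:R + c%:R.
Proof. by case: b; case: c; apply/val_inj. Qed.

Lemma F2_bool_inj (b c : bool) : (b : nat)%:R = (c : nat)%:R :> 'F_2 -> b = c.
Proof. by case: b; case: c => // /(congr1 val). Qed.

(* Stands in for Dirichlet's theorem on primes in arithmetic progressions: a product of
   primes with [~~ l q] is enough for the three squares theorem. *)
Lemma prime_combination (N m : nat) (beta : 'I_m -> nat -> bool) (l : nat -> bool) (w : nat) :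
  (0 < N)%N -> (forall i, additive_char N (beta i)) -> additive_char N l ->
  coprime w N -> ~~ l w ->
  exists s : seq nat, [/\ uniq s, {in s, forall q, prime q}, {in s, forall q, coprime q N},
    {in s, forall q, ~~ l q} & forall i, beta i (\prod_(q <- s) q)%N = beta i w].
Proof.
move=> N0 hb hl hw lw.
pose v a : 'rV['F_2]_m := \row_i (beta i a : nat)%:R.
pose W x := exists q, [/\ prime q, coprime q N, ~~ l q & v q = x].
case: (span_separation W (v w)) => [[s [us hs ew]]|[c [hc hw2]]].
  have [f hf] := @seq_choice _ _ s 0%N (fun x q => [/\ prime q, coprime q N, ~~ l q & v q = x]) hs.
  have hf' : {in map f s, forall q, [/\ prime q, coprime q N & ~~ l q]}.
    by move=> q /mapP[x xs ->]; have [] := hf x xs.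
  exists (map f s); split.
  - rewrite map_inj_in_uniq // => x y xs ys e.
    by have [_ _ _ <-] := hf x xs; have [_ _ _ <-] := hf y ys; rewrite e.
  - by move=> q /hf'[].
  - by move=> q /hf'[].
  - by move=> q /hf'[].
  move=> i; apply: F2_bool_inj; rewrite (char_prod (hb i)); last by move=> q /hf'[].
  have := congr1 (fun x : 'rV_m => x 0 i) ew; rewrite summxE mxE => ->.
  rewrite (big_morph (fun b : bool => (b : nat)%:R : 'F_2) F2_boolD (erefl _)) big_map.
  rewrite big_seq [RHS]big_seq; apply: eq_bigr => x xs.
  by have [_ _ _ e] := hf x xs; rewrite -{2}e mxE.
(* The separating functional becomes a character that is trivial at every prime where [l] is, but
   not at [w], against [nonvanishing]. *)
exfalso; pose k a := (v a *m c) 0 0 != 0.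
have vM a b : coprime a N -> coprime b N -> v (a * b)%N = v a + v b.
  by move=> ha hb'; apply/rowP => i; rewrite !mxE (proj2 (hb i)) // F2_boolD.
have hk : additive_char N k.
  split=> [a|a b ha hb']; last by rewrite /k vM // mulmxDl mxE F2_addb.
  have -> : k (a + N)%N = ((v (a + N)%N *m c) 0 0 != 0) by [].
  suff -> : v (a + N)%N = v a by []. 
  by apply/rowP => i; rewrite !mxE (proj1 (hb i)).
apply: (nonvanishing N0 hk hl _ hw _ lw).
  move=> q pq hq lq; rewrite /k negbK hc ?mxE //; by exists q.
apply: contraNneq hw2 => e; apply/eqP/matrixP => i j; rewrite !ord1 [RHS]mxE; exact: e.
Qed.

(** At odd primes [chi4] and [chi8] are the symbols of - 1 and 2, by [nonresN1] and [nonres2]. *)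
Definition chi4 (a : nat) := (a %% 4 == 3)%N.
Definition chi8 (a : nat) := (a %% 8 \in [:: 3; 5])%N.

Lemma chi4M a b : odd a -> odd b -> chi4 (a * b)%N = chi4 a (+) chi4 b.
Proof.
rewrite /chi4 => oa ob; have [ha hb] : (a %% 4 = 1 \/ a %% 4 = 3)%N /\ (b %% 4 = 1 \/ b %% 4 = 3)%N.
  by clear -oa ob; lia.
by rewrite -modnMm; case: ha => ->; case: hb => ->.
Qed.

Lemma chi8M a b : odd a -> odd b -> chi8 (a * b)%N = chi8 a (+) chi8 b.
Proof.
have h c : odd c -> (c %% 8 = 1 \/ c %% 8 = 3 \/ c %% 8 = 5 \/ c %% 8 = 7)%N by clear; lia.
rewrite /chi8 => /h ha /h hb; rewrite -modnMm !inE.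
by case: ha => [->|[->|[->|->]]]; case: hb => [->|[->|[->|->]]].
Qed.

Lemma chi_prod (k : nat -> bool) (s : seq nat) : k 1%N = false ->
  (forall a b, odd a -> odd b -> k (a * b)%N = k a (+) k b) -> {in s, forall p, odd p} ->
  k (\prod_(p <- s) p)%N = \big[addb/false]_(p <- s) k p.
Proof.
move=> k1 kM; elim: s => [|p s IH] os; first by rewrite !big_nil.
have os' : {in s, forall p, odd p} by move=> x xs; apply: os; rewrite inE xs orbT.
have op := os p (mem_head _ _); rewrite !big_cons kM ?(IH os') //.
by rewrite big_seq; elim/big_ind: _ => [//|x y ox oy|x /os' //]; rewrite oddM ox oy.
Qed.

Lemma nonres_root p a : prime p -> ~~ nonres p (p.-1 * a)%N -> exists v, (p %| v ^ 2 + a)%N.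
Proof.
move=> pp /negPn/existsP[x /eqP ex]; exists (val x).
rewrite -(Fp_eq0 pp) natrD natrX natr_Zp ex natrM -subn1 natrB ?prime_gt0 // pchar_Fp_0 //.
by rewrite sub0r mulN1r addNr.
Qed.

Definition odd_primes (r : nat) := [seq p <- primes r | odd p].

Lemma sqfree_primes r : sqfree r -> (0 < r)%N -> r = (\prod_(p <- primes r) p)%N.
Proof.
move=> sr r0; rewrite {1}(prod_prime_decomp r0) /primes /unzip1 big_map big_seq [RHS]big_seq.
apply: eq_bigr => -[p k] /mem_prime_decomp[pp k0 dk] /=.
case: k k0 dk => [//|[|k]] _ dk; first by rewrite expn1.
by have /negP[] := sr p pp; apply: dvdn_trans dk; rewrite dvdn_exp2l.
Qed.

Lemma sqfree_odd_part r : sqfree r -> (0 < r)%N ->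
  r = ((if odd r then 1 else 2) * \prod_(p <- odd_primes r) p)%N.
Proof.
move=> sr r0; have op p : p \in primes r -> odd p = (p != 2).
  by rewrite mem_primes => /andP[/even_prime[->|op] _] //; rewrite op; case: eqP op => // ->.
rewrite /odd_primes big_filter {1}(sqfree_primes sr r0); case: ifP => [ro|re].
  rewrite mul1n big_seq [in RHS]big_seq_cond; apply: eq_bigl => p.
  case hp: (p \in primes r) => //=; rewrite op //; apply/esym/negP => /eqP p2.
  by move: hp; rewrite p2 mem_primes r0 dvdn2 ro.
have h2 : 2%N \in primes r by rewrite mem_primes r0 dvdn2 re.
rewrite (bigD1_seq 2%N) ?primes_uniq //=; congr (_ * _)%N.
rewrite big_seq_cond [in RHS]big_seq_cond; apply: eq_bigl => p.
by case hp: (p \in primes r) => //=; rewrite op.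
Qed.
End ThreeSquares.

Section ThreeSquares2.
Local Open Scope ring_scope.

Lemma big_addb_char N (I : eqType) (s : seq I) (k : I -> nat -> bool) :
  {in s, forall i, additive_char N (k i)} ->
  additive_char N (fun a => \big[addb/false]_(i <- s) k i a).
Proof.
move=> hs; split=> [a|a b ha hb].
  by rewrite big_seq [RHS]big_seq; apply: eq_bigr => i /hs[h _].
rewrite big_seq [in RHS]big_seq [X in _ (+) X]big_seq -big_split /=.
by apply: eq_bigr => i /hs[_ ->].
Qed.

Lemma andb_char N (b : bool) k : additive_char N k -> additive_char N (fun a => b && k a).
Proof. by case: b => //= [[h1 h2]]; split=> *; rewrite ?h1 ?h2. Qed.

Lemma nonres_char N p : prime p -> odd p -> (p %| N)%N -> additive_char N (nonres p).
Proof.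
move=> pp po dp; split=> [a|a b ha hb].
  by apply: nonres_mod => //; case/dvdnP: dp => c ->; rewrite addnC modnMDl.
by apply: nonresM => //; rewrite -prime_coprime // coprime_sym; apply: coprime_dvdr dp _.
Qed.

Lemma chi_char N : (8 %| N)%N -> additive_char N chi4 /\ additive_char N chi8.
Proof.
move=> dN; have oN a : coprime a N -> odd a.
  move=> h; rewrite -coprime2n coprime_sym; apply: coprime_dvdr h.
  exact: dvdn_trans dN.
split; split=> [a|a b /oN ha /oN hb]; rewrite ?chi4M ?chi8M // /chi4 /chi8; case/dvdnP: dN => c ->.
  by have -> : ((a + c * 8) %% 4 = a %% 4)%N by clear; lia.
by rewrite addnC modnMDl.
Qed.

Variable r : nat.
Hypotheses (r0 : (0 < r)%N) (sr : sqfree r) (r7 : (r %% 8 != 7)%N).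
Let ps := odd_primes r.
Let r' := (\prod_(p <- ps) p)%N.
Let N := (8 * r)%N.

Lemma odd_primesP p : p \in ps -> [/\ prime p, odd p, (p %| r)%N & (p %| r')%N].
Proof.
move=> h; have := h; rewrite mem_filter mem_primes => /andP[po /and3P[pp _ dp]]; split=> //.
by rewrite /r' (big_rem p h) /= dvdn_mulr.
Qed.

Lemma odd_part_odd : odd r'.
Proof.
rewrite /r' big_seq; elim/big_ind: _ => [//|x y ox oy|x /odd_primesP[] //]; rewrite oddM ox oy.
by [].
Qed.

(* By reciprocity, [split_char q] decides whether [- r] is a square modulo the prime [q]. *)
Definition split_char (a : nat) := (\big[addb/false]_(p <- ps) nonres p a) (+)
  ((~~ odd r && chi8 a) (+) (~~ chi4 r' && chi4 a)).

Lemma split_charP : additive_char N split_char.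
Proof.
have [h4 h8] := @chi_char N (dvdn_mulr _ (dvdnn _)).
apply: addb_char; last by apply: addb_char; apply: andb_char.
apply: big_addb_char => p /odd_primesP[pp po dp _]; apply: nonres_char => //.
exact: dvdn_mull.
Qed.

Lemma coprimeN a : coprime a N = odd a && coprime a r.
Proof. by rewrite /N coprimeMr -[8%N]/(2 ^ 3)%N coprime_pexpr // coprimen2. Qed.

Lemma split_prime_root q : prime q -> coprime q N -> ~~ split_char q ->
  exists v, (q %| v ^ 2 + r)%N.
Proof.
move=> pq hq lq; apply: nonres_root => //; apply: contraNN lq.
move: (hq); rewrite coprimeN => /andP[oq cr].
have qr : ~~ (q %| r)%N by rewrite -prime_coprime.
have q1 := prime_gt1 pq; have qq : ~~ (q %| q.-1)%N by apply/negP => /dvdn_leq; lia.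
have nqp p : p \in ps -> ~~ (q %| p)%N.
  by case/odd_primesP => _ _ dp _; apply: contra qr => /dvdn_trans; apply.
rewrite nonresM // nonresN1 // -/(chi4 q) (sqfree_odd_part sr r0) -/ps -/r' /split_char.
have nr' : nonres q r' = \big[addb/false]_(p <- ps) nonres q p.
  have : {in ps, forall p, ~~ (q %| p)%N} by [].
  rewrite /r'; elim: ps => [|p s IH] hs.
    rewrite !big_nil; apply: negbTE; rewrite /nonres negbK; apply/existsP; exists 1.
    by rewrite expr1n.
  have hs' : {in s, forall p, ~~ (q %| p)%N} by move=> x xs; apply: hs; rewrite inE xs orbT.
  have hp := hs p (mem_head _ _); rewrite !big_cons nonresM ?(IH hs') //.
  by rewrite big_seq; elim/big_ind: _ => [|x y hx hy|x /hs' //]; rewrite ?Euclid_dvd1 // Euclid_dvdM // negb_or hx.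
have rec : \big[addb/false]_(p <- ps) nonres q p =
    (\big[addb/false]_(p <- ps) nonres p q) (+) (chi4 r' && chi4 q).
  have -> : chi4 r' && chi4 q = \big[addb/false]_(p <- ps) (chi4 p && chi4 q).
    rewrite /r' chi_prod //; [|exact: chi4M|by move=> p /odd_primesP[]].
    by rewrite (big_morph (fun b => b && chi4 q) (fun _ _ => andb_addl _ _ _) (erefl _)).
  rewrite -big_split /= big_seq [RHS]big_seq; apply: eq_bigr => p pin.
  have [pp po _ _] := odd_primesP pin; rewrite quadratic_reciprocity //; first by rewrite andbC.
  by apply: contraNneq (nqp p pin) => ->.
have qr' : ~~ (q %| r')%N.
  by apply: contra qr => h; rewrite (sqfree_odd_part sr r0) dvdn_mull.
case: (odd r); last first.
  have q2 : ~~ (q %| 2)%N by rewrite dvdn_prime2 //; apply: contraTneq oq => ->.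
  rewrite nonresM // nonres2 // -/(chi8 q) nr' rec /=.
  by case: (\big[_/_]_(_ <- _) _); case: (chi8 q); case: (chi4 q); case: (chi4 r').
rewrite mul1n nr' rec /=.
by case: (\big[_/_]_(_ <- _) _); case: (chi4 q); case: (chi4 r').
Qed.

(** u w = - 1 modulo the odd part of [r] makes - u w a square modulo each [p], which the last clause
    expresses by the symbols of - 1 and 2. The residue modulo 8 stays free. *)
Lemma target_class (u w8 : nat) : u \in [:: 1; 2]%N -> odd w8 -> exists w, [/\ coprime w N,
  (w = w8 %[mod 8])%N & {in ps, forall p, nonres p w = chi4 p (+) ((u == 2)%N && chi8 p)}].
Proof.
move=> hu ow; have or' := odd_part_odd.
have c8 : coprime r' 8 by rewrite -[8%N]/(2 ^ 3)%N coprime_pexpr // coprimen2.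
have [x ex] : exists x, (u * x + 1 = r')%N.
  move: hu; rewrite !inE => /orP[] /eqP ->; [exists r'.-1 | exists r'./2]; move: or'; clear; lia.
pose w := chinese r' 8 x w8; have w1 : (w = x %[mod r'])%N by rewrite chinese_modl.
have w2 : (w = w8 %[mod 8])%N by rewrite chinese_modr.
have dw : (r' %| u * w + 1)%N.
  by rewrite /dvdn -modnDml -modnMmr w1 modnMmr modnDml ex modnn.
have co : coprime w r'.
  rewrite coprime_sym; apply: coprime_dvdl dw _.
  by have := coprimeSn (u * w)%N; rewrite addn1 coprimeMr => /andP[].
have o_w : odd w by have := odd_mod w (erefl : odd 8 = false); rewrite w2 odd_mod // ow.
exists w; split=> // [|p pin].
  by rewrite coprimeN o_w (sqfree_odd_part sr r0) -/ps -/r' coprimeMr co; case: ifP; rewrite ?coprimen1 ?coprimen2 ?o_w.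
have [pp po _ dp] := odd_primesP pin.
have pw : ~~ (p %| w)%N by rewrite -prime_coprime // coprime_sym; apply: coprime_dvdr co.
have p1 := prime_gt1 pp.
have : nonres p (u * w)%N = chi4 p.
  rewrite -[RHS]nonresN1 //; apply: nonres_mod => //; apply/eqP.
  rewrite -(eqn_modDr 1) addn1 addn1 prednK ?prime_gt0 // modnn -addn1 -/(dvdn _ _).
  exact: dvdn_trans dp dw.
move: hu; rewrite !inE => /orP[] /eqP ->; first by rewrite mul1n addbF.
rewrite nonresM // ?nonres2 // -/(chi8 p) /=; last first.
  by rewrite dvdn_prime2 //; apply: contraTneq po => ->.
by case: chi8 => /= <-; rewrite ?addbT ?addbF ?negbK.
Qed.

(** The residue of [w] modulo 8 is used to adjust [split_char]. For r = 3 modulo 4 it has no effect,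
    and only u = 2 can help, which requires [chi8 r]: this works for 3 and fails for 7 modulo 8. *)
Lemma split_target : exists u w, [/\ u \in [:: 1; 2]%N, (u == 2)%N ==> odd r, coprime w N,
  ~~ split_char w & {in ps, forall p, nonres p w = chi4 p (+) ((u == 2)%N && chi8 p)}].
Proof.
have ev u w : {in ps, forall p, nonres p w = chi4 p (+) ((u == 2)%N && chi8 p)} ->
    split_char w = (chi4 r' (+) ((u == 2)%N && chi8 r')) (+)
      ((~~ odd r && chi8 w) (+) (~~ chi4 r' && chi4 w)).
  move=> h; rewrite /split_char; congr (_ (+) _); rewrite big_seq (eq_bigr _ h) -big_seq big_split /=.
  have op : {in ps, forall p, odd p} by move=> p /odd_primesP[].
  rewrite /r' !chi_prod //; [|exact: chi8M|exact: chi4M]; congr addb.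
  by rewrite (big_morph (andb (u == 2)%N) (andb_addr _) (andbF _)).
have w8E w w8 : (w = w8 %[mod 8])%N -> (chi8 w = chi8 w8) /\ (chi4 w = chi4 w8).
  rewrite /chi8 /chi4 => e; split; first by rewrite e.
  by have -> : (w %% 4 = w8 %% 4)%N by move: e; clear; lia.
have er : odd r -> r' = r by move=> h; have := sqfree_odd_part sr r0; rewrite h mul1n.
case: (boolP (odd r)) => o_r.
  have c4 : chi4 r' = (r %% 4 == 3)%N by rewrite er.
  have c8 : chi8 r' = (r %% 8 \in [:: 3; 5])%N by rewrite er.
  case h3 : (r %% 4 == 3)%N.
    have h8 : (r %% 8 = 3)%N by move: h3 r7; clear; lia.
    have [w [h1 h2 h4]] := @target_class 2 1 isT isT; exists 2%N, w; split=> //.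
    by rewrite (ev _ _ h4) c4 c8 h8 h3 o_r.
  have [w [h1 h2 h4]] := @target_class 1 1 isT isT; exists 1%N, w; split=> //.
  by rewrite (ev _ _ h4) c4 h3 o_r (proj2 (w8E _ _ h2)).
pose w8 := if chi4 r' then 5%N else 1%N; have ow : odd w8 by rewrite /w8; case: ifP.
have [w [h1 h2 h4]] := @target_class 1 w8 isT ow; exists 1%N, w; split=> //.
by rewrite (ev _ _ h4) o_r (proj2 (w8E _ _ h2)) (proj1 (w8E _ _ h2)) /w8; case: (chi4 r').
Qed.

(** Dirichlet's argument with A = u A', where A' is a product of primes instead of one prime: - A is
    a square modulo [r] by the class of [w], and - r is a square modulo each prime of A' by
    reciprocity. *)
Theorem three_squares : exists s t u : int, r%:Z = s ^+ 2 + t ^+ 2 + u ^+ 2.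
Proof.
have [u [w [hu uo cw lw hw]]] := split_target.
have N0 : (0 < N)%N by rewrite muln_gt0.
have bc (i : 'I_(size ps)) : additive_char N (nonres (nth 2%N ps i)).
  have /odd_primesP[pp po dp _] := mem_nth 2%N (ltn_ord i).
  by apply: nonres_char => //; apply: dvdn_mull.
have [s [us sp sN sl hA]] := prime_combination N0 bc split_charP cw lw.
set A' := (\prod_(q <- s) q)%N in hA.
have cA : coprime A' N.
  rewrite /A' big_seq; apply: (big_ind (fun x => coprime x N)) => [|x y hx hy|x /sN //].
    exact: coprime1n.
  by rewrite coprimeMl hx.
have [oA cAr] : odd A' /\ coprime A' r by apply/andP; rewrite -coprimeN.
have hA' p : p \in ps -> nonres p A' = nonres p w.
  by move=> pin; have ip := pin; rewrite -index_mem in ip; have := hA (Ordinal ip); rewrite /= nth_index.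
have A0 : (0 < u * A')%N.
  by rewrite muln_gt0; apply/andP; split; [move: hu; rewrite !inE => /orP[] /eqP -> | move: oA; case: (A')].
have coA : coprime (u * A') r.
  rewrite coprimeMl cAr andbT; move: hu uo; rewrite !inE => /orP[] /eqP -> /= h; by rewrite ?coprime1n ?coprime2n.
have [l hl] : exists l, (r %| l ^ 2 + u * A')%N.
  rewrite {1}(sqfree_primes sr r0); apply: prod_root; first exact: primes_uniq.
    by move=> p; rewrite mem_primes => /andP[].
  move=> p pin; have [pp dp] : prime p /\ (p %| r)%N.
    by move: pin; rewrite mem_primes => /and3P[].
  case: (even_prime pp) => [->|po].
    by exists (u * A')%N; rewrite dvdn2 oddD oddX /= addbb.
  have pin' : p \in ps by rewrite mem_filter po.
  apply: nonres_root => //.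
  have pA x : coprime x r -> ~~ (p %| x)%N.
    by move=> h; rewrite -prime_coprime // coprime_sym; apply: coprime_dvdr h.
  have p1 := prime_gt1 pp; have pp1 : ~~ (p %| p.-1)%N by apply/negP => /dvdn_leq; move: p1; clear; lia.
  have puA := pA _ coA; have pA' := pA _ cAr; rewrite nonresM // nonresN1 // -/(chi4 p).
  suff -> : nonres p (u * A')%N = chi4 p by rewrite addbb.
  move: hu (hw p pin'); rewrite !inE => /orP[] /eqP -> /=; rewrite -hA' // => e.
    by rewrite mul1n e addbF.
  have p2 : ~~ (p %| 2)%N by rewrite dvdn_prime2 //; apply: contraTneq po => ->.
  by rewrite nonresM // nonres2 // -/(chi8 p) e; case: chi8; case: chi4.
have [v hv] : exists v, (A' %| v ^ 2 + r)%N.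
  apply: prod_root => // q qs; apply: split_prime_root; [exact: sp|exact: sN|exact: sl].
have [B hB] : exists B, (u * A' %| B ^ 2 + r)%N.
  move: hu uo; rewrite !inE => /orP[] /eqP -> /= o_r; first by exists v; rewrite mul1n.
  (* Modulo 2 A' the root must be odd; adding the odd A' changes its parity. *)
  have [z [oz hz]] : exists z, odd z /\ (A' %| z ^ 2 + r)%N.
    case ov: (odd v); first by exists v.
    exists (v + A')%N; split; first by rewrite oddD ov oA.
    have -> : ((v + A') ^ 2 + r = v ^ 2 + r + A' * (2 * v + A'))%N.
      by rewrite !expnS !expn0; clear; nia.
    by rewrite dvdn_add // dvdn_mulr.
  exists z; rewrite Gauss_dvd ?coprime2n // hz andbT dvdn2 oddD oddX oz o_r.
  by [].
case/dvdnP: hB => c hc.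
apply: (@three_squares_criterion r%:Z (u * A')%N%:Z B%:Z c%:Z l%:Z) => //.
  by rewrite -PoszM mulnC -hc PoszD -mulnn PoszM expr2.
Qed.
End ThreeSquares2.

(** * Two squares and congruences *)

Section Elementary.
Implicit Types (a b c n m k p q r s v : nat).

Lemma root_exists k n : 0 < k -> exists x, x ^ k <= n < x.+1 ^ k.
Proof.
move=> k0; have ex : exists x, x ^ k <= n by exists 0; rewrite exp0n.
have bd x : x ^ k <= n -> x <= n.
  case: x => [//|x] h; apply: leq_trans h; rewrite -{1}[x.+1]expn1 leq_pexp2l //.
case: (ex_maxnP ex bd) => x hx hm; exists x; rewrite hx ltnNge; apply/negP => /hm.
by rewrite ltnn.
Qed.

Lemma sqfree_decomp n : 0 < n -> exists c r, [/\ n = c ^ 2 * r, 0 < c & sqfree r].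
Proof.
have [m] := ubnP n; elim: m n => // m IH n; rewrite ltnS => nm n0.
case: (boolP (has (fun l => prime l && (l ^ 2 %| n)) (iota 0 n.+1))) => [/hasP[l _ /andP[pl]]|no].
  case/dvdnP=> k ek; have l1 := prime_gt1 pl.
  have k0 : 0 < k by move: n0; rewrite ek muln_gt0 => /andP[].
  have kn : k < n by rewrite ek -[X in X < _]muln1 ltn_pmul2l // -(exp1n 2) ltn_exp2r.
  have [c [r [er c0 sr]]] := IH k (leq_trans kn nm) k0.
  exists (l * c), r; split=> //; first by rewrite ek er expnMn mulnC mulnA.
  by rewrite muln_gt0 c0 prime_gt0.
exists 1, n; split=> //; first by rewrite mul1n.
move=> l pl; apply: contra no => h; apply/hasP; exists l; last by rewrite pl h.
rewrite mem_iota add0n ltnS; apply: dvdn_leq => //; apply: dvdn_trans h; exact: dvdn_exp.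
Qed.

(** If [q] does not divide [y], the quotient x / y is a root of - 1. Otherwise [q] divides [x] too
    and, [v] being squarefree, also [c]; all three are divided by [q]. *)
Lemma sqfree_two_squares_root v c x y : sqfree v -> 0 < c -> v * c ^ 2 = x ^ 2 + y ^ 2 ->
  forall q, prime q -> q %| v -> exists l, q %| l ^ 2 + 1.
Proof.
move=> sv c0 e q pq qv; have v0 := sqfree_gt0 sv.
have [m] := ubnP c; elim: m c x y c0 e => // m IH c x y c0 e; rewrite ltnS => cm.
have qxy : q %| x ^ 2 + y ^ 2 by rewrite -e dvdn_mulr.
case: (boolP (q %| y)) => qy; last first.
  have co : coprime y q by rewrite coprime_sym prime_coprime.
  have y0 : 0 < y by case: (y) qy => //; rewrite dvdn0.
  case: (egcdnP q y0) => z w ez _; rewrite (eqnP co) in ez.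
  exists (z * x); rewrite -(Gauss_dvdr _ (_ : coprime q (y ^ 2))); last first.
    by rewrite coprime_sym coprimeXl.
  have -> : y ^ 2 * ((z * x) ^ 2 + 1) = z * y * (z * y) * x ^ 2 + y ^ 2.
    by rewrite !expnS !expn0; clear; nia.
  rewrite ez; have -> : (w * q + 1) * (w * q + 1) * x ^ 2 + y ^ 2 =
      q * (w * (w * q + 2) * x ^ 2) + (x ^ 2 + y ^ 2) by clear; nia.
  by rewrite dvdn_add // dvdn_mulr.
have qx : q %| x.
  have : q %| x ^ 2 by rewrite -(dvdn_addl _ (n := y ^ 2)) // Euclid_dvdX // qy.
  by rewrite Euclid_dvdX // => /andP[].
have q0 := prime_gt0 pq; have q1 := prime_gt1 pq.
case/dvdnP: qx e => x' ->; case/dvdnP: qy => y' -> e; case/dvdnP: (qv) => v' ev.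
have nv' : ~~ (q %| v').
  by apply: contra (sv q pq) => h; rewrite ev -mulnn dvdn_pmul2r.
have e2 : v' * c ^ 2 = q * (x' ^ 2 + y' ^ 2).
  apply/eqP; rewrite -(eqn_pmul2r q0) mulnAC -ev e !expnMn -mulnDl -mulnn; apply/eqP; ring.
have : q %| v' * c ^ 2 by rewrite e2 dvdn_mulr.
rewrite Euclid_dvdM // (negPf nv') Euclid_dvdX //= andbT => /dvdnP[c' ec].
have c'0 : 0 < c' by move: c0; rewrite ec muln_gt0 => /andP[].
apply: (IH c' x' y' c'0).
  apply/eqP; rewrite -(eqn_pmul2r (_ : 0 < q ^ 2)) ?expn_gt0 ?q0 //; apply/eqP.
  by rewrite -mulnA -expnMn -ec e !expnMn; ring.
by apply: leq_trans cm; rewrite ec -[X in X < _]muln1 ltn_pmul2l.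
Qed.

(** With v = c^2 r, the product of the two sums of two squares shows that r (c d)^2 is one as well.
    So - 1 is a square modulo [r], which gives a binary form of determinant 1 that takes the value
    [r]. *)
Lemma two_squares v d x y a b : 0 < d -> d = a ^ 2 + b ^ 2 -> d * v = x ^ 2 + y ^ 2 ->
  exists z w, v = z ^ 2 + w ^ 2.
Proof.
move=> d0 ed e; case: (posnP v) => [->|v0]; first by exists 0, 0.
have [c [r [ev c0 sr]]] := sqfree_decomp v0.
have [X [Y eXY]] : exists X Y, r * (c * d) ^ 2 = X ^ 2 + Y ^ 2.
  have e1 : r * (c * d) ^ 2 = d * v * d by rewrite ev !expnMn; ring.
  rewrite e1 e {1}ed; case: (leqP (x * b) (y * a)) => [|/ltnW] le.
    exists (x * a + y * b), (y * a - x * b).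
    have E : (y * a) ^ 2 + (x * b) ^ 2 = (y * a - x * b) ^ 2 + 2 * (x * b) * (y * a).
      by move: (y * a - x * b) (subnK le) => k <-; ring.
    by transitivity ((x * a) ^ 2 + (y * b) ^ 2 + ((y * a) ^ 2 + (x * b) ^ 2)); [ring | rewrite E; ring].
  exists (x * a + y * b), (x * b - y * a).
  have E : (y * a) ^ 2 + (x * b) ^ 2 = (x * b - y * a) ^ 2 + 2 * (x * b) * (y * a).
    by move: (x * b - y * a) (subnK le) => k <-; ring.
  by transitivity ((x * a) ^ 2 + (y * b) ^ 2 + ((y * a) ^ 2 + (x * b) ^ 2)); [ring | rewrite E; ring].
have r0 := sqfree_gt0 sr.
have [l hl] : exists l, r %| l ^ 2 + 1.
  rewrite {1}(sqfree_primes sr r0); apply: prod_root; first exact: primes_uniq.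
    by move=> q; rewrite mem_primes => /andP[].
  move=> q; rewrite mem_primes => /and3P[pq _ dq].
  by apply: (sqfree_two_squares_root sr _ eXY) dq => //; rewrite muln_gt0 c0.
case/dvdnP: hl => k ek.
have [] := @binary_unimodular r%:Z l%:Z k%:Z _ _ 1%R 0%R.
- by rewrite ltz_nat.
- by have := congr1 Posz ek; rewrite PoszD PoszM -mulnn PoszM; clear; lia.
move=> s [t] h; exists (c * `|s|%N), (c * `|t|%N).
have {}h : r = `|s|%N ^ 2 + `|t|%N ^ 2.
  by apply/eqP; rewrite -eqz_nat PoszD -!mulnn !PoszM !abszE -!expr2 !real_normK ?num_real //; apply/eqP; rewrite -h; ring.
by rewrite ev {1}h !expnMn mulnDr.
Qed.

(** The list omits 0, 4, 7, 12, 15. If r were 7 modulo 8, the exponent of 2 in [e] would be even: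
    exponent 0 gives 7 or 15 modulo 16, exponent 2 gives 4 or 12, and larger ones give 0. *)
Lemma sqr_factor_mod8 j e c r : 16 ^ j * e = c ^ 2 * r -> 0 < c -> 0 < e ->
  (e %% 16 \in [:: 1; 2; 3; 5; 6; 8; 9; 10; 11; 13; 14]) -> r %% 8 != 7.
Proof.
move=> h c0 e0 he; apply/negP => /eqP r7.
have or : odd r by move: r7; clear; lia.
have r0 : 0 < r by case: r or h r7.
have [c' oc ec] := pfactor_coprime (isT : prime 2) c0; rewrite coprime2n in oc.
have := congr1 (logn 2) h; rewrite -[16]/(2 ^ 4) -expnM !lognM ?expn_gt0 ?c0 // pfactorK //.
have -> : logn 2 r = 0 by rewrite lognE dvdn2 or andbF.
move: ec; set i := logn 2 c => ec; rewrite addn0 => hl.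
have oe : ~~ odd (logn 2 e) by move: hl; clear; lia.
have [e' oe' ee'] := pfactor_coprime (isT : prime 2) e0; rewrite coprime2n in oe'.
move: ee' hl oe; set z := logn 2 e => ee' hl oe.
have z0 : z = 0.
  case: z ee' oe {hl} => [//|[//|[|[//|z]]]] ee' _; move: he; rewrite ee'.
    have -> : (e' * 2 ^ 2) %% 16 = 4 * (e' %% 4) by clear; lia.
    have : e' %% 4 = 1 \/ e' %% 4 = 3 by move: oe'; clear; lia.
    by case=> ->.
  have -> : e' * 2 ^ z.+4 = e' * 2 ^ z * 16 by rewrite !expnS; clear; lia.
  by rewrite modnMl.
have {}ee' : e = e' by rewrite ee' z0 muln1.
have E : e = c' ^ 2 * r.
  apply/eqP; rewrite -(eqn_pmul2l (_ : 0 < 16 ^ j)) ?expn_gt0 //; apply/eqP; rewrite h {1}ec expnMn.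
  have -> : 16 ^ j = (2 ^ i) ^ 2.
    by rewrite -[16]/(2 ^ 4) -!expnM; congr (2 ^ _); move: hl; rewrite z0; clear; lia.
  ring.
have : e %% 8 = 7.
  rewrite E -modnMm r7; have -> : c' ^ 2 %% 8 = 1.
    have : c' %% 8 = 1 \/ c' %% 8 = 3 \/ c' %% 8 = 5 \/ c' %% 8 = 7 by move: oc; clear; lia.
    by rewrite -mulnn -modnMm => -[->|[->|[->|->]]].
  by [].
move: he; rewrite -(modn_dvdm e (isT : 8 %| 16)) !inE.
by do !(case/orP => [/eqP -> //|]); move=> /eqP ->.
Qed.
End Elementary.

(** * Roots modulo primes and prime powers *)

Section Roots.
Implicit Types (a b c n m k p q r s v : nat).

Lemma linear_mod p y m : 0 < p -> 0 < y -> coprime y p -> exists t, p %| m + y * t.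
Proof.
move=> p0 y0 co; case: (egcdnP p y0) => z w ez _; rewrite (eqnP co) in ez.
exists (z * m * p.-1); have -> : y * (z * m * p.-1) = z * y * m * p.-1 by ring.
rewrite ez -{2}(prednK p0) -[X in X + _]mul1n; move: (p.-1) (prednK p0) => t et.
have -> : 1 * m + (w * t.+1 + 1) * m * t = t.+1 * (w * m * t + m) by ring.
by rewrite et dvdn_mulr.
Qed.

Lemma root_quotient q x y r : 0 < q -> 0 < y -> coprime y q -> q %| x ^ 2 + r * y ^ 2 ->
  exists l, q %| x + y * l /\ q %| l ^ 2 + r.
Proof.
move=> q0 y0 co h; have [z hz] := linear_mod x q0 y0 co; exists z; split=> //.
have coy : coprime q (y ^ 2) by rewrite coprimeXr // coprime_sym.
rewrite -(Gauss_dvdr _ coy).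
have -> : y ^ 2 * (z ^ 2 + r) = y ^ 2 * z ^ 2 + r * y ^ 2 by ring.
have : q %| y ^ 2 * z ^ 2 + r * y ^ 2 + (x + y * z) * (2 * x).
  have -> : y ^ 2 * z ^ 2 + r * y ^ 2 + (x + y * z) * (2 * x) =
      (x ^ 2 + r * y ^ 2) + (x + y * z) * (x + y * z) by ring.
  by rewrite dvdn_add // dvdn_mulr.
by rewrite dvdn_addl // dvdn_mulr.
Qed.

Lemma hensel_sqr p r x0 K : prime p -> odd p -> ~~ (p %| r) -> p %| x0 ^ 2 + r ->
  exists x, p ^ K %| x ^ 2 + r.
Proof.
move=> pp po pr h0; suff : exists x, p ^ K.+1 %| x ^ 2 + r.
  by case=> x h; exists x; apply: dvdn_trans h; rewrite dvdn_exp2l.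
elim: K => [|K [x hx]]; first by exists x0.
have px : ~~ (p %| 2 * x).
  rewrite Euclid_dvdM // negb_or; apply/andP; split.
    by rewrite dvdn_prime2 //; apply: contraTneq po => ->.
  apply: contra pr => px; rewrite -(dvdn_addr _ (m := x ^ 2)); last by rewrite Euclid_dvdX ?px.
  by apply: dvdn_trans hx; rewrite expnS dvdn_mulr.
case/dvdnP: (hx) => m em.
have x20 : 0 < 2 * x by case: (2 * x) px => //; rewrite dvdn0.
have cx : coprime (2 * x) p by rewrite coprime_sym prime_coprime.
have [t /dvdnP[u hu]] := linear_mod m (prime_gt0 pp) x20 cx.
exists (x + p ^ K.+1 * t).
have -> : (x + p ^ K.+1 * t) ^ 2 + r = (x ^ 2 + r) + p ^ K.+1 * (2 * x * t) + (p ^ K.+1 * p ^ K.+1) * t ^ 2 by ring.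
rewrite em; have -> : m * p ^ K.+1 + p ^ K.+1 * (2 * x * t) = p ^ K.+1 * (m + 2 * x * t) by ring.
have -> : m + 2 * x * t = u * p by rewrite -hu.
have -> : p ^ K.+1 * (u * p) = p ^ K.+2 * u by rewrite [p ^ K.+2]expnSr; ring.
apply: dvdn_add; first exact: dvdn_mulr.
by apply: dvdn_mulr; rewrite -expnD dvdn_exp2l //; clear; lia.
Qed.
End Roots.

(** * Cyclic groups of units *)

Section Cyclic.
Implicit Types (a b d e k p : nat).

(** A cyclic group has one subgroup of order 2. If e > 2, then - 1 and the unit that is 1 modulo p^k
    and - 1 modulo [e] are two distinct elements of order 2. *)
Lemma cyclic_units_prime_pow d p k e : cyclic (units_Zp d) -> prime p -> odd p -> 0 < k ->
  coprime (p ^ k) e -> d = p ^ k * e -> 0 < e -> e <= 2.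
Proof.
move=> cy pp po k0 co ed e0; rewrite leqNgt; apply/negP => e2.
have P2 : 2 < p ^ k.
  have : 2 < p by have := prime_gt1 pp; move: po; clear; lia.
  by move=> h; apply: leq_trans h _; rewrite -{1}[p]expn1 leq_pexp2l // prime_gt0.
have d1 : 1 < d by rewrite ed; move: (p ^ k) P2 e2; clear; nia.
have eqZ n m : (n = m %[mod d] -> n%:R = m%:R :> 'Z_d)%R by move=> h; rewrite -(Zp_nat_mod d1 n) h Zp_nat_mod.
have Zeq n m : (n%:R = m%:R :> 'Z_d)%R -> n = m %[mod d].
  by move=> /(congr1 val) /=; rewrite !val_Zp_nat.
have sqr1 m : 0 < m -> m.-1 ^ 2 = 1 %[mod m].
  case: m => // m _; rewrite /= -(modnMDl 1); have -> : m ^ 2 = m.-1 * m + m by case: m => // m; rewrite -mulnn; ring.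
  case: m => [|m]; first by rewrite !modn1.
  by have -> : 1 * m.+2 + (m.+1.-1 * m.+1 + m.+1) = m.+1 * m.+2 + 1; [rewrite /=; ring | rewrite modnMDl].
pose x := d.-1; pose y := chinese (p ^ k) e 1 e.-1.
have y1 : y = 1 %[mod p ^ k] by rewrite chinese_modl.
have y2 : y = e.-1 %[mod e] by rewrite chinese_modr.
have sy : y ^ 2 = 1 %[mod d].
  apply/eqP; rewrite ed chinese_remainder //; apply/andP; split; apply/eqP.
    by rewrite -modnXm y1 modnXm exp1n.
  by rewrite -modnXm y2 modnXm sqr1.
have mE n m : n = m %[mod d] -> n = m %[mod p ^ k] /\ n = m %[mod e].
  by move=> /eqP; rewrite ed chinese_remainder // => /andP[/eqP ? /eqP ?].
have un z : z ^ 2 = 1 %[mod d] -> (z%:R : 'Z_d)%R \is a GRing.unit.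
  move=> h; apply/unitrP; exists (z%:R)%R; rewrite -natrM mulnn.
  by split; exact: eqZ h.
have sx : x ^ 2 = 1 %[mod d] by apply: sqr1; apply: ltnW.
pose ux : {unit 'Z_d} := FinRing.Unit (un _ sx); pose uy : {unit 'Z_d} := FinRing.Unit (un _ sy).
have ord2 z (hz : z ^ 2 = 1 %[mod d]) : z <> 1 %[mod d] -> #[FinRing.Unit (un _ hz)]%g = 2.
  move=> nz; apply: nt_prime_order => //.
    by apply: val_inj; rewrite /= -natrM mulnn; exact: eqZ hz.
  by apply/eqP => /(congr1 val) /= /(Zeq z 1).
have nx : x <> 1 %[mod d].
  move/mE => [_]; rewrite /x ed => h.
  have : (p ^ k * e).-1 = e.-1 + (p ^ k).-1 * e by move: (p ^ k) P2 e2; clear; case=> // u; nia.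
  by move=> E; move: h; rewrite E addnC modnMDl !modn_small //; move: e2; clear; lia.
have ny : y <> 1 %[mod d].
  by move/mE => [_]; rewrite y2 !modn_small //; move: e2; clear; lia.
have nxy : y <> x %[mod d].
  move/mE => [h _]; move: h; rewrite y1 /x ed.
  have -> : (p ^ k * e).-1 = e.-1 * p ^ k + (p ^ k).-1 by move: (p ^ k) P2 e2; clear; case=> // u; case: e => // e; nia.
  by rewrite modnMDl !modn_small //; move: P2; clear; lia.
have ex : #[ux]%g = 2 by apply: ord2.
have ey : #[uy]%g = 2 by apply: ord2.
have : <[ux]>%G :==: <[uy]>%G.
  rewrite (eq_subG_cyclic cy) ?subsetT // -!orderE ex ey //.
move/eqP => E; have : uy \in <[ux]>%g by rewrite E cycle_id.
case/cyclePmin => i; rewrite ex; case: i => [_|[_|//]] /(congr1 val) /=.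
  by move=> /(Zeq y 1).
by move=> /(Zeq y x).
Qed.
End Cyclic.

(** * From three squares to the four coordinates *)

Section Assemble.
Local Open Scope ring_scope.

Lemma assemble (a b n s : nat) (t Z W : int) : (0 < a)%N -> (0 < b)%N -> coprime a b ->
  ((a ^ 2 + b ^ 2) * n)%N%:Z = s%:Z ^+ 2 + t ^+ 2 + Z ^+ 2 + W ^+ 2 ->
  ((a ^ 2 + b ^ 2)%N%:Z %| a%:Z * s%:Z + b%:Z * t)%Z ->
  a%:Z * `|t| <= b%:Z * s%:Z -> b%:Z * `|t| <= a%:Z * s%:Z ->
  exists x y z w : nat, (x ^ 2 + y ^ 2 + z ^ 2 + w ^ 2 = n /\ a * x + b * y = s)%N.
Proof.
move=> a0 b0 co e dv le1 le2; set d := (a ^ 2 + b ^ 2)%N in e dv *.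
have d0 : (0 < d)%N by rewrite addn_gt0 expn_gt0 a0.
have ed : d%:Z = a%:Z ^+ 2 + b%:Z ^+ 2 by rewrite /d PoszD -!mulnn !PoszM.
have dv2 : (d%:Z %| b%:Z * s%:Z - a%:Z * t)%Z.
  have : (d%:Z %| a%:Z * (b%:Z * s%:Z - a%:Z * t))%Z.
    have -> : a%:Z * (b%:Z * s%:Z - a%:Z * t) = b%:Z * (a%:Z * s%:Z + b%:Z * t) - d%:Z * t.
      by rewrite ed; ring.
    by apply: rpredB; [exact: dvdz_mull | exact: dvdz_mulr (dvdzz _)].
  rewrite Gauss_dvdzr // coprimezE /= coprime_sym /coprime /d -{1}mulnn gcdnMDl.
  by rewrite -/(coprime _ _) coprimeXr.
case/dvdzP: dv => X eX; case/dvdzP: dv2 => Y eY.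
have dp : 0 < d%:Z by rewrite ltz_nat.
have X0 : 0 <= X.
  rewrite -(pmulr_lge0 _ dp) -eX; have : - (b%:Z * `|t|) <= b%:Z * t.
    by rewrite -mulrN ler_wpM2l // lerNl -normrN ler_norm.
  by move: le2; clear; lia.
have Y0 : 0 <= Y.
  rewrite -(pmulr_lge0 _ dp) -eY; have : a%:Z * t <= a%:Z * `|t| by rewrite ler_wpM2l // ler_norm.
  by move: le1; clear; lia.
have exy : d%:Z * (X ^+ 2 + Y ^+ 2) = s%:Z ^+ 2 + t ^+ 2.
  apply: (mulfI (lt0r_neq0 dp)).
  have -> : d%:Z * (d%:Z * (X ^+ 2 + Y ^+ 2)) = (X * d%:Z) ^+ 2 + (Y * d%:Z) ^+ 2 by ring.
  by rewrite -eX -eY ed; ring.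
have es : a%:Z * X + b%:Z * Y = s%:Z.
  apply: (mulfI (lt0r_neq0 dp)).
  have -> : d%:Z * (a%:Z * X + b%:Z * Y) = a%:Z * (X * d%:Z) + b%:Z * (Y * d%:Z) by ring.
  by rewrite -eX -eY ed; ring.
pose V := n%:Z - X ^+ 2 - Y ^+ 2.
have eV : d%:Z * V = Z ^+ 2 + W ^+ 2.
  have -> : d%:Z * V = (d * n)%N%:Z - d%:Z * (X ^+ 2 + Y ^+ 2) by rewrite /V PoszM; ring.
  by rewrite exy e; ring.
have V0 : 0 <= V by rewrite -(pmulr_rge0 _ dp) eV addr_ge0 ?sqr_ge0.
have eV' : (d * `|V| = `|Z| ^ 2 + `|W| ^ 2)%N.
  by apply/eqP; rewrite -eqz_nat PoszD -!mulnn !PoszM !abszE -!expr2 !real_normK ?num_real // ger0_norm // eV.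
have [z [w ezw]] := two_squares d0 (erefl d) eV'.
exists `|X|%N, `|Y|%N, z, w; split; apply/eqP; rewrite -eqz_nat.
  rewrite -addnA -ezw !PoszD -!mulnn !PoszM !abszE -!expr2 !real_normK ?num_real // ger0_norm //.
  by apply/eqP; rewrite /V; ring.
by rewrite PoszD !PoszM !abszE !ger0_norm // es.
Qed.
End Assemble.

(** * Prime counting *)

Section Chebyshev.

Definition primes_upto (X : nat) := [seq q <- iota 0 X.+1 | prime q].

Lemma logn_central_bin p k : prime p -> 0 < k -> logn p 'C(k.*2, k) <= trunc_log p k.*2.
Proof.
move=> pp k0; have p1 := prime_gt1 pp; have p0 := prime_gt0 pp.
have k20 : 0 < k.*2 by rewrite double_gt0.
have := congr1 (logn p) (bin_fact (leq_addr k k)); rewrite addnn -{2 5}addnn addnK.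
rewrite !lognM ?muln_gt0 ?fact_gt0 ?bin_gt0 ?leq_addr -?addnn ?leq_addr // addnn !logn_fact // => e.
have ek : \sum_(1 <= i < k.+1) k %/ p ^ i = \sum_(1 <= i < k.*2.+1) k %/ p ^ i.
  have le : k.+1 <= k.*2.+1 by rewrite ltnS -addnn leq_addr.
  rewrite [RHS](big_cat_nat (n := k.+1)) //= [X in _ = _ + X]big_nat_cond [X in _ = _ + X]big1 ?addn0 //.
  move=> i /andP[/andP[ki _] _]; rewrite divn_small //.
  by apply: leq_trans ki _; rewrite ltnW // ltn_expl.
have {e ek} : logn p 'C(k.*2, k) = \sum_(1 <= i < k.*2.+1) (k.*2 %/ p ^ i - 2 * (k %/ p ^ i)).
  rewrite sumnB => [|i _]; last first.
    by rewrite leq_divRL ?expn_gt0 ?p0 // -mulnA -mul2n leq_mul2l leq_divM.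
  by rewrite -e ek -big_distrr /= mul2n addnn addnK.
move=> ->; apply: (@leq_trans (\sum_(1 <= i < k.*2.+1) (i <= trunc_log p k.*2))).
  rewrite big_nat_cond [leqRHS]big_nat_cond; apply: leq_sum => i _.
  case: (leqP i (trunc_log p k.*2)) => h; last first.
    by rewrite divn_small //; apply: leq_trans (trunc_log_ltn _ p1) _; rewrite leq_exp2l.
  rewrite leq_subLR -ltnS ltn_divLR ?expn_gt0 ?p0 //.
  have := ltn_ceil k (_ : 0 < p ^ i); rewrite expn_gt0 p0 => /(_ isT); set u := k %/ _; set P := p ^ i.
  by rewrite -mul2n; clear; nia.
have tl : trunc_log p k.*2 < k.*2.+1.
  by rewrite ltnS ltnW // (leq_trans (ltn_expl _ p1)) // trunc_logP.
rewrite (big_cat_nat (n := (trunc_log p k.*2).+1)) //= [X in _ + X]big_nat_cond [X in _ + X]big1.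
  rewrite addn0 big_nat_cond (eq_bigr (fun _ => 1)) => [|i /andP[/andP[_]]]; last by rewrite ltnS => ->.
  by rewrite -big_nat_cond sum_nat_const_nat muln1 subn1.
by move=> i /andP[/andP[h _] _]; rewrite leqNgt h.
Qed.

(** 2^k is at most the central binomial coefficient, whose p-part is at most 2 k, hence at most X,
    for each of its primes. *)
Lemma chebyshev X : X./2 <= (trunc_log 2 X).+1 * size (primes_upto X).
Proof.
set k := X./2; case: (posnP k) => [->//|k0].
have kX : k.*2 <= X by rewrite -[leqRHS](odd_double_half X) leq_addl.
have X0 : 0 < X by apply: leq_trans kX; rewrite double_gt0.
rewrite -(leq_exp2l _ _ (isT : 1 < 2)) expnM.
apply: (@leq_trans 'C(k.*2, k)).
  have : forall j, 2 ^ j <= 'C(j.*2, j).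
    elim=> [//|j IH]; rewrite expnS doubleS binS binS; apply: (@leq_trans (2 * 'C(j.*2, j))).
      by rewrite leq_mul2l IH.
    rewrite mul2n -addnn; apply: leq_add; first exact: leq_addl.
    exact: leq_bin2l.
  exact.
have C0 : 0 < 'C(k.*2, k) by rewrite bin_gt0 -addnn leq_addr.
rewrite (prod_prime_decomp C0) prime_decompE big_map /=.
apply: (@leq_trans (\prod_(p <- primes 'C(k.*2, k)) k.*2)).
  rewrite big_seq [leqRHS]big_seq; apply: leq_prod => p; rewrite mem_primes => /and3P[pp _ _].
  apply: (@leq_trans (p ^ trunc_log p k.*2)); first by rewrite leq_pexp2l ?prime_gt0 ?logn_central_bin.
  by rewrite trunc_logP ?prime_gt1 // double_gt0.
rewrite big_const_seq count_predT iter_muln_1.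
apply: (@leq_trans (X ^ size (primes 'C(k.*2, k)))).
  by case: (size _) => // n; rewrite leq_exp2r.
apply: (@leq_trans (X ^ size (primes_upto X))).
  rewrite leq_pexp2l //; apply: uniq_leq_size; first exact: primes_uniq.
  move=> p pin; rewrite mem_filter mem_iota /= add0n ltnS.
  have [pp cp] : prime p /\ p %| 'C(k.*2, k) by move: pin; rewrite mem_primes => /and3P[].
  rewrite pp /=; apply: leq_trans kX.
  have : 0 < trunc_log p k.*2 by apply: leq_trans (logn_central_bin pp k0); rewrite logn_gt0.
  by rewrite trunc_log_gt0 => /andP[_]; rewrite prednK ?prime_gt0.
case: (size _) => // n; rewrite leq_exp2r // ltnW // trunc_log_ltn //.
Qed.
End Chebyshev.

(** * Quartic residues *)

Section QuarticPoints.
Local Open Scope ring_scope.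
Variable q : nat.
Hypotheses (pq : prime q) (q2 : (2 < q)%N).
Let F := 'F_q.
Let cF : #|F| = q := card_Fp pq.

Lemma card_power_roots (k : nat) (b : F) : (0 < k)%N -> (#|[set x : F | x ^+ k == b]| <= k)%N.
Proof.
move=> k0; pose P : {poly F} := 'X^k - b%:P.
have sP : size P = k.+1 by rewrite size_XnsubC.
have P0 : P != 0 by rewrite -size_poly_eq0 sP.
have := @max_poly_roots _ P (enum [set x : F | x ^+ k == b]) P0.
rewrite sP ltnS -cardE enum_uniq; apply=> //.
apply/allP => x; rewrite mem_enum inE => /eqP e.
by rewrite /root !hornerE ?hornerXn e subrr.
Qed.

Definition sqrts (b : F) := #|[set y : F | y ^+ 2 == b]|.

Arguments sqrts b%_R.

Lemma sqrts_sum : (\sum_(b : F) sqrts b = q)%N.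
Proof.
rewrite -[RHS]cF -sum1_card [RHS](partition_big (fun y : F => y ^+ 2) predT) //=.
by apply: eq_bigr => b _; rewrite sum1dep_card.
Qed.

Lemma sqrts_le2 b : (sqrts b <= 2)%N. Proof. exact: card_power_roots. Qed.

Lemma sqrtsZ u b : u != 0 -> sqrts (u ^+ 2 * b) = sqrts b.
Proof.
move=> u0; rewrite /sqrts -[RHS](card_imset _ (mulfI u0)); apply: eq_card => y.
rewrite !inE; apply/eqP/imsetP => [e|[z]]; last by rewrite inE => /eqP <- ->; rewrite exprMn.
exists (u^-1 * y); last by rewrite mulrA divff // mul1r.
by rewrite inE exprMn e exprVn mulrA mulVf ?mul1r // expf_neq0.
Qed.

(** For d <> 0 the sum counts points of the hyperbola (x - y) (x + y) = d, which are determined by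
    the nonzero x - y. For d = 0 the bound is 2 q. *)
Lemma sqrts_corr (d : F) : (\sum_(b : F) sqrts (b + d) * sqrts b <= q.-1 + (d == 0%R) * q.+1)%N.
Proof.
have q0 := prime_gt0 pq.
have [->|d0] /= := eqVneq d 0.
  apply: (@leq_trans (\sum_(b : F) 2 * sqrts b)).
    by apply: leq_sum => b _; rewrite leq_mul2r addr0 sqrts_le2 orbT.
  by rewrite -big_distrr /= sqrts_sum; move: q0; clear; lia.
have -> : (\sum_(b : F) sqrts (b + d) * sqrts b =
    #|[set z : F * F | z.1 ^+ 2 == (z.2 ^+ 2 + d)%R]|)%N.
  rewrite -sum1_card [RHS](partition_big (fun z : F * F => z.2 ^+ 2) predT) //=.
  apply: eq_bigr => b _; rewrite sum1dep_card /sqrts -cardsX; apply: eq_card => -[x y].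
  rewrite !inE /=; apply/andP/andP => -[/eqP e1 /eqP e2]; first by rewrite e1 e2 !eqxx.
  by rewrite e1 e2 !eqxx.
have -> : q.-1 = #|predC1 (0 : F)| by rewrite cardC1 cF.
rewrite mul0n addn0.
rewrite -(card_in_imset (f := fun z : F * F => z.1 - z.2)).
  apply: subset_leq_card; apply/subsetP => u /imsetP[[x y]]; rewrite inE /= => /eqP e ->.
  rewrite !inE subr_eq0; apply: contraNneq d0 => xy; move/eqP: e.
  by rewrite xy addrC -subr_eq subrr eq_sym.
move=> [x y] [x' y']; rewrite !inE /= => /eqP e /eqP e' h.
have sp (a b : F) : a ^+ 2 = b ^+ 2 + d -> (a - b) * (a + b) = d.
  by rewrite -subr_sqr => ->; rewrite addrAC subrr add0r.
have e1 := sp _ _ e; have e2 := sp _ _ e'.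
have u0 : x - y != 0 by apply: contraNneq d0 => u; rewrite -e1 u mul0r.
have h2 : x + y = x' + y' by apply: (mulfI u0); rewrite e1 h e2.
have n2 : (2%:R : F) != 0.
  by rewrite Fp_eq0 //; apply/negP => /dvdn_leq => /(_ isT); rewrite leqNgt q2.
have ex : x = x'.
  apply: (mulfI n2); have -> : 2%:R * x = (x - y) + (x + y) by ring.
  by rewrite h h2; ring.
by congr (_, _) => //; apply: (addrI x); rewrite h2 -ex.
Qed.

Definition quartic_pts (c : F) := (\sum_(m : F) sqrts (m ^+ 4 - c))%N.

Arguments quartic_pts c%_R.

Lemma quartic_pts_sum : (\sum_(c : F) quartic_pts c = q * q)%N.
Proof.
rewrite exchange_big /= (eq_bigr (fun _ => q)) ?sum_nat_const ?cF // => m _.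
by rewrite -[RHS]sqrts_sum [RHS](reindex_inj (subrI (m ^+ 4))).
Qed.

(** Expanding the square and summing over [c] first reduces it to correlations at m^4 - m'^4, a
    shift that vanishes for at most 4 values of m'. No bound for a single curve is used. *)
Lemma quartic_pts_sqr : (\sum_(c : F) quartic_pts c ^ 2 <= q * q * q.-1 + q * 4 * q.+1)%N.
Proof.
have -> : (\sum_(c : F) quartic_pts c ^ 2 = \sum_(m : F) \sum_(m' : F) \sum_(b : F)
    sqrts (b + (m ^+ 4 - m' ^+ 4)) * sqrts b)%N.
  under eq_bigr => c _ do rewrite -mulnn /quartic_pts big_distrl /=.
  rewrite exchange_big; apply: eq_bigr => m _ /=.
  under eq_bigr => c _ do rewrite big_distrr /=.
  rewrite exchange_big; apply: eq_bigr => m' _ /=.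
  rewrite [RHS](reindex_inj (subrI (m' ^+ 4))) /=; apply: eq_bigr => c _.
  by congr (sqrts _ * _)%N; ring.
apply: (@leq_trans (\sum_(m : F) \sum_(m' : F) (q.-1 + (m' ^+ 4 == m ^+ 4) * q.+1))%N).
  apply: leq_sum => m _; apply: leq_sum => m' _; apply: leq_trans (sqrts_corr _) _.
  by rewrite subr_eq0 eq_sym.
apply: (@leq_trans (\sum_(m : F) (q * q.-1 + 4 * q.+1))%N).
  apply: leq_sum => m _; rewrite big_split /= sum_nat_const cF leq_add2l -big_distrl /=.
  rewrite leq_mul2r; apply/orP; right.
  have -> : (\sum_(m' : F) (m' ^+ 4 == m ^+ 4) = #|[set m' : F | m' ^+ 4 == m ^+ 4]|)%N.
    by rewrite -sum1dep_card [RHS]big_mkcond; apply: eq_bigr => i _; case: eqP.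
  exact: card_power_roots.
by rewrite sum_nat_const cF; apply: eq_leq; ring.
Qed.

Lemma quartic_ptsZ g c : g != 0 -> quartic_pts (g ^+ 4 * c) = quartic_pts c.
Proof.
move=> g0; rewrite /quartic_pts (reindex_inj (mulfI g0)) /=; apply: eq_bigr => m _.
have -> : (g * m) ^+ 4 - g ^+ 4 * c = (g ^+ 2) ^+ 2 * (m ^+ 4 - c) by ring.
by rewrite sqrtsZ ?expf_neq0.
Qed.

Let dev (c : F) : int := ((quartic_pts c)%:Z - q%:Z) ^+ 2.

Lemma quartic_dev_sum : \sum_(c : F) dev c <= 5 * q%:Z ^+ 2.
Proof.
have e1 : \sum_(c : F) (quartic_pts c)%:Z = q%:Z * q%:Z.
  by rewrite -PoszM -quartic_pts_sum; apply/esym; apply: (big_morph Posz PoszD).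
have e2 : \sum_(c : F) (quartic_pts c)%:Z ^+ 2 <= (q * q * q.-1 + q * 4 * q.+1)%N%:Z.
  have -> : \sum_(c : F) (quartic_pts c)%:Z ^+ 2 = (\sum_(c : F) quartic_pts c ^ 2)%N%:Z.
    rewrite (big_morph Posz PoszD (erefl _)); apply: eq_bigr => c _.
    by rewrite -mulnn PoszM.
  by rewrite lez_nat quartic_pts_sqr.
have -> : \sum_(c : F) dev c = \sum_(c : F) (quartic_pts c)%:Z ^+ 2 -
    2 * q%:Z * (\sum_(c : F) (quartic_pts c)%:Z) + \sum_(c : F) q%:Z ^+ 2.
  rewrite mulr_sumr -sumrB -big_split /=; apply: eq_bigr => c _; rewrite /dev; ring.
rewrite e1 sumr_const cF -mulr_natr natz.
move: e2; set S := \sum_(_ : F) _ => e2; move: q2 e2; clear; case: q => // n; nia.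
Qed.

(* The deviation is constant on the classes of [c] modulo fourth powers, which have at
   least (q - 1) / 4 elements, so that the second moment bounds each single term. *)
Lemma quartic_dev c : c != 0 -> q.-1%:Z * dev c <= 20 * q%:Z ^+ 2.
Proof.
move=> c0.
have -> : q.-1%:Z * dev c = \sum_(g : F | g != 0) dev (g ^+ 4 * c).
  rewrite (eq_bigr (fun _ => dev c)) => [|g g0]; last by rewrite /dev quartic_ptsZ.
  rewrite sumr_const -[X in _ = _ *+ X]/#|predC1 (0 : F)| cardC1 cF.
  by rewrite -mulr_natl natz.
rewrite (partition_big (fun g => g ^+ 4 * c) predT) //=.
apply: (@le_trans _ _ (\sum_(b : F) 4 * dev b)); last first.
  by rewrite -mulr_sumr; have := quartic_dev_sum; lra.
apply: ler_sum => b _; rewrite (eq_bigr (fun _ => dev b)) => [|g /andP[_ /eqP -> //]].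
rewrite sumr_const -[leLHS]mulr_natl; apply: ler_wpM2r; first exact: sqr_ge0.
rewrite natz lez_nat; apply: leq_trans (@card_power_roots 4 (b / c) _) => //.
apply: subset_leq_card; apply/subsetP => g; rewrite !inE => /andP[_ /eqP <-].
by rewrite mulfK.
Qed.

(** For c <> 0, [quartic_dev] gives 16 dev <= 320 q^2 / (q - 1) < q^2 once q > 321, so there are at
    least 3 q / 4 points. Each good [m] carries at most 2, and the points with y = 0 number at most
    4. *)
Lemma quartic_points c : (321 < q)%N ->
  (q <= 4 * #|[set m : F | [exists y : F, (y != 0%R) && (y ^+ 2 == m ^+ 4 - c)%R]]|)%N.
Proof.
move=> hq; set G := [set m : F | _].
have [c0|c0] := eqVneq c 0.
  have : (q.-1 <= #|G|)%N.
    have -> : q.-1 = #|predC1 (0 : F)| by rewrite cardC1 cF.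
    apply: subset_leq_card; apply/subsetP => m.
    rewrite !inE => m0; apply/existsP; exists (m ^+ 2); rewrite expf_neq0 //= c0 subr0.
    by rewrite -exprM.
  by move: hq; clear; lia.
have : (quartic_pts c <= 2 * #|G| + 4)%N.
  apply: (@leq_trans (\sum_(m : F) (2 * (m \in G) + (m ^+ 4 == c)))%N).
    apply: leq_sum => m _; case: (boolP (m \in G)) => mG.
      by apply: leq_trans (sqrts_le2 _) _; rewrite muln1 leq_addr.
    rewrite muln0 add0n; have [e|e] := eqVneq (m ^+ 4) c.
      rewrite e subrr /sqrts; apply: leq_trans (_ : #|[set 0%R : F]| <= 1)%N; last by rewrite cards1.
      by apply: subset_leq_card; apply/subsetP => y; rewrite !inE sqrf_eq0.
    rewrite leqn0 cards_eq0; apply/eqP/setP => y; rewrite !inE; apply/negP => hy.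
    move: mG; rewrite inE => /existsP; apply; exists y; rewrite hy andbT.
    by apply: contraNneq e => y0; move: hy; rewrite y0 expr0n /= eq_sym subr_eq0.
  rewrite big_split /= -big_distrr /=; apply: leq_add.
    rewrite leq_mul2l /= -sum1_card [leqRHS]big_mkcond /=.
    by apply: leq_sum => i _; case: (i \in G).
  have -> : (\sum_(m : F) (m ^+ 4 == c) = #|[set m : F | m ^+ 4 == c]|)%N.
    by rewrite -sum1dep_card [RHS]big_mkcond; apply: eq_bigr => i _; case: eqP.
  exact: card_power_roots.
have := quartic_dev c0; rewrite /dev.
have : (4 * quartic_pts c < 3 * q)%N -> 320 * q%:Z ^+ 2 < q.-1%:Z * (16 * ((quartic_pts c)%:Z - q%:Z) ^+ 2).
  move=> h; apply: (@lt_le_trans _ _ (q.-1%:Z * q%:Z ^+ 2)).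
    by rewrite ltr_pM2r ?exprn_gt0 ?ltz_nat //; move: hq; clear; lia.
  rewrite ler_wpM2l //; move: h; move: (quartic_pts c) q => u v; clear => h.
  have h' : v%:Z <= 4 * (v%:Z - u%:Z) by lia.
  have : v%:Z ^+ 2 <= (4 * (v%:Z - u%:Z)) ^+ 2 by rewrite lerXn2r ?nnegrE //; lia.
  by have -> : (4 * (v%:Z - u%:Z)) ^+ 2 = 16 * (u%:Z - v%:Z) ^+ 2 by ring.
move: (quartic_pts c) => u; case: (ltnP (4 * u) (3 * q)) => [_ /(_ isT) h1 h2|h _ _].
  by move: h1 h2; set z := (_ - _) ^+ 2; move: (q.-1%:Z) (q%:Z ^+ 2) => s t; clear; nia.
by move: h hq; clear; lia.
Qed.
End QuarticPoints.

(** * Points on conics *)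

Section Conic.
Implicit Types (f r l g m D x y : nat).

(** As for squarefree [r], but g and f / g may share a factor [h]. It divides 2 l0 and l0^2 + r,
    hence 4 r; roots with the same g agree modulo f / h, so there are at most [h] of them. *)
Lemma sqrt_roots_count r f : 0 < r -> 0 < f ->
  size [seq l <- iota 0 f | f %| l ^ 2 + r] <= 4 * r * size (divisors f).
Proof.
move=> r0 f0; set s := [seq _ <- _ | _].
have us : uniq s by rewrite filter_uniq ?iota_uniq.
case Es: s => [//|l0 s']; rewrite -Es.
have : l0 \in s by rewrite Es mem_head.
rewrite mem_filter => /andP[h0 _].
pose F1 l := gcdn f `|(Posz l - Posz l0)%R|%N.
have F1d l : F1 l %| f by rewrite dvdn_gcdl.
apply: (size_fiber (f := F1)) => [l _|g]; first by rewrite -dvdn_divisors.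
rewrite -dvdn_divisors // => gf; set t := [seq _ <- s | _].
have g0 := dvdn_gt0 f0 gf; set e := f %/ g; have fe : f = e * g by rewrite divnK.
have e0 : 0 < e by move: f0; rewrite fe muln_gt0 => /andP[].
pose L := lcmn g e; pose h := gcdn g e.
have Lh : f = h * L by rewrite mulnC muln_lcm_gcd mulnC.
have h0' : 0 < h by rewrite gcdn_gt0 g0.
have L0 : 0 < L by rewrite lcmn_gt0 g0.
have tP l : l \in t -> [/\ l < f, g %| `|(Posz l - Posz l0)%R|%N & e %| l + l0].
  rewrite !mem_filter mem_iota add0n /= => /andP[/eqP eg /andP[hl lf]]; split=> //.
    by rewrite -eg dvdn_gcdr.
  by have := sqrt_roots_split f0 hl h0; rewrite -/(F1 l) eg.
case: (boolP (nilp t)) => [/nilP -> //|tn].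
have [l1 l1t] : exists l1, l1 \in t by case: (t) tn => // x t' _; exists x; rewrite mem_head.
have h4 : h <= 4 * r.
  apply: dvdn_leq; first by rewrite muln_gt0.
  have [_ d1 d2] := tP _ l1t.
  have hd : (Posz h %| Posz (2 * l0))%Z.
    have -> : Posz (2 * l0) = (Posz (l1 + l0) - (Posz l1 - Posz l0))%R by rewrite PoszM PoszD; ring.
    apply: rpredB; rewrite dvdzE /=; first exact: dvdn_trans (dvdn_gcdr _ _) d2.
    exact: dvdn_trans (dvdn_gcdl _ _) d1.
  rewrite dvdzE /= in hd.
  have hr : h %| 4 * (l0 ^ 2 + r).
    by apply: dvdn_mull; apply: dvdn_trans h0; rewrite Lh dvdn_mulr.
  have e4 : 4 * (l0 ^ 2 + r) = (2 * l0) ^ 2 + 4 * r by ring.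
  by rewrite -(dvdn_addr _ (m := (2 * l0) ^ 2)) -?e4 // -mulnn dvdn_mulr.
apply: leq_trans h4; rewrite -[leqLHS](size_map (fun l => l %/ L)) -[leqRHS](size_iota 0 h).
have ut : uniq t by rewrite filter_uniq.
apply: uniq_leq_size; last first.
  move=> _ /mapP[l /tP[lf _ _] ->]; rewrite mem_iota add0n /= ltn_divLR //.
  by rewrite -Lh.
rewrite map_inj_in_uniq // => l l' /tP[lf d1 d2] /tP[lf' d1' d2'] eq.
have dL : (Posz L %| (Posz l - Posz l')%R)%Z.
  rewrite dvdzE /= dvdn_lcm; apply/andP; split.
    have -> : (Posz l - Posz l')%R = ((Posz l - Posz l0) - (Posz l' - Posz l0))%R by ring.
    by rewrite -[g]/(absz (Posz g)) -dvdzE; apply: rpredB; rewrite dvdzE.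
  have -> : (Posz l - Posz l')%R = (Posz (l + l0) - Posz (l' + l0))%R by rewrite !PoszD; ring.
  by rewrite -[e]/(absz (Posz e)) -dvdzE; apply: rpredB; rewrite dvdzE.
have em : l %% L = l' %% L.
  by apply/eqP; rewrite -eqz_nat -!modz_nat -[_ == _]/(_ == _ %[mod _])%Z eqz_mod_dvd.
by rewrite (divn_eq l L) (divn_eq l' L) eq em.
Qed.

(** [f] divides u = x y' - x' y, and (x x' + r y y')^2 + r u^2 = f^2 with a positive first square,
    so |u| < f and u = 0. *)
Lemma primitive_conic_inj r f l x y x' y' : 0 < r -> 0 < y -> 0 < y' -> 0 < x -> 0 < x' ->
  coprime x y -> coprime x' y' -> x ^ 2 + r * y ^ 2 = f -> x' ^ 2 + r * y' ^ 2 = f ->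
  f %| x + y * l -> f %| x' + y' * l -> (x, y) = (x', y').
Proof.
move=> r0 y0 y'0 x0 x'0 co co' e e' d d'.
have dz : (Posz f %| (Posz x * Posz y' - Posz x' * Posz y)%R)%Z.
  have -> : (Posz x * Posz y' - Posz x' * Posz y =
     Posz (x + y * l) * Posz y' - Posz (x' + y' * l) * Posz y)%R by rewrite !PoszD !PoszM; ring.
  by apply: rpredB; apply: dvdz_mulr; rewrite dvdzE.
have eqz : (Posz x * Posz y' - Posz x' * Posz y = 0)%R.
  apply/eqP; apply/negPn/negP => nz; set u := (_ - _)%R in dz nz.
  have uf : (Posz f * Posz f <= u * u)%R.
    have : (Posz f <= `|u|)%R.
      have a0 : 0 < `|u|%N by rewrite absz_gt0.
      by rewrite -abszE lez_nat; apply: dvdn_leq => //; rewrite dvdzE in dz.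
    move=> h; have -> : (u * u = `|u| * `|u|)%R by rewrite -normrM ger0_norm // -expr2 sqr_ge0.
    by apply: ler_pM.
  have E : ((Posz x * Posz x' + Posz r * Posz y * Posz y') ^+ 2 + Posz r * (u * u) = Posz f * Posz f)%R.
    by rewrite -{1}e -e' !PoszD !PoszM /u; ring.
  have p0 : (0 < (Posz x * Posz x' + Posz r * Posz y * Posz y') ^+ 2)%R.
    by rewrite exprn_gt0 // addr_gt0 ?mulr_gt0 ?ltz_nat.
  have r1 : (u * u <= Posz r * (u * u))%R by rewrite ler_peMl // -expr2 sqr_ge0.
  by move: uf E p0 r1; clear; lia.
have en : x * y' = x' * y by move: eqz; rewrite -!PoszM; clear; lia.
have xx : x = x'.
  apply/eqP; rewrite eqn_dvd; apply/andP; split.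
    by rewrite -(Gauss_dvdl _ co) -en dvdn_mulr.
  by rewrite -(Gauss_dvdl _ co') en dvdn_mulr.
by rewrite xx; congr (_, _); apply/eqP; rewrite -(eqn_pmul2l x'0) -en xx.
Qed.

(* A primitive point (x, y) determines the root x / y of z^2 = - r, and is determined by it. *)
Lemma conic_count r D (s : seq (nat * nat)) : 0 < r -> 0 < D -> uniq s ->
  (forall z, z \in s -> [/\ 0 < z.1, 0 < z.2 & z.1 ^ 2 + r * z.2 ^ 2 = D]) ->
  size s <= 4 * r * size (divisors D) ^ 2.
Proof.
move=> r0 D0 us hs; rewrite -mulnn mulnA.
apply: (size_fiber (f := fun z => gcdn z.1 z.2)) => [z zs|g].
  have [_ _ <-] := hs z zs; rewrite -dvdn_divisors; last by have [? ? ->] := hs z zs.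
  by apply: dvdn_add; last apply: dvdn_mull; apply: dvdn_exp => //; rewrite ?dvdn_gcdl ?dvdn_gcdr.
move=> _; set t := [seq _ <- s | _].
have ut : uniq t by rewrite filter_uniq.
case: (boolP (nilp t)) => [/nilP -> //|tn].
have [z0 z0t] : exists z, z \in t by case: (t) tn => // x t' _; exists x; rewrite mem_head.
have tP z : z \in t -> exists x y, [/\ z = (x * g, y * g), 0 < x, 0 < y, coprime x y &
    (x ^ 2 + r * y ^ 2) * g ^ 2 = D].
  rewrite mem_filter => /andP[/eqP eg zs]; have [z1 z2 e] := hs z zs.
  have g0 : 0 < g by rewrite -eg gcdn_gt0 z1.
  have e1 : z.1 = z.1 %/ g * g by rewrite divnK // -eg dvdn_gcdl.
  have e2 : z.2 = z.2 %/ g * g by rewrite divnK // -eg dvdn_gcdr.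
  exists (z.1 %/ g), (z.2 %/ g); split.
  - by rewrite [LHS]surjective_pairing; congr (_, _).
  - by rewrite divn_gt0 // dvdn_leq // -eg dvdn_gcdl.
  - by rewrite divn_gt0 // dvdn_leq // -eg dvdn_gcdr.
  - by rewrite /coprime -(eqn_pmul2r g0) muln_gcdl -e1 -e2 eg mul1n.
  by rewrite mulnDl -mulnA -!expnMn -e1 -e2.
have [x0 [y0 [_ x00 _ _ eD]]] := tP z0 z0t.
have g0 : 0 < g ^ 2 by move: D0; rewrite -eD muln_gt0 => /andP[].
set f := x0 ^ 2 + r * y0 ^ 2 in eD.
have f0 : 0 < f by rewrite addn_gt0 expn_gt0 x00.
have fD : size (divisors f) <= size (divisors D).
  apply: uniq_leq_size; first exact: divisors_uniq.
  move=> d; rewrite -!dvdn_divisors // -eD => h; exact: dvdn_mulr.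
apply: leq_trans (_ : 4 * r * size (divisors f) <= _); last by rewrite leq_mul2l fD orbT.
apply: leq_trans (sqrt_roots_count r0 f0).
have ex z : z \in t -> exists l, l \in [seq l <- iota 0 f | f %| l ^ 2 + r] /\ f %| z.1 %/ g + z.2 %/ g * l.
  move=> /tP[x [y [-> xp yp co ef]]] /=.
  have gp : 0 < g by move: g0; rewrite expn_gt0 orbF.
  rewrite !mulnK //.
  have {}ef : x ^ 2 + r * y ^ 2 = f by apply/eqP; rewrite -(eqn_pmul2r g0) ef eD.
  have cof : coprime y f.
    rewrite -ef -[r * _]/(r * (y * y)) mulnA addnC /coprime gcdnMDl -/(coprime _ _).
    by apply: coprimeXr; rewrite coprime_sym.
  have dv : f %| x ^ 2 + r * y ^ 2 by rewrite ef.
  have [l []] := root_quotient f0 yp cof dv.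
  move=> h1 h2; exists (l %% f); split.
    rewrite mem_filter mem_iota add0n ltn_pmod // leq0n !andbT.
    by rewrite /dvdn -modnDml modnXm modnDml.
  by move: h1; rewrite {1}(divn_eq l f) mulnDr addnCA mulnA dvdn_addr ?dvdn_mull.
have [F hF] := seq_choice 0 ex.
rewrite -[leqLHS](size_map F); apply: uniq_leq_size; last by move=> _ /mapP[z /hF[h _] ->].
rewrite map_inj_in_uniq // => z z' zt zt' eF.
have [_ d1] := hF z zt; have [_ d2] := hF z' zt'; rewrite -eF in d2.
have gp : 0 < g by move: g0; rewrite expn_gt0 orbF.
have [x [y [ez xp yp co ef]]] := tP z zt; have [x' [y' [ez' xp' yp' co' ef']]] := tP z' zt'.
rewrite ez ez' /= !mulnK // in d1 d2 *.
have {}ef : x ^ 2 + r * y ^ 2 = f by apply/eqP; rewrite -(eqn_pmul2r g0) ef eD.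
have {}ef' : x' ^ 2 + r * y' ^ 2 = f by apply/eqP; rewrite -(eqn_pmul2r g0) ef' eD.
by case: (primitive_conic_inj r0 yp yp' xp xp' co co' ef ef' d1 d2) => -> ->.
Qed.
End Conic.

(** * Choice of m *)

Section ChoiceOfM.
Implicit Types (D n m c r q H X : nat).

Definition quartic_split (D m q : nat) : bool :=
  [exists y : 'F_q, (y != 0%R) && (y ^+ 2 == m%:R ^+ 4 - D%:R)%R].

Lemma count_sum (T : eqType) (s : seq T) (P : pred T) : count P s = \sum_(i <- s) P i.
Proof. by rewrite -sum1_count [LHS]big_mkcond; apply: eq_bigr => i _; case: (P i). Qed.

Lemma quartic_split_block D m0 s q k : prime q -> ~~ (q %| s) ->
  \sum_(0 <= j < q) quartic_split D (m0 + s * (k * q + j)) q =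
  #|[set m : 'F_q | [exists y : 'F_q, (y != 0%R) && (y ^+ 2 == m ^+ 4 - D%:R)%R]]|.
Proof.
move=> pq qs; have q0 := prime_gt0 pq.
pose g (j : 'I_q) : 'F_q := ((m0 + s * (k * q + j))%:R)%R.
have ig : injective g.
  have mono (i j : 'I_q) : i <= j -> g i = g j -> i = j.
    move=> le /(Fp_eqP pq); rewrite eq_sym eqn_modDl eqn_mod_dvd; last by rewrite leq_mul2l leq_add2l le orbT.
    rewrite -mulnBr subnDl Euclid_dvdM // (negPf qs) /= => dv; apply/val_inj/eqP; rewrite /= eqn_leq le /=.
    rewrite -subn_eq0; move: dv; have := ltn_ord j; case: (j - i) (leq_subr i j) => // u lu lq /dvdn_leq -/(_ isT).
    by rewrite leqNgt (leq_ltn_trans lu lq).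
  by move=> i j e; case: (leqP i j) => [|/ltnW] le; [exact: mono | apply/esym/mono].
have cq : #|'I_q| = #|'F_q| by rewrite card_ord card_Fp.
rewrite big_mkord -sum1dep_card [RHS]big_mkcond.
rewrite [RHS](reindex g) /=; first by apply: eq_bigr => j _; rewrite /quartic_split /g; case: ifP.
by apply: onW_bij; apply: inj_card_bij => //; rewrite -cq.
Qed.

(** Each full block of length [q] contains at least q / 4 good terms, and full blocks fill more than
    half of [H]; hence the factor 8. *)
Lemma quartic_split_count D m0 s q H : prime q -> 321 < q -> ~~ (q %| s) -> q <= H ->
  H <= 8 * \sum_(0 <= i < H) quartic_split D (m0 + s * i) q.
Proof.
move=> pq q1 qs qH; have q0 := prime_gt0 pq.
set S := [set m : 'F_q | [exists y : 'F_q, (y != 0%R) && (y ^+ 2 == m ^+ 4 - D%:R)%R]].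
have S4 : q <= 4 * #|S| by apply: quartic_points => //; apply: leq_trans q1.
have blocks u : \sum_(0 <= i < u * q) quartic_split D (m0 + s * i) q = u * #|S|.
  elim: u => [|u IH]; first by rewrite big_geq.
  rewrite (big_cat_nat (n := u * q)) //=; last by rewrite mulSn leq_addl.
  rewrite IH mulSn addnC; congr (_ + _).
  rewrite -{1}[u * q]add0n big_addn addnK -(quartic_split_block D m0 u pq qs).
  by apply: eq_bigr => j _; rewrite [j + _]addnC.
have : (H %/ q) * #|S| <= \sum_(0 <= i < H) quartic_split D (m0 + s * i) q.
  by rewrite -blocks [leqRHS](big_cat_nat (n := H %/ q * q)) ?leq_divM //= leq_addr.
have : H < 2 * (H %/ q * q).
  have := ltn_ceil H q0; have : 0 < H %/ q by rewrite divn_gt0.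
  by move: (H %/ q) => u; clear; nia.
by move: (\sum_(_ <= _ < _) _) (H %/ q) S4 => z u; move: #|S| => t; clear; nia.
Qed.

(** Here y^2 = - c^2 r modulo [q], so y <> 0 keeps [q] prime to [c] and [r], and y / c is a root of
    - r. *)
Lemma quartic_split_root D m c r q : prime q -> D = m ^ 4 + c ^ 2 * r -> quartic_split D m q ->
  ~~ (q %| r) /\ exists v, q %| v ^ 2 + r.
Proof.
move=> pq eD /existsP[y /andP[y0 /eqP ey]].
have dv : q %| (val y) ^ 2 + r * c ^ 2.
  by rewrite -(Fp_eq0 pq) natrD natrX natr_Zp ey eD natrD natrX natrM; apply/eqP; rewrite [X in (_ + X)%R]natrM; ring.
have qy : ~~ (q %| val y) by rewrite -(Fp_eq0 pq) natr_Zp.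
have ny : ~~ (q %| val y ^ 2) by rewrite Euclid_dvdX // andbT.
have qc : ~~ (q %| c).
  by apply: contra ny => h; rewrite -(dvdn_addl _ (n := r * c ^ 2)) // dvdn_mull // dvdn_exp.
have qr : ~~ (q %| r).
  by apply: contra ny => h; rewrite -(dvdn_addl _ (n := r * c ^ 2)) // dvdn_mulr.
split=> //; have c0 : 0 < c by case: (c) qc => //; rewrite dvdn0.
have cc : coprime c q by rewrite coprime_sym prime_coprime.
by have [l [_ h]] := root_quotient (prime_gt0 pq) c0 cc dv; exists l.
Qed.

(** By averaging, at least H / 16 indices have a sixteenth of [Q] split. If all of these had r <
    rho, each [r] would account for at most 4 rho tau^2 of them through points (m^2, c) of its
    conic, in all fewer than H / 16. *)
Lemma choose_m D n m0 s H rho tau (Q : seq nat) : 0 < s -> 0 < m0 ->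
  (forall i, i < H -> (m0 + s * i) ^ 4 < D) -> uniq Q ->
  (forall q, q \in Q -> [/\ prime q, 321 < q, ~~ (q %| s) & q <= H]) -> 0 < size Q ->
  n <= rho ^ 16 -> size (divisors D) <= tau -> 64 * rho ^ 2 * tau ^ 2 < H ->
  exists i c r, [/\ i < H, D = (m0 + s * i) ^ 4 + c ^ 2 * r, 0 < c, sqfree r & n <= r ^ 16 /\
    exists Q', [/\ uniq Q', {subset Q' <= Q}, size Q <= 16 * size Q' &
      forall q, q \in Q' -> ~~ (q %| r) /\ exists v, q %| v ^ 2 + r]].
Proof.
move=> s0 m00 hD uQ hQ Q0 hn ht hH.
pose m i := m0 + s * i.
have mi : injective m by move=> i j /addnI/eqP; rewrite eqn_pmul2l // => /eqP.
pose cnt i := count (quartic_split D (m i)) Q.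
pose G := [seq i <- iota 0 H | size Q <= 16 * cnt i].
have sumQ : size Q * H <= 8 * \sum_(0 <= i < H) cnt i.
  have -> : \sum_(0 <= i < H) cnt i = \sum_(q <- Q) \sum_(0 <= i < H) quartic_split D (m i) q.
    by rewrite exchange_big; apply: eq_bigr => i _; rewrite /cnt count_sum.
  rewrite big_distrr /= -sum1_size big_distrl /= big_seq [leqRHS]big_seq; apply: leq_sum => q qQ.
  by have [pq q1 qs qH] := hQ q qQ; rewrite mul1n; exact: quartic_split_count.
have GH : H <= 16 * size G.
  have : \sum_(0 <= i < H) 16 * cnt i <= 16 * size Q * size G + size Q * H.
    have -> : size G = \sum_(0 <= i < H) (size Q <= 16 * cnt i) by rewrite size_filter count_sum /index_iota subn0.
    have -> : size Q * H = \sum_(0 <= i < H) size Q by rewrite sum_nat_const_nat subn0 mulnC.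
    rewrite big_distrr -big_split /=; apply: leq_sum => i _.
    case: (leqP (size Q) (16 * cnt i)) => h; last by rewrite muln0 add0n ltnW.
    by rewrite muln1 (leq_trans _ (leq_addr _ _)) // leq_mul2l count_size.
  rewrite -big_distrr /=; move: sumQ Q0; move: (\sum_(_ <= _ < _) _) (size Q) (size G) => z u v.
  clear=> h1 u0 h2; rewrite -(leq_pmul2l u0); move: h1 h2; clear; nia.
have D0 : 0 < D by apply: leq_ltn_trans (hD 0 _) => //; apply: leq_ltn_trans hH.
have [f hf] : exists f, forall i, i \in G -> D = m i ^ 4 + (f i).1 ^ 2 * (f i).2 /\ 0 < (f i).1 /\ sqfree (f i).2.
  apply: (@seq_choice _ _ G (0, 0) (fun i (cr : nat * nat) => D = m i ^ 4 + cr.1 ^ 2 * cr.2 /\ 0 < cr.1 /\ sqfree cr.2)).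
  move=> i; rewrite mem_filter mem_iota add0n => /andP[_ /andP[_ iH]].
  have lt := hD i iH; have lt' : 0 < D - m i ^ 4 by rewrite subn_gt0.
  have [c [r [e c0 sr]]] := sqfree_decomp lt'.
  exists (c, r); rewrite /= -e subnKC //; exact: ltnW.
case: (boolP (has (fun i => n <= (f i).2 ^ 16) G)) => [/hasP[i iG hi]|no].
  have [e [c0 sr]] := hf i iG; move: (iG); rewrite mem_filter mem_iota add0n => /andP[hc /andP[_ iH]].
  exists i, (f i).1, (f i).2; split=> //; split=> //.
  exists [seq q <- Q | quartic_split D (m i) q]; split.
  - by rewrite filter_uniq.
  - by move=> q; rewrite mem_filter => /andP[].
  - by rewrite size_filter.
  move=> q; rewrite mem_filter => /andP[hq qQ]; have [pq _ _ _] := hQ q qQ.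
  exact: quartic_split_root pq e hq.
exfalso; have : size G <= 4 * rho * tau ^ 2 * size (iota 0 rho).
  apply: (size_fiber (f := fun i => (f i).2)) => [i iG|r].
    rewrite mem_iota add0n /= ltnNge; apply: contra no => h; apply/hasP; exists i => //.
    by apply: leq_trans hn _; rewrite leq_exp2r.
  rewrite mem_iota add0n /= => rr; set t := [seq _ <- G | _].
  case: (posnP r) => [r0|r0].
    suff -> : t = [::] by [].
    apply/eqP; rewrite -size_eq0 size_filter -leqn0 leqNgt -has_count; apply/hasP => -[i iG /eqP e].
    by have [_ [_ /sqfree_gt0]] := hf i iG; rewrite e r0.
  have ut : uniq t by rewrite !filter_uniq ?iota_uniq.
  rewrite -(size_map (fun i => (m i ^ 2, (f i).1))).
  apply: (@leq_trans (4 * r * size (divisors D) ^ 2)); last first.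
    apply: leq_mul; last by rewrite leq_exp2r.
    by rewrite leq_mul2l (ltnW rr) orbT.
  apply: (conic_count r0 D0).
    rewrite map_inj_in_uniq // => i j _ _ e; have /eqP := congr1 fst e.
    by rewrite /= eqn_exp2r // => /eqP/mi.
  move=> z /mapP[i]; rewrite mem_filter => /andP[/eqP er iG] -> /=.
  have [e [c0 _]] := hf i iG; split=> //; first by rewrite expn_gt0 addn_gt0 m00.
  by rewrite e er -expnM [r * _]mulnC.
rewrite size_iota => h; move: hH; rewrite ltnNge => /negP; apply.
apply: leq_trans GH _; move: h; clear; rewrite -!mulnn; nia.
Qed.
End ChoiceOfM.

(** * Existence of a good representation *)

Section Symmetry.
Local Open Scope ring_scope.
Implicit Types (a b c : quat).

Definition qrot a := Quat (qre a) (qj a) (qk a) (qi a).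

Lemma qrot_inj : injective qrot.
Proof. by case=> a1 a2 a3 a4 [b1 b2 b3 b4] [-> -> -> ->]. Qed.

(** Some coordinate has the parity of [r], and for one of its two signs u + e x is not 0, since [p]
    does not divide 2 u. Moving that coordinate to the front with that sign is one of six
    isometries, and the most frequent one is kept. *)
Lemma symmetrize (A : seq quat) (r p : nat) (u e : int) : uniq A ->
  (forall a, a \in A -> qre a = 0 /\ qnorm a = r%:Z) -> ~~ (p%:Z %| 2 * u)%Z ->
  exists A' : seq quat, [/\ uniq A', (size A <= 6 * size A')%N &
    forall a, a \in A' -> [/\ qre a = 0, qnorm a = r%:Z, (2 %| qi a - r%:Z)%Z &
      ~~ (p%:Z %| u + e * qi a)%Z]].
Proof.
move=> uA hA pu.
pose good a := (2 %| qi a - r%:Z)%Z && ~~ (p%:Z %| u + e * qi a)%Z.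
pose fs : seq (quat -> quat) := [:: id; qrot; qrot \o qrot; -%R; -%R \o qrot; -%R \o (qrot \o qrot)].
have fsP f : List.In f fs -> injective f /\ forall a, qre a = 0 -> qre (f a) = 0 /\ qnorm (f a) = qnorm a.
  have nN a : qnorm (- a) = qnorm a by rewrite /qnorm !qE; ring.
  have nR a : qnorm (qrot a) = qnorm a by rewrite /qnorm /=; ring.
  have ii : injective (qrot \o qrot) by apply: inj_comp; exact: qrot_inj.
  case=> [<-|[<-|[<-|[<-|[<-|[<-|[]]]]]]].
  - by split=> [x y|].
  - by split; [exact: qrot_inj | move=> a ha; rewrite nR].
  - by split=> // a ha; rewrite /= !nR.
  - by split; [exact: oppr_inj | move=> a ha; rewrite nN !qE ha].
  - split; first by apply: inj_comp; [exact: oppr_inj | exact: qrot_inj].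
    by move=> a ha; rewrite /= nN nR ?qE /= ha oppr0.
  split; first by apply: inj_comp; [exact: oppr_inj | exact: ii].
  by move=> a ha; rewrite /= nN !nR ?qE /= ha oppr0.
have key a : a \in A -> exists f, List.In f fs /\ good (f a).
  move=> /hA[ra na].
  have np x : (p%:Z %| u + e * x)%Z -> ~~ (p%:Z %| u + e * - x)%Z.
    move=> h1; apply: contra pu => h2; have -> : 2 * u = (u + e * x) + (u + e * - x) by ring.
    exact: rpredD.
  have two x : (2 %| x - r%:Z)%Z -> (2 %| - x - r%:Z)%Z.
    by move=> h; have -> : - x - r%:Z = (x - r%:Z) - 2 * x by [ring]; apply: rpredB => //; exact: dvdz_mulr.
  have : [|| (2 %| qi a - r%:Z)%Z, (2 %| qj a - r%:Z)%Z | (2 %| qk a - r%:Z)%Z].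
    have E : qi a ^+ 2 + qj a ^+ 2 + qk a ^+ 2 = r%:Z by rewrite -na /qnorm ra; ring.
    rewrite -E; move: (qi a) (qj a) (qk a) => x y z; clear.
    have par (w : int) : exists v, w = 2 * v \/ w = 2 * v + 1.
      by exists (w %/ 2)%Z; have := divz_eq w 2; have := ltz_pmod w (isT : 0 < 2 :> int); have := modz_ge0 w (isT : 2 != 0 :> int); lia.
    have even_d (t v : int) : t = 2 * v -> (2 %| t)%Z by move=> ->; exact: dvdz_mulr.
    case: (par x) => x' [] ->; case: (par y) => y' [] ->; case: (par z) => z' [] ->; apply/or3P.
    - by constructor 1; apply: (even_d _ (x' - 2 * (x' ^+ 2 + y' ^+ 2 + z' ^+ 2))); ring.
    - by constructor 3; apply: (even_d _ (- z' - 2 * (x' ^+ 2 + y' ^+ 2 + z' ^+ 2))); ring.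
    - by constructor 2; apply: (even_d _ (- y' - 2 * (x' ^+ 2 + y' ^+ 2 + z' ^+ 2))); ring.
    - by constructor 1; apply: (even_d _ (x' - 2 * (x' ^+ 2 + y' ^+ 2 + z' ^+ 2) - 2 * y' - 2 * z' - 1)); ring.
    - by constructor 1; apply: (even_d _ (- x' - 2 * (x' ^+ 2 + y' ^+ 2 + z' ^+ 2))); ring.
    - by constructor 2; apply: (even_d _ (y' - 2 * (x' ^+ 2 + y' ^+ 2 + z' ^+ 2) - 2 * x' - 2 * z' - 1)); ring.
    - by constructor 3; apply: (even_d _ (z' - 2 * (x' ^+ 2 + y' ^+ 2 + z' ^+ 2) - 2 * x' - 2 * y' - 1)); ring.
    by constructor 1; apply: (even_d _ (- x' - 2 * (x' ^+ 2 + y' ^+ 2 + z' ^+ 2) - 2 * y' - 2 * z' - 1)); ring.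
  case/or3P => h.
  - case: (boolP (p%:Z %| u + e * qi a)%Z) => hp; last by exists id; split; [left | rewrite /good /= h].
    exists -%R; split; first by do 3 right; left.
    by rewrite /good !qE two ?np.
  - case: (boolP (p%:Z %| u + e * qj a)%Z) => hp; last by exists qrot; split; [right; left | rewrite /good /= h].
    exists (-%R \o qrot); split; first by do 4 right; left.
    by rewrite /good /= ?qE /= two ?np.
  case: (boolP (p%:Z %| u + e * qk a)%Z) => hp; last by exists (qrot \o qrot); split; [right; right; left | rewrite /good /= h].
  exists (-%R \o (qrot \o qrot)); split; first by do 5 right; left.
  by rewrite /good /= ?qE /= two ?np.
have tot : (size A <= \sum_(f <- fs) count (good \o f) A)%N.
  elim: (A) key => [//|a s IH] key /=.
  rewrite big_split /= -add1n; apply: leq_add; last by apply: IH => x xs; apply: key; rewrite inE xs orbT.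
  have [f [fin gf]] := key a (mem_head _ _).
  move: fin; rewrite /fs !big_cons big_nil /=.
  by case=> [e1|[e1|[e1|[e1|[e1|[e1|[]]]]]]]; rewrite -e1 /= in gf; rewrite gf; clear; lia.
have [f [fin hf]] : exists f, List.In f fs /\ (size A <= 6 * count (good \o f) A)%N.
  move: tot; rewrite /fs !big_cons big_nil addn0; set c1 := count _ _; set c2 := count _ _.
  set c3 := count _ _; set c4 := count _ _; set c5 := count _ _; set c6 := count _ _ => tot.
  have : [\/ (size A <= 6 * c1)%N, (size A <= 6 * c2)%N, (size A <= 6 * c3)%N | [|| (size A <= 6 * c4)%N, (size A <= 6 * c5)%N | (size A <= 6 * c6)%N]].
    case: (leqP (size A) (6 * c1)) => h1; first by constructor 1.
    case: (leqP (size A) (6 * c2)) => h2; first by constructor 2.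
    case: (leqP (size A) (6 * c3)) => h3; first by constructor 3.
    by constructor 4; move: tot h1 h2 h3; clear; lia.
  case=> [h|h|h|/or3P[h|h|h]].
  - by exists id; split=> //; left.
  - by exists qrot; split=> //; right; left.
  - by exists (qrot \o qrot); split=> //; right; right; left.
  - by exists -%R; split=> //; do 3 right; left.
  - by exists (-%R \o qrot); split=> //; do 4 right; left.
  by exists (-%R \o (qrot \o qrot)); split=> //; do 5 right; left.
have [fi fp] := fsP f fin.
exists [seq f a | a <- A & good (f a)]; split.
- by rewrite map_inj_uniq // filter_uniq.
- by rewrite size_map size_filter.
move=> b /mapP[a]; rewrite mem_filter => /andP[/andP[g1 g2] aA] ->.
by have [ra na] := hA a aA; have [h1 h2] := fp a ra; rewrite h1 h2 na.
Qed.
End Symmetry.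

(** * Numerical bounds *)

Section Numerics.
Implicit Types (B J K L P X Y r : nat).

Lemma bin_lower K L : K <= L -> L ^ K <= 'C(L, K) * K ^ K.
Proof.
move=> KL; suff : L ^ K * K`! <= L ^_ K * K ^ K.
  by rewrite -bin_ffact -mulnA [_`! * _]mulnC mulnA leq_pmul2r ?fact_gt0.
rewrite -ffactnn !ffact_prod.
have -> : L ^ K = \prod_(i < K) L by rewrite prod_nat_const card_ord.
have -> : K ^ K = \prod_(i < K) K by rewrite prod_nat_const card_ord.
rewrite -!big_split /=; apply: leq_prod => i _; have := ltn_ord i.
by move: KL; move: (nat_of_ord i) => t; clear; nia.
Qed.

Lemma bernoulli P : 1 < P -> 2 * P.-1 ^ P.-1 <= P ^ P.-1.
Proof.
case: P => [//|[//|P]] _; rewrite /= -[P.+2]addn1 expnDn big_ord_recl big_ord_recl /= /bump /=.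
have E : P.+1 * P.+1 ^ P = P.+1 ^ P.+1 by rewrite expnS.
by rewrite !exp1n bin0 bin1 !mul1n !muln1 subn0 subSS subn0 E mul2n -addnn addnA leq_addr.
Qed.

(** The gain P / (P - 1) of one step becomes a factor 2 over P - 1 steps, by [bernoulli]. *)
Lemma growth_bound P J X c : 1 < P -> P ^ J <= P.-1 ^ J * X ^ c -> 2 ^ J <= X ^ (c * P.-1).
Proof.
move=> P1 h; have P0 : 0 < P.-1 by case: P P1 {h} => [|[|]].
have b : (2 * P.-1 ^ P.-1) ^ J <= (P ^ P.-1) ^ J.
  by case: (J) => // j; rewrite leq_exp2r // bernoulli.
have q0 : 0 < P.-1 ^ (P.-1 * J) by rewrite expn_gt0 P0.
rewrite -(leq_pmul2r q0).
apply: (@leq_trans (P ^ (P.-1 * J))).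
  by move: b; rewrite expnMn -!expnM.
apply: (@leq_trans ((P.-1 ^ J * X ^ c) ^ P.-1)).
  by rewrite mulnC expnM leq_exp2r.
by rewrite expnMn -!expnM mulnC [J * _]mulnC.
Qed.

(* Either the diagonal or the off-diagonal term of the pair count dominates; [Y] measures how
   far the number [B] of representations is from [P ^ J]. *)
Lemma density_contradiction P J B X Y : 0 < P -> 0 < B -> P ^ J <= Y * B ->
  B ^ 2 <= P.-1 ^ J * (B + 256 * X ^ 2 * P ^ J.+2) ->
  P ^ J <= P.-1 ^ J * (Y * (1 + 256 * X ^ 2 * P ^ 2 * Y)).
Proof.
move=> P0 B0 h1 h2; rewrite -(leq_pmul2r B0).
apply: (@leq_trans (Y * B ^ 2)); first by rewrite -mulnn mulnA leq_pmul2r.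
apply: (@leq_trans (Y * (P.-1 ^ J * (B + 256 * X ^ 2 * P ^ J.+2)))); first by rewrite leq_mul2l h2 orbT.
rewrite mulnCA -[leqRHS]mulnA leq_mul2l; apply/orP; right.
rewrite -[leqRHS]mulnA leq_mul2l; apply/orP; right; rewrite mulnDl mul1n leq_add2l.
have -> : 256 * X ^ 2 * P ^ J.+2 = 256 * X ^ 2 * P ^ 2 * P ^ J.
  by have -> : P ^ J.+2 = P ^ J * P ^ 2 by [rewrite -expnD addn2]; ring.
by rewrite -[leqRHS]mulnA leq_mul2l h1 orbT.
Qed.
End Numerics.

Section GoodRepresentation.
Implicit Types (p k X g r n : nat).

(** Origin of 224: since P <= 2^P, r is below 4^P (2^J)^(2 P), at most X^(P + 14 P (P - 1)) <= X^(14
    P^2), and 16 * 14 = 224. *)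
Lemma final_bound P X r J : 1 < P -> 3 < X -> r < P ^ (2 * J.+1) -> 2 ^ J <= X ^ (7 * P.-1) ->
  r ^ 16 < X ^ (224 * P ^ 2).
Proof.
move=> P1 X3 hr hJ; have X0 : 0 < X by apply: leq_trans X3.
have h1 : P ^ (2 * J.+1) <= X ^ (14 * P ^ 2).
  apply: (@leq_trans ((2 ^ P) ^ (2 * J.+1))); first by rewrite leq_exp2r ?muln_gt0 // ltnW // ltn_expl.
  have -> : (2 ^ P) ^ (2 * J.+1) = 4 ^ P * (2 ^ J) ^ (2 * P).
    by rewrite -[4]/(2 ^ 2) -!expnM -expnD; congr (2 ^ _); ring.
  apply: (@leq_trans (X ^ P * (X ^ (7 * P.-1)) ^ (2 * P))).
    by have P0 := ltnW P1; apply: leq_mul; rewrite leq_exp2r ?muln_gt0 ?P0.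
  rewrite -expnM -expnD leq_pexp2l //.
  by move: P1; clear; case: P => // P _; rewrite /=; nia.
have {}hr := leq_trans hr h1.
apply: (@leq_trans ((X ^ (14 * P ^ 2)) ^ 16)); first by rewrite ltn_exp2r.
by rewrite -expnM; apply: eq_leq; congr (X ^ _); ring.
Qed.

(** If no such [c] existed, [count_ineq] would bound the representations by a power of [r] below
    1/2, while the split primes in [Q] provide about r^(1/2) of them up to powers of X. *)
Lemma good_rep (p k X g r : nat) (Q : seq nat) : prime p -> odd p -> 0 < k ->
  sqfree r -> r %% 8 != 7 -> ~~ (p %| r) -> (exists x, p %| x ^ 2 + r) -> (exists x, p %| x ^ 2 + 1) ->
  X ^ (224 * (p ^ k) ^ 2) <= r ^ 16 -> r <= X ^ (2 * (224 * (p ^ k) ^ 2)).+1 ->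
  (97 * p ^ k) ^ 2 <= X -> 0 < g -> (g * (224 * (p ^ k) ^ 2)) ^ (224 * (p ^ k) ^ 2) <= X ->
  (forall M, 0 < M -> M <= r ^ 2 -> size (divisors M) <= X) ->
  uniq Q -> (forall q, q \in Q -> [/\ prime q, odd q, ~~ (q %| r), exists v, q %| v ^ 2 + r & q <= X]) ->
  X <= size Q * g ->
  exists c : quat, [/\ qre c = 0%R, qnorm c = Posz r, (2 %| (qi c - Posz r)%R)%Z &
    (Posz (p ^ k) %| (Posz r - qi c ^+ 2)%R)%Z].
Proof.
move=> pp po k0 sr r7 pr [x0 hx0] [e0 he0] rX Xr X1 g0 gX hD uQ hQ XQ.
set P := p ^ k in rX Xr X1 gX *; set E := 224 * P ^ 2 in rX Xr gX.
have p2 : 2 < p by have := prime_gt1 pp; move: po; clear; case: (p) => [|[|[|]]].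
have Pp : p <= P by rewrite -{1}[p]expn1 leq_pexp2l // prime_gt0.
have P1 : 1 < P by apply: leq_trans Pp; exact: ltnW.
have P0 : 0 < P by apply: ltnW.
have P21 : 1 <= P ^ 2 by rewrite expn_gt0 P0.
have X3 : 3 < X by apply: leq_trans X1; rewrite expnMn; move: P21; move: (P ^ 2) => z; clear; lia.
have X0 : 0 < X by apply: leq_trans X3.
have r0 := sqfree_gt0 sr.
have E0 : 16 < E by rewrite /E; move: P21; move: (P ^ 2) => z; clear; lia.
have E1 : 0 < E by apply: leq_trans E0.
have rP : P ^ 2 <= r.
  rewrite leqNgt; apply/negP => h; have : r ^ 16 < X ^ 16.
    by rewrite ltn_exp2r //; apply: leq_trans h _; apply: leq_trans X1; rewrite expnMn; apply: leq_pmull.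
  by rewrite ltnNge (leq_trans _ rX) // leq_pexp2l // ltnW.
apply: NNPP => no.
have [s [t [u hs]]] := three_squares r0 sr r7.
pose a := Quat 0%R s t u.
have na : qnorm a = Posz r by rewrite hs /qnorm /=; ring.
pose l := trunc_log X r.-1; pose K := l./2; pose L := size Q.
have r1 : 1 < r by apply: leq_trans rP; rewrite -{1}(exp1n 2) ltn_exp2r.
have X1' : 1 < X by apply: leq_trans X3.
have r10 : 0 < r.-1 by rewrite -ltnS prednK.
have hl1 : X ^ l <= r.-1 by apply: trunc_logP.
have hl2 : r.-1 < X ^ l.+1 by apply: trunc_log_ltn.
have K1 : X ^ (2 * K) < r.
  rewrite -(prednK r0) ltnS; apply: leq_trans hl1; rewrite leq_pexp2l //.
  by rewrite /K mul2n -[leqRHS]odd_double_half leq_addl.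
have K2 : r <= X ^ (2 * K.+1).
  rewrite -(prednK r0); apply: leq_trans hl2 _; rewrite leq_pexp2l //.
  by rewrite /K; clear; lia.
have KE : K <= E.
  have : X ^ (2 * K) < X ^ (2 * E).+1 by apply: leq_trans K1 Xr.
  by rewrite ltn_exp2l //; clear; lia.
have EL : E <= L.
  have h : g * E <= g * L.
    rewrite mulnC -/L in XQ; apply: leq_trans XQ; apply: leq_trans gX.
    by rewrite -{1}[g * E]expn1 leq_pexp2l // muln_gt0 g0.
  by rewrite leq_pmul2l in h.
have KL := leq_trans KE EL.
pose q (i : 'I_L) := nth 0 Q i.
have qQ i : q i \in Q by apply: mem_nth.
have [A [uA hA sA]] := @rep_count a r L K X q sr (erefl _) na
   (fun i j e => val_inj (eqP (etrans (esym (nth_uniq 0 (ltn_ord i) (ltn_ord j) uQ)) (introT eqP e))))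
   (fun i => let: And5 h _ _ _ _ := hQ _ (qQ i) in h) (fun i => let: And5 _ h _ _ _ := hQ _ (qQ i) in h)
   (fun i => let: And5 _ _ h _ _ := hQ _ (qQ i) in h) (fun i => let: And5 _ _ _ h _ := hQ _ (qQ i) in h)
   (fun i => let: And5 _ _ _ _ h := hQ _ (qQ i) in h) K1.
pose J := trunc_log (P ^ 2) r.
have P2g : 1 < P ^ 2 by rewrite -{1}(exp1n 2) ltn_exp2r.
have J1 : (P ^ 2) ^ J <= r by apply: trunc_logP.
have J2 : r < (P ^ 2) ^ J.+1 by apply: trunc_log_ltn.
have J0 : 0 < J by rewrite trunc_log_gt0 P2g prednK // ltnW.
have [x hx] := hensel_sqr (k * J) pp po pr hx0.
have p1 : ~~ (p %| 1) by rewrite dvdn1; apply: contraTneq p2 => ->.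
have [e he] := hensel_sqr (k * J) pp po p1 he0.
rewrite !expnM in hx he.
have pPJ : p %| (p ^ k) ^ J by rewrite -expnM -{1}[p]expn1 dvdn_exp2l // muln_gt0 k0.
have px : ~~ (p %| x).
  apply: contra pr => h; rewrite -(dvdn_addr _ (m := x ^ 2)) ?dvdn_exp //.
  exact: dvdn_trans hx.
have pu : ~~ (Posz p %| (2 * Posz x)%R)%Z.
  rewrite dvdzE abszM /= Euclid_dvdM // negb_or px andbT.
  by rewrite dvdn_prime2 //; apply: contraTneq p2 => ->.
have [A' [uA' sA' hA']] := symmetrize (Posz e) uA hA pu.
have toZ z y w : z %| y ^ 2 + w -> (Posz z %| (Posz y ^+ 2 + Posz w)%R)%Z.
  by move=> h; rewrite expr2 -PoszM mulnn -PoszD dvdzE.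
have cnt := @count_ineq p k r J X (Posz e) (Posz x) A' pp po k0 J0 sr.
have {}cnt : size A' ^ 2 <= P.-1 ^ J * (size A' + 128 * X ^ 2 * (2 * r %/ P ^ J)).
  by apply: cnt => // c h1 h2 h3 h4; apply: no; exists c.
set B := size A' in sA' cnt.
have C0 : 0 < 'C(L, K) by rewrite bin_gt0.
have B0 : 0 < B by move: sA' C0; rewrite sA; clear; lia.
(* P^J is at most r^(1/2) <= X^(K + 1). On the other side 6 B >= C(L, K) >= (L / K)^K >= X^(K - 1),
   because L g >= X and (g K)^K <= X. *)
have PJ : P ^ J <= 6 * X ^ 2 * B.
  have h1 : P ^ J <= X ^ K.+1.
    have e1 : (P ^ J) ^ 2 = (P ^ 2) ^ J by rewrite -[LHS]expnM mulnC [LHS]expnM.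
    have e2 : (X ^ K.+1) ^ 2 = X ^ (2 * K.+1) by rewrite -[LHS]expnM mulnC.
    by rewrite -(leq_exp2r _ _ (isT : 0 < 2)) e1 e2 (leq_trans J1).
  apply: leq_trans h1 _; rewrite expnS.
  have gK : (g * K) ^ K <= X.
    apply: leq_trans gX; apply: (@leq_trans ((g * E) ^ K)).
      by case: (K) KE => // K' h; rewrite leq_exp2r // leq_mul2l h orbT.
    by rewrite leq_pexp2l // muln_gt0 g0 (leq_trans _ E0).
  have h2 : X ^ K <= 'C(L, K) * X.
    apply: (@leq_trans ((L * g) ^ K)); first by case: (K) => // K'; rewrite leq_exp2r.
    rewrite expnMn; apply: leq_trans (leq_mul (bin_lower KL) (leqnn _)) _.
    by rewrite -mulnA -expnMn leq_mul2l [K * g]mulnC gK orbT.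
  apply: leq_trans (leq_mul (leqnn X) h2) _; rewrite -sA.
  by move: sA'; rewrite -mulnn; move: (size A) => z; clear; nia.
have cnt2 : B ^ 2 <= P.-1 ^ J * (B + 256 * X ^ 2 * P ^ J.+2).
  apply: leq_trans cnt _; rewrite leq_mul2l; apply/orP; right; rewrite leq_add2l.
  have -> : 256 * X ^ 2 * P ^ J.+2 = 128 * X ^ 2 * (2 * P ^ J.+2) by ring.
  have PJ0 : 0 < P ^ J by rewrite !expn_gt0 (prime_gt0 pp).
  rewrite leq_mul2l; apply/orP; right; rewrite -ltnS ltn_divLR //.
  have e2 : (P ^ 2) ^ J.+1 = P ^ J.+2 * P ^ J by rewrite -expnM -expnD; congr (P ^ _); clear; lia.
  move: J2; rewrite e2; have := PJ0.
  by move: (P ^ J.+2) (P ^ J) => y z; clear; nia.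
have := density_contradiction P0 B0 PJ cnt2.
(* Y = 6 X^2 is the loss found above; (97 P)^2 <= X absorbs the numerical factors, since 36 * 256 +
   6 <= 97^2. *)
have W : 6 * X ^ 2 * (1 + 256 * X ^ 2 * P ^ 2 * (6 * X ^ 2)) <= X ^ 7.
  apply: (@leq_trans ((97 * P) ^ 2 * X ^ 6)); last by rewrite [X ^ 7]expnS leq_mul2r X1 orbT.
  have x1 : 1 <= X ^ 2 by rewrite expn_gt0 X0.
  have -> : X ^ 6 = X ^ 2 * X ^ 2 * X ^ 2 by rewrite -!expnD.
  have h : 6 * X ^ 2 <= 6 * X ^ 2 * (P ^ 2 * (X ^ 2 * X ^ 2)).
    by apply: leq_pmulr; apply: (leq_mul P21 (leq_mul x1 x1)).
  rewrite expnMn; move: h; move: (X ^ 2) (P ^ 2) => y z; clear => h.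
  have -> : 6 * y * (1 + 256 * y * z * (6 * y)) = 6 * y + 36 * 256 * (z * (y * y * y)) by ring.
  have -> : 97 ^ 2 * z * (y * y * y) = 193 * (z * (y * y * y)) + 36 * 256 * (z * (y * y * y)) by ring.
  rewrite leq_add2r; apply: leq_trans h _.
  have -> : 6 * y * (z * (y * y)) = 6 * (z * (y * y * y)) by ring.
  by rewrite leq_mul2r orbT.
move=> h; have {h W} h : P ^ J <= P.-1 ^ J * X ^ 7.
  by apply: leq_trans h _; rewrite leq_mul2l W orbT.
have := growth_bound P1 h; rewrite -expnM in J2; move/(final_bound P1 X3 J2).
by rewrite ltnNge rX.
Qed.
End GoodRepresentation.

(** * The main theorem *)

Section Preparation.
Implicit Types (a b c d e j k m n p r v X C D P T : nat).

(** An odd prime factor leaves a cofactor at most 2. Otherwise the sum is a power of 2, and coprime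
    [a], [b] exclude 4. *)
Lemma cyclic_sum_squares a b : 0 < a -> 0 < b -> coprime a b ->
  cyclic (units_Zp (a ^ 2 + b ^ 2)) -> a ^ 2 + b ^ 2 = 2 \/
  exists p k e, [/\ prime p, odd p, 0 < k, e \in [:: 1; 2] & a ^ 2 + b ^ 2 = p ^ k * e].
Proof.
move=> a0 b0 co cy; set d := a ^ 2 + b ^ 2 in cy *.
have d0 : 0 < d by rewrite addn_gt0 expn_gt0 a0.
have main p : prime p -> odd p -> p %| d -> exists p k e, [/\ prime p, odd p, 0 < k, e \in [:: 1; 2] & d = p ^ k * e].
  move=> pp po pd; have [e ce ed] := pfactor_coprime pp d0.
  have k0 : 0 < logn p d by rewrite logn_gt0 mem_primes pp d0.
  have e0 : 0 < e by move: d0; rewrite {1}ed muln_gt0 => /andP[].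
  exists p, (logn p d), e; split=> //; last by rewrite mulnC.
  have : e <= 2.
    apply: (cyclic_units_prime_pow cy pp po k0) => //; last by rewrite mulnC.
    by rewrite coprimeXl.
  by case: (e) e0 => [|[|[|]]].
have [e ce ed] := pfactor_coprime (isT : prime 2) d0; rewrite coprime2n in ce.
have [e1|e1] := eqVneq e 1; last first.
  right; have pe : prime (pdiv e) by apply: pdiv_prime; case: (e) ce e1 => [|[|]].
  apply: (main (pdiv e) pe); first exact: dvdn_odd (pdiv_dvd e) ce.
  by rewrite ed; apply: dvdn_mulr; exact: pdiv_dvd.
left; move: ed; rewrite e1 mul1n; case: (logn 2 d) => [|[|i]] ed //.
  by move: ed; rewrite /d expn0; move: a0 b0; clear; rewrite -!mulnn; nia.
have d4 : d %% 4 = 0 by rewrite ed !expnS mulnA modnMr.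
have nn : ~~ (~~ odd a && ~~ odd b).
  apply/negP => /andP[ea eb]; have : 2 %| gcdn a b by rewrite dvdn_gcd !dvdn2 ea.
  by rewrite (eqP co).
have sq x : x ^ 2 %% 4 = odd x.
  rewrite -{1}(odd_double_half x) -mul2n; case: (odd x).
    by rewrite (_ : (true + 2 * x./2) ^ 2 = (x./2 + x./2 ^ 2) * 4 + 1) ?modnMDl //; rewrite /=; ring.
  by rewrite (_ : (false + 2 * x./2) ^ 2 = x./2 ^ 2 * 4) ?modnMl //; rewrite /=; ring.
by move: d4 nn; rewrite /d -modnDm !sq; case: (odd a); case: (odd b).
Qed.

(** With y = 16 d - 1, D is at most ((y + 2) v)^4 and m at least y v, and (1 + 2 / y)^4 <= 1 + 1 / d
    as soon as y >= 10 d and y >= 15. The conclusion keeps |T| small enough for x and y to be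
    natural numbers. *)
Lemma window d D v m : 0 < d -> D < ((16 * d) * v.+1) ^ 4 -> 16 * d <= v ->
  (16 * d).-1 * v <= m -> d * (D - m ^ 4) <= m ^ 4.
Proof.
move=> d0 hD hv hm; rewrite mulnBr leq_subLR -mulSnr.
set y := (16 * d).-1 in hm.
have ey : 16 * d = y.+1 by rewrite /y prednK // muln_gt0.
have y10 : 10 * d <= y by rewrite /y; move: d0; clear; lia.
have y15 : 15 <= y by rewrite /y; move: d0; clear; lia.
clearbody y; have hD2 : D <= (y.+2 * v) ^ 4.
  apply: ltnW; apply: leq_trans hD _; rewrite leq_exp2r // ey; move: hv; rewrite ey.
  by clear; nia.
have poly : d * y.+2 ^ 4 <= d.+1 * y ^ 4.
  have -> : y.+2 ^ 4 = y ^ 4 + (8 * y ^ 3 + 24 * y ^ 2 + 32 * y + 16) by rewrite -addn2; ring.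
  rewrite mulnDr mulSn addnC leq_add2r.
  have : 8 * y ^ 3 + 24 * y ^ 2 + 32 * y + 16 <= 10 * y ^ 3.
    have -> : y ^ 3 = y ^ 2 * y by rewrite expnSr.
    have h1 : 15 * y <= y ^ 2 by rewrite -mulnn leq_mul2r y15 orbT.
    have h2 : 15 * y ^ 2 <= y ^ 2 * y by rewrite mulnC leq_mul2l y15 orbT.
    by move: y15 h1 h2; move: (y ^ 2) => z; move: (z * y) => w; clear; lia.
  move=> h; apply: leq_trans (_ : d * (10 * y ^ 3) <= _); first by rewrite leq_mul2l h orbT.
  have -> : d * (10 * y ^ 3) = (10 * d) * y ^ 3 by ring.
  by rewrite [y ^ 4]expnS leq_mul2r y10 orbT.
apply: (@leq_trans (d * (y.+2 * v) ^ 4)); first by rewrite leq_mul2l hD2 orbT.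
apply: (@leq_trans (d.+1 * (y * v) ^ 4)); last by rewrite leq_mul2l leq_exp2r // hm orbT.
have e1 : d * (y.+2 * v) ^ 4 = d * y.+2 ^ 4 * v ^ 4 by rewrite expnMn mulnA.
have e2 : d.+1 * (y * v) ^ 4 = d.+1 * y ^ 4 * v ^ 4 by rewrite expnMn mulnA.
by rewrite e1 e2; apply: leq_mul.
Qed.

(** With D = 16^j D' and m = 2^j m', the residue of D' - m'^4 modulo 16 is D' or D' - 1 according to
    the parity of m'. Odd m' is taken for D' = 4 or 7 modulo 8, which avoids 0, 4, 7, 12, 15. The
    modulus depends on [j], bounded through the power of 2 in [D]. *)
Lemma residue_class D p : 0 < D -> odd p -> exists j s rho, [/\ s = 2 ^ j.+1 * p, 4 * j <= logn 2 D &
  forall m c r, m = rho %[mod s] -> D = m ^ 4 + c ^ 2 * r -> m ^ 4 < D -> 0 < c ->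
    m = 1 %[mod p] /\ r %% 8 != 7].
Proof.
move=> D0 po; pose j := logn 2 D %/ 4; pose D' := D %/ 16 ^ j.
have e16 : 16 ^ j = 2 ^ (4 * j) by rewrite -[16]/(2 ^ 4) -expnM.
have j4 : 4 * j <= logn 2 D by rewrite mulnC leq_divM.
have eD : D = 16 ^ j * D' by rewrite mulnC divnK // e16 pfactor_dvdn.
have nD : D' %% 16 != 0.
  apply/negP => /dvdnP[z ez]; have : 2 ^ (4 * j.+1) %| D.
    by rewrite mulnS addnC expnD -e16 eD ez -[2 ^ 4]/16 dvdn_pmul2l ?expn_gt0 // dvdn_mull.
  by rewrite pfactor_dvdn // leqNgt mulnC ltn_ceil.
pose b := (D' %% 8 == 7) || (D' %% 8 == 4).
pose s := 2 ^ j.+1 * p; pose rho := chinese (2 ^ j.+1) p (b * 2 ^ j) 1.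
have co : coprime (2 ^ j.+1) p by rewrite coprimeXl // coprime2n.
exists j, s, rho; split=> // m c r hm eDm lt c0.
have hmd q : q %| s -> m = rho %[mod q] by move=> h; rewrite -(modn_dvdm m h) hm modn_dvdm.
have m1 : m = 1 %[mod p] by rewrite hmd ?dvdn_mull // chinese_modr.
split=> //; have m2 : m = b * 2 ^ j %[mod 2 ^ j.+1] by rewrite hmd ?dvdn_mulr // chinese_modl.
have [m' [em ob]] : exists m', m = m' * 2 ^ j /\ odd m' = b.
  have : 2 ^ j %| m.
    rewrite /dvdn -(modn_dvdm _ (_ : 2 ^ j %| 2 ^ j.+1)) ?m2; last by rewrite expnS dvdn_mull.
    by rewrite modn_dvdm ?modnMl // expnS dvdn_mull.
  case/dvdnP=> m' em; exists m'; split=> //; move/eqP: m2; rewrite em expnS -!muln_modl eqn_pmul2r ?expn_gt0 //.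
  by rewrite modn2 => /eqP; case: (b); case: (odd m').
have e4 : m ^ 4 = 16 ^ j * m' ^ 4 by rewrite em expnMn e16 -expnM [j * 4]mulnC mulnC.
have lt' : m' ^ 4 < D' by move: lt; rewrite e4 eD ltn_pmul2l // expn_gt0.
have e0 : 0 < D' - m' ^ 4 by rewrite subn_gt0.
apply: (sqr_factor_mod8 (j := j) (e := D' - m' ^ 4) (c := c)) => //.
  by rewrite mulnBr -e4 -eD {1}eDm addnC addnK.
have : D' %% 16 = ((D' - m' ^ 4) %% 16 + (m' ^ 4) %% 16) %% 16 by rewrite modnDm subnK // ltnW.
have -> : m' ^ 4 %% 16 = odd m'.
  have {1}-> : m' = odd m' + 2 * m'./2 by rewrite mul2n odd_double_half.
  have p2 u : exists v, u ^ 2 + u = 2 * v.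
    exists (u * u.+1)./2; have := odd_double_half (u * u.+1); rewrite oddM /= andbN add0n -mul2n => ->.
    by rewrite mulnS -mulnn addnC.
  have [w ew] := p2 m'./2; case: (odd m').
    have -> : (true + 2 * m'./2) ^ 4 = (4 * w * w + w) * 16 + 1.
      have -> : (true + 2 * m'./2) ^ 4 = (4 * (m'./2 ^ 2 + m'./2) + 1) ^ 2 by rewrite /=; ring.
      by rewrite ew; ring.
    by rewrite modnMDl.
  have -> : (false + 2 * m'./2) ^ 4 = m'./2 ^ 4 * 16 by rewrite /=; ring.
  by rewrite modnMl.
rewrite ob /b; have : D' %% 16 < 16 by rewrite ltn_pmod.
have : (D' - m' ^ 4) %% 16 < 16 by rewrite ltn_pmod.
have -> : D' %% 8 = D' %% 16 %% 8 by rewrite modn_dvdm.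
move: nD; move: (D' %% 16) ((D' - m' ^ 4) %% 16) => x y x0 hy hx; rewrite !inE.
by do 16?[case: x x0 hx => [//|x] x0 hx]; do 16?[case: y hy => [|y] hy].
Qed.

Lemma log_growth c k : 0 < k -> exists X0, forall X, X0 <= X -> (c * (trunc_log 2 X).+1) ^ k <= X.
Proof.
move=> k0; pose B := (2 * k)`! * 2 ^ (2 * k); exists (c ^ (2 * k) * B + 1) => X hX.
have X0 : 0 < X by apply: leq_trans hX; rewrite addn1.
rewrite -(leq_exp2r _ _ (isT : 0 < 2)) -expnM [k * 2]mulnC expnMn.
apply: (@leq_trans (c ^ (2 * k) * (B * 2 ^ trunc_log 2 X))).
  by rewrite leq_mul2l succ_exp_le orbT.
apply: (@leq_trans (c ^ (2 * k) * (B * X))).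
  by rewrite !leq_mul2l trunc_logP ?orbT.
by rewrite mulnA -mulnn leq_mul2r (leq_trans _ hX) ?orbT // leq_addr.
Qed.
End Preparation.

Section Finish.
Local Open Scope ring_scope.

(** The hypothesis on products x y states what [P] must provide: it holds for a power of [p] and
    also for P = 1, so that d = 2 is covered too. It selects the sign T' of c t. *)
Lemma finish (a b n m c r P e : nat) (t Z W : int) : (0 < a)%N -> (0 < b)%N -> coprime a b ->
  (a ^ 2 + b ^ 2 = P * e)%N -> odd P -> (e \in [:: 1; 2])%N ->
  (forall x y : int, (P%:Z %| x * y)%Z -> x + y = 2 * (a * m ^ 2)%N%:Z -> (P%:Z %| x)%Z \/ (P%:Z %| y)%Z) ->
  ((P * e) * n = m ^ 4 + c ^ 2 * r)%N -> r%:Z = t ^+ 2 + Z ^+ 2 + W ^+ 2 ->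
  (2 %| t - r%:Z)%Z -> (P%:Z %| r%:Z - t ^+ 2)%Z ->
  ((a ^ 2 + b ^ 2) * (c ^ 2 * r) <= m ^ 4)%N ->
  exists x y z w : nat, (x ^ 2 + y ^ 2 + z ^ 2 + w ^ 2 = n /\ a * x + b * y = m ^ 2)%N.
Proof.
move=> a0 b0 co ed oP he hs eD er t2 tP hm.
pose s := (m ^ 2)%N; pose T := c%:Z * t.
have eds : (P * e)%N%:Z = a%:Z ^+ 2 + b%:Z ^+ 2 by rewrite -ed PoszD -!mulnn !PoszM !expr2.
have eS : (P * e)%N%:Z * n%:Z = s%:Z ^+ 2 + c%:Z ^+ 2 * r%:Z.
  have s4 : (m ^ 4 = s ^ 2)%N by rewrite /s -expnM.
  by rewrite -PoszM eD s4 PoszD PoszM -!mulnn !PoszM !expr2.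
have dT : ((P * e)%N%:Z %| c%:Z ^+ 2 * r%:Z - T ^+ 2)%Z.
  have -> : c%:Z ^+ 2 * r%:Z - T ^+ 2 = c%:Z ^+ 2 * (r%:Z - t ^+ 2) by rewrite /T; ring.
  apply: dvdz_mull; rewrite PoszM Gauss_dvdz; last first.
    by rewrite coprimezE /=; move: he; rewrite !inE => /orP[] /eqP ->; rewrite ?coprimen1 ?coprimen2.
  rewrite tP /=; move: he; rewrite !inE => /orP[] /eqP ->; first exact: dvd1z.
  case/dvdzP: t2 => v ev; have -> : t = v * 2 + r%:Z by rewrite -ev; ring.
  have [w ew] : exists w, r%:Z - r%:Z ^+ 2 = 2 * w.
    exists (- (r * r.-1)./2%:Z); case: (r) => [|r']; first by rewrite expr0n.
    have := odd_double_half (r'.+1 * r'); rewrite oddM /= andNb add0n -mul2n => E.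
    have E2 : 2 * ((r'.+1 * r')./2)%:Z = r'.+1%:Z * r'%:Z by (have -> : (2 : int) = Posz 2 by []); rewrite -!PoszM E.
    by rewrite mulrN /= E2 intS; ring.
  have -> : r%:Z - (v * 2 + r%:Z) ^+ 2 = 2 * (w - 2 * v ^+ 2 - 2 * v * r%:Z).
    have -> : 2 * (w - 2 * v ^+ 2 - 2 * v * r%:Z) = 2 * w - 4 * v ^+ 2 - 4 * v * r%:Z by ring.
    by rewrite -ew; ring.
  exact: dvdz_mulr.
have dprod : ((P * e)%N%:Z %| (a%:Z * s%:Z + b%:Z * T) * (a%:Z * s%:Z + b%:Z * - T))%Z.
  have -> : (a%:Z * s%:Z + b%:Z * T) * (a%:Z * s%:Z + b%:Z * - T) =
    (P * e)%N%:Z * (a%:Z ^+ 2 * n%:Z - T ^+ 2) - a%:Z ^+ 2 * (c%:Z ^+ 2 * r%:Z - T ^+ 2).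
    have -> : (P * e)%N%:Z * (a%:Z ^+ 2 * n%:Z - T ^+ 2) = a%:Z ^+ 2 * ((P * e)%N%:Z * n%:Z) - (P * e)%N%:Z * T ^+ 2 by ring.
    by rewrite eS eds; ring.
  by apply: rpredB; [exact: dvdz_mulr (dvdzz _) | exact: dvdz_mull].
(* For e = 2: the two factors have an even sum, so an even product makes both even. *)
have both x y : x + y = 2 * (a%:Z * s%:Z) -> ((P * e)%N%:Z %| x * y)%Z -> (P%:Z %| x)%Z -> ((P * e)%N%:Z %| x)%Z.
  move=> exy; rewrite PoszM => h hx; rewrite Gauss_dvdz; last first.
    by rewrite coprimezE /=; move: he; rewrite !inE => /orP[] /eqP ->; rewrite ?coprimen1 ?coprimen2.
  rewrite hx /=; have {h} h : (e%:Z %| x * y)%Z by apply: dvdz_trans h; exact: dvdz_mull (dvdzz _).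
  move: he h; rewrite !inE => /orP[] /eqP ->; first by move=> _; exact: dvd1z.
  have -> : y = 2 * (a%:Z * s%:Z) - x by rewrite -exy; ring.
  move=> h; have : (2 %| x * x)%Z.
    have -> : x * x = 2 * (a%:Z * s%:Z * x) - x * (2 * (a%:Z * s%:Z) - x) by ring.
    by apply: rpredB => //; exact: dvdz_mulr (dvdzz _).
  by rewrite !dvdzE abszM Euclid_dvdM // orbb.
have [T' [eT' dv]] : exists T', T' ^+ 2 = T ^+ 2 /\ ((P * e)%N%:Z %| a%:Z * s%:Z + b%:Z * T')%Z.
  have sm : (a%:Z * s%:Z + b%:Z * T) + (a%:Z * s%:Z + b%:Z * - T) = 2 * (a%:Z * s%:Z) by ring.
  have dP : (P%:Z %| (a%:Z * s%:Z + b%:Z * T) * (a%:Z * s%:Z + b%:Z * - T))%Z.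
    by apply: dvdz_trans dprod; rewrite PoszM; exact: dvdz_mulr (dvdzz _).
  have sm2 : (a%:Z * s%:Z + b%:Z * T) + (a%:Z * s%:Z + b%:Z * - T) = 2 * (a * m ^ 2)%N%:Z by rewrite sm PoszM.
  case: (hs _ _ dP sm2).
    by move=> h; exists T; split=> //; exact: both sm dprod h.
  move=> h; exists (- T); rewrite sqrrN; split=> //.
  by apply: (both _ (a%:Z * s%:Z + b%:Z * T) _ _ h); [rewrite addrC sm | rewrite mulrC].
have R2 : `|T'| ^+ 2 = c%:Z ^+ 2 * t ^+ 2 by rewrite real_normK ?num_real // eT' /T; ring.
have tr : c%:Z ^+ 2 * t ^+ 2 <= (c ^ 2 * r)%N%:Z.
  rewrite PoszM -mulnn PoszM -expr2 er ler_wpM2l ?sqr_ge0 //.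
  by have := sqr_ge0 Z; have := sqr_ge0 W; lra.
have pos u v : (0 < v)%N -> (u ^ 2 <= a ^ 2 + b ^ 2)%N -> u%:Z * `|T'| <= v%:Z * s%:Z.
  move=> v0 hu; rewrite -(@ler_pXn2r _ 2) ?nnegrE ?mulr_ge0 // !exprMn R2.
  apply: (@le_trans _ _ ((u ^ 2)%N%:Z * (c ^ 2 * r)%N%:Z)).
    by rewrite -(mulnn u) PoszM -expr2 ler_wpM2l ?sqr_ge0.
  rewrite -PoszM; apply: (@le_trans _ _ (m ^ 4)%N%:Z).
    by rewrite lez_nat; apply: leq_trans hm; rewrite leq_mul2r hu orbT.
  have -> : s%:Z ^+ 2 = (m ^ 4)%N%:Z by rewrite expr2 -PoszM mulnn /s -expnM.
  have v1 : 1 <= v%:Z by rewrite lez_nat.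
  rewrite ler_peMl // expr2; have := mulr_ge0 (ltW (lt_le_trans ltr01 v1)) (ltW (lt_le_trans ltr01 v1)).
  by rewrite -{1}[1]mulr1 ler_pM.
apply: (@assemble a b n s T' (c%:Z * Z) (c%:Z * W)) => //.
- by rewrite ed PoszM eS er eT' /T; ring.
- by rewrite ed.
- by apply: pos => //; rewrite leq_addr.
by apply: pos => //; rewrite leq_addl.
Qed.
End Finish.

Lemma progression_start lo s rho : 0 < s -> exists m0, lo <= m0 < lo + s /\ m0 = rho %[mod s].
Proof.
move=> s0; exists (lo + (rho + lo * s.-1) %% s); split.
  by rewrite leq_addr ltn_add2l ltn_pmod.
rewrite modnDmr addnCA -mulnS prednK // addnC mulnC; apply/eqP.
by rewrite mulnC modnMDl.
Qed.

Lemma sum_squares_gt0 a b : 0 < a -> 0 < a ^ 2 + b ^ 2.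
Proof. by move=> a0; rewrite addn_gt0 expn_gt0 a0. Qed.

Section MainTheorem.
Implicit Types (a b n m c d r p k e X C D v s : nat).

(** For d = 2 the only condition on the representation is a parity, which any representation meets
    after permuting coordinates; hence no walk, and P = 1, e = 2. *)
Lemma conclusion_two a b C : 0 < a -> 0 < b -> coprime a b -> a ^ 2 + b ^ 2 = 2 ->
  exists N, forall n, N <= n -> logn 2 n <= C ->
    exists x y z w m, x ^ 2 + y ^ 2 + z ^ 2 + w ^ 2 = n /\ a * x + b * y = m ^ 2.
Proof.
move=> a0 b0 co d2; have [sm esm] : exists sm, sm = 2 ^ (2 + C).+1 by eexists.
have [T eT] : exists T, T = 16 * (a ^ 2 + b ^ 2) by eexists.
have T0 : 0 < T by rewrite eT muln_gt0 sum_squares_gt0.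
exists ((T * (sm + T)) ^ 4 + 1) => n hn hC.
have n0 : 0 < n by apply: leq_trans hn; rewrite addn1.
have [D eDn] : exists D, D = 2 * n by eexists.
have D0 : 0 < D by rewrite eDn muln_gt0.
have T4 : 0 < T ^ 4 by rewrite expn_gt0 T0.
have [v /andP[v1 v2]] := @root_exists 4 (D %/ T ^ 4) isT.
have hv1 : (T * v) ^ 4 <= D by rewrite expnMn mulnC -leq_divRL.
have hv2 : D < (T * v.+1) ^ 4 by rewrite expnMn mulnC -ltn_divLR.
have hv : sm + T <= v.
  rewrite -ltnS -(ltn_pmul2l T0) -(@ltn_exp2r _ _ 4) //.
  apply: leq_ltn_trans hv2; apply: (@leq_trans n); first by apply: leq_trans hn; rewrite leq_addr.
  by rewrite eDn mul2n -addnn leq_addr.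
have [j [s [rho [es j4 hrho]]]] := residue_class D0 (isT : odd 1).
have ssm : s <= sm.
  rewrite es esm muln1 leq_pexp2l // ltnS.
  have : logn 2 D = (1 + logn 2 n)%N by rewrite eDn lognM.
  by move: j4 hC; clear; lia.
have s0 : 0 < s by rewrite es muln1 expn_gt0.
have [m [/andP[m1 m2] mrho]] := progression_start (T.-1 * v) rho s0.
have mv : m < T * v.
  apply: leq_trans m2 _; rewrite -[X in _ <= X * _](@prednK T) // mulSn addnC leq_add2r.
  by apply: leq_trans ssm _; apply: leq_trans hv; rewrite leq_addr.
have lt : m ^ 4 < D by apply: leq_trans hv1; rewrite ltn_exp2r.
have lt' : 0 < D - m ^ 4 by rewrite subn_gt0.
have [c [r [ecr c0 sr]]] := sqfree_decomp lt'.
have eD : D = m ^ 4 + c ^ 2 * r by rewrite -ecr subnKC // ltnW.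
have [_ r7] := hrho m c r mrho eD lt c0.
have r0 := sqfree_gt0 sr.
have [t [Z [W hs]]] := three_squares r0 sr r7.
have hA (q : quat) : q \in [:: Quat 0%R t Z W] -> qre q = 0%R /\ qnorm q = Posz r.
  by rewrite inE => /eqP ->; rewrite hs /qnorm /=; split=> //; ring.
(* Placeholder values that fulfil the divisibility condition of [symmetrize]; the parity of the
   first coordinate is what is wanted. *)
have u3 : ~~ (Posz 3 %| (2 * 1)%R)%Z by [].
have [A' [_ sA' hA']] := @symmetrize [:: Quat 0%R t Z W] r 3 1%R 0%R isT hA u3.
case: A' sA' hA' => [//|q A'] _ /(_ q (mem_head _ _))[q0 nq q2 _].
have [] := @finish a b n m c r 1 2 (qi q) (qj q) (qk q) a0 b0 co; rewrite ?mul1n -?eDn //.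
- by move=> x y _ _; left; exact: dvd1z.
- by rewrite -nq /qnorm q0; ring.
- rewrite -ecr; apply: window; rewrite -?eT; [exact: sum_squares_gt0|exact: hv2| |exact: m1].
  by apply: leq_trans hv; rewrite leq_addl.
by move=> x [y [z [w h]]]; exists x, y, z, w, m.
Qed.

Lemma conclusion_prime_power a b C p k e : 0 < a -> 0 < b -> coprime a b -> prime p -> odd p ->
  0 < k -> e \in [:: 1; 2] -> a ^ 2 + b ^ 2 = p ^ k * e ->
  exists N, forall n, N <= n -> logn 2 n <= C ->
    exists x y z w m, x ^ 2 + y ^ 2 + z ^ 2 + w ^ 2 = n /\ a * x + b * y = m ^ 2.
Proof.
move=> a0 b0 co pp po k0 he ed; pose d := a ^ 2 + b ^ 2; pose P := p ^ k.
have d0 : 0 < d := sum_squares_gt0 b a0.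
have [E eE] : exists E, E = 224 * P ^ 2 by eexists.
have [T eT] : exists T, T = 16 * d by eexists.
have [sm esm] : exists sm, sm = 2 ^ (d + C).+1 * p by eexists.
have P0 : 0 < P by rewrite expn_gt0 prime_gt0.
have E27 : 26 <= E.
  have : 0 < P ^ 2 by rewrite expn_gt0 P0.
  by rewrite eE; move: (P ^ 2) => z; clear; lia.
have E0 : 0 < E by apply: leq_trans E27.
(* The primes split by the chosen m satisfy X <= 679 l |Q'|, from X / 2 - 1/2 <= l (16 |Q'| + 323)
   <= 339 l |Q'|. So [g] is 679 l. *)
have [g1 hg1] := log_growth (679 * E) E0.
(* X >= 1000 l ensures that primes remain after 323 of them are discarded. *)
have [g2 hg2] := log_growth 1000 (isT : 0 < 1).
(* D^2 is at most X^(4 E + 2), and one more X absorbs the constant, so numbers up to D^2 have at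
   most X divisors. *)
have [cst [cst0 hcst]] := divisor_bound (4 * E + 3).
have [X0 eX0] : exists X0, X0 = (97 * P) ^ 2 + g1 + g2 + d + cst + (264 * T * sm) ^ 8 + 2 by eexists.
exists (X0 ^ E) => n hn hC.
have [X /andP[X1 X2]] := @root_exists E n E0.
have hX : X0 <= X.
  rewrite leqNgt; apply/negP => h; move: X2; rewrite ltnNge => /negP; apply.
  by apply: leq_trans hn; rewrite leq_exp2r.
have [b1 b2 b3] : [/\ (97 * P) ^ 2 <= X, g1 <= X & g2 <= X].
  by move: hX; rewrite eX0; move: ((97 * P) ^ 2) ((264 * T * sm) ^ 8) => u w; clear; split; lia.
have [b4 b5 b6 b7] : [/\ d <= X, cst <= X, (264 * T * sm) ^ 8 <= X & 2 <= X].
  by move: hX; rewrite eX0; move: ((97 * P) ^ 2) ((264 * T * sm) ^ 8) => u w; clear; split; lia.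
have {hg1} hg1 := hg1 X b2; have {hg2} := hg2 X b3; rewrite expn1 => hg2.
set l := (trunc_log 2 X).+1 in hg1 hg2.
have Xp : 0 < X by apply: ltnW.
have n0 : 0 < n by apply: leq_trans X1; rewrite expn_gt0 Xp.
have [D eDn] : exists D, D = d * n by eexists.
have D0 : 0 < D by rewrite eDn muln_gt0 d0.
have DX : D <= X ^ (2 * E).+1.
  rewrite eDn expnS; apply: leq_mul => //; apply: ltnW; apply: leq_trans X2 _.
  rewrite expnM leq_exp2r // -mulnn; move: b7; clear; nia.
have divX M : 0 < M -> M <= D ^ 2 -> size (divisors M) <= X.
  move=> M0 MD; rewrite -(@leq_exp2r _ _ (4 * E + 3)) ?addn_gt0 ?orbT //.
  apply: leq_trans (hcst M M0) _.
  apply: (@leq_trans (X * (X ^ (2 * E).+1) ^ 2)).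
    apply: leq_mul => //; apply: leq_trans MD _; by rewrite leq_exp2r.
  by rewrite -expnM -expnS; apply: eq_leq; congr (X ^ _); clear; lia.
have [j [s [rho [es j4 hrho]]]] := residue_class D0 po.
have ssm : s <= sm.
  rewrite es esm leq_mul2r leq_pexp2l ?orbT // ltnS.
  have : logn 2 D = (logn 2 d + logn 2 n)%N by rewrite eDn lognM.
  have : logn 2 d < d by rewrite -(ltn_exp2l _ _ (isT : 1 < 2)) (leq_ltn_trans _ (ltn_expl d _)) // dvdn_leq // pfactor_dvdnn.
  by move: j4 hC; clear; lia.
have s0 : 0 < s by rewrite es muln_gt0 expn_gt0 (prime_gt0 pp).
have T0 : 0 < T by rewrite eT muln_gt0.
have T4 : 0 < T ^ 4 by rewrite expn_gt0 T0.
have [v /andP[v1 v2]] := @root_exists 4 (D %/ T ^ 4) isT.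
have hv1 : (T * v) ^ 4 <= D by rewrite expnMn mulnC -leq_divRL.
have hv2 : D < (T * v.+1) ^ 4 by rewrite expnMn mulnC -ltn_divLR.
have [ro /andP[ro1 ro2]] := @root_exists 16 n isT.
have ro0 : 0 < ro.
  by rewrite lt0n; apply/eqP => r0; move: ro2; rewrite r0 exp1n ltnNge n0.
(* The first summand is the bound of [choose_m] with rho = ro + 1 and tau = X; the second lets every
   prime up to X fit into the range, the third gives T <= v for [window]. *)
pose S := 64 * ro.+1 ^ 2 * X ^ 2 + X + T.
(* Otherwise n^(1/4) would be at most about n^(1/8) X^2 up to constants; eighth powers give n^2 < n
   X^26, against n >= X^E and E >= 26. *)
have vS : s * S.+2 <= v.
  rewrite leqNgt; apply/negP => h.
  have S2 : S.+2 < 66 * 4 * (T * ro ^ 2 * X ^ 2).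
    have h1 : ro.+1 ^ 2 <= 4 * ro ^ 2 by rewrite -!mulnn; move: ro0; clear; nia.
    have t1 : ro.+1 ^ 2 * X ^ 2 <= 4 * ro ^ 2 * X ^ 2 by rewrite leq_mul2r h1 orbT.
    have x1 : X <= X ^ 2 by rewrite -mulnn leq_pmulr.
    have y1 : 0 < ro ^ 2 by rewrite expn_gt0 ro0.
    have z1 : X <= ro ^ 2 * X ^ 2 by apply: leq_trans x1 _; rewrite leq_pmull.
    have w1 : ro ^ 2 * X ^ 2 <= T * (ro ^ 2 * X ^ 2) by rewrite leq_pmull.
    have w2 : T <= T * (ro ^ 2 * X ^ 2) by rewrite leq_pmulr // muln_gt0 y1 expn_gt0 Xp.
    rewrite /S -mulnA -[T * _ * _]mulnA; move: t1 z1 w1 w2 b7; rewrite -mulnA.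
    move: (ro.+1 ^ 2 * X ^ 2) (ro ^ 2 * X ^ 2) => u w; move: (T * w) => z; clear; lia.
  have Tv : T * v.+1 <= T * (sm * S.+2).
    by rewrite leq_mul2l (leq_trans h) ?orbT // leq_mul2r ssm orbT.
  have TW : T * v.+1 <= 264 * T * sm * (T * ro ^ 2 * X ^ 2).
    apply: leq_trans Tv _; have -> : 264 * T * sm * (T * ro ^ 2 * X ^ 2) = T * (sm * (66 * 4 * (T * ro ^ 2 * X ^ 2))) by ring.
    by rewrite !leq_mul2l (ltnW S2) !orbT.
  have nW : n < (264 * T * sm * (T * ro ^ 2 * X ^ 2)) ^ 4.
    apply: leq_trans (_ : (T * v.+1) ^ 4 <= _); last by rewrite leq_exp2r.
    by apply: leq_ltn_trans hv2; rewrite eDn leq_pmull.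
  have : n ^ 2 < n * X ^ 26.
    apply: (@leq_trans (((264 * T * sm * (T * ro ^ 2 * X ^ 2)) ^ 4) ^ 2)); first by rewrite ltn_exp2r.
    have -> : ((264 * T * sm * (T * ro ^ 2 * X ^ 2)) ^ 4) ^ 2 = ro ^ 16 * ((264 * T * sm) ^ 8 * T ^ 8 * X ^ 16).
      by move: (264 * T * sm) => u; ring.
    apply: leq_mul => //; have -> : X ^ 26 = X * X ^ 9 * X ^ 16 by rewrite -expnS -expnD.
    rewrite leq_mul2r; apply/orP; right; apply: leq_mul => //.
    apply: leq_trans (_ : X <= _); last by rewrite -{1}[X]expn1 leq_pexp2l.
    by apply: leq_trans b6; rewrite leq_exp2r // mulnAC leq_pmull // muln_gt0 esm muln_gt0 expn_gt0 (prime_gt0 pp).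
  by rewrite -mulnn ltn_pmul2l // ltnNge (leq_trans _ X1) // leq_pexp2l.
pose H := S.+1.
have [m0 [/andP[m1 m2] mrho]] := progression_start (T.-1 * v) rho s0.
have vpos : 0 < v by apply: leq_trans vS; rewrite muln_gt0 s0.
have m00 : 0 < m0.
  apply: leq_trans m1; rewrite muln_gt0 vpos andbT eT; move: d0; clear; lia.
have mlt i : i < H -> m0 + s * i < T * v.
  move=> iH; apply: (@leq_trans (T.-1 * v + v)); last by rewrite addnC -mulSn prednK.
  apply: (@leq_trans (T.-1 * v + s + s * i)); first by rewrite ltn_add2r.
  rewrite -addnA leq_add2l -mulnS; apply: leq_trans vS; rewrite leq_mul2l; apply/orP; right.
  by apply: leq_trans iH _; rewrite /H.
have hD i : i < H -> (m0 + s * i) ^ 4 < D.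
  by move=> iH; apply: leq_trans hv1; rewrite ltn_exp2r ?mlt.
pose Q := [seq q <- primes_upto X | (321 < q) && (q != p)].
have uQ : uniq Q by rewrite !filter_uniq ?iota_uniq.
have QP q : q \in Q -> [/\ prime q, 321 < q, q != p & q <= X].
  by rewrite !mem_filter mem_iota add0n ltnS => /andP[/andP[h1 h2] /andP[h3 h4]].
have hQ q : q \in Q -> [/\ prime q, 321 < q, ~~ (q %| s) & q <= H].
  case/QP=> pq q1 qp qX; split=> //.
    rewrite es Euclid_dvdM // Euclid_dvdX // andbT negb_or !dvdn_prime2 // qp andbT.
    by apply: contraTneq q1 => ->.
  by apply: leq_trans qX _; rewrite /H /S -addnA addnCA ltnW // ltnS leq_addr.
have sQ : size (primes_upto X) <= size Q + 323.
  rewrite -(count_predC (fun q => (321 < q) && (q != p))) -size_filter leq_add2l -size_filter.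
  apply: (@leq_trans (size (p :: iota 0 322))); last by rewrite -[size _]/(size (iota 0 322)).+1 size_iota.
  apply: uniq_leq_size; first by rewrite !filter_uniq ?iota_uniq.
  move=> q; rewrite mem_filter => /andP[h _]; have {h} : ~~ ((321 < q) && (q != p)) := h.
  rewrite negb_and -leqNgt negbK in_cons mem_iota leq0n add0n ltnS /=.
  by case/orP => ->; rewrite ?orbT.
have ch := chebyshev X; rewrite -/l in ch.
have l0 : 0 < l by [].
have Q0 : 0 < size Q.
  rewrite lt0n; apply/eqP => q0; rewrite q0 in sQ.
  have : X./2 <= l * 323 by apply: leq_trans ch _; rewrite leq_mul2l sQ orbT.
  by move: hg2 l0; clear; lia.
have hn16 : n <= ro.+1 ^ 16 by apply: ltnW.
have hdD : size (divisors D) <= X by apply: divX => //; rewrite -mulnn leq_pmulr.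
have hH : 64 * ro.+1 ^ 2 * X ^ 2 < H by rewrite /H /S ltnS -addnA leq_addr.
have [i [c [r [iH eD c0 sr [rn [Q' [uQ' subQ' sQ' hQ']]]]]]] :=
  choose_m s0 m00 hD uQ hQ Q0 hn16 hdD hH.
set m := m0 + s * i in eD.
have lt : m ^ 4 < D by apply: hD.
have mm : m = rho %[mod s] by rewrite /m mulnC addnC modnMDl.
have [mp r7] := hrho m c r mm eD lt c0.
have r0 := sqfree_gt0 sr.
have pm : ~~ (p %| m) by rewrite /dvdn mp modn_small ?prime_gt1.
have pP : p %| P by rewrite -{1}[p]expn1 dvdn_exp2l.
have pD : p %| D by rewrite eDn /d ed -mulnA dvdn_mulr.
have pm4 : ~~ (p %| m ^ 4) by rewrite Euclid_dvdX // andbT.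
have pcr : ~~ (p %| c ^ 2 * r) by move: pD; rewrite eD => h; apply: contra pm4 => h'; rewrite -(dvdn_addl _ h').
have pc : ~~ (p %| c) by apply: contra pcr => h; rewrite -mulnn -mulnA dvdn_mulr.
have pr : ~~ (p %| r) by apply: contra pcr => h; rewrite dvdn_mull.
have ccp : coprime c p by rewrite coprime_sym prime_coprime.
have hx : exists x, p %| x ^ 2 + r.
  have h : p %| (m ^ 2) ^ 2 + r * c ^ 2 by rewrite -expnM [r * _]mulnC -eD.
  by have [x [_ hx]] := root_quotient (prime_gt0 pp) c0 ccp h; exists x.
have pb : ~~ (p %| b).
  apply/negP => hb; have ha : p %| a.
    have : p %| a ^ 2 by rewrite -(dvdn_addl _ (n := b ^ 2)) ?dvdn_exp // ed dvdn_mulr.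
    by rewrite Euclid_dvdX // => /andP[].
  have : p %| gcdn a b by rewrite dvdn_gcd ha hb.
  by rewrite (eqP co) dvdn1 => /eqP p1; rewrite p1 in pp.
have pa : ~~ (p %| a).
  apply/negP => ha; have : p %| b ^ 2.
    by rewrite -(dvdn_addr _ (m := a ^ 2)) ?dvdn_exp // ed dvdn_mulr.
  by rewrite Euclid_dvdX // (negPf pb).
have he0 : exists x, p %| x ^ 2 + 1.
  have cb : coprime b p by rewrite coprime_sym prime_coprime.
  have h : p %| a ^ 2 + 1 * b ^ 2 by rewrite mul1n ed dvdn_mulr.
  by have [x [_ hx']] := root_quotient (prime_gt0 pp) b0 cb h; exists x.
have rD : r <= D by rewrite eD; apply: leq_trans (leq_addl _ _); rewrite leq_pmull // expn_gt0 c0.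
have rX : X ^ (224 * (p ^ k) ^ 2) <= r ^ 16 by rewrite -/P -eE; apply: leq_trans X1 rn.
have rX2 : r <= X ^ (2 * (224 * (p ^ k) ^ 2)).+1 by rewrite -/P -eE; apply: leq_trans rD DX.
have g0 : 0 < 679 * l by rewrite muln_gt0.
have gX : (679 * l * (224 * (p ^ k) ^ 2)) ^ (224 * (p ^ k) ^ 2) <= X.
  by move: hg1; rewrite -/P -eE mulnAC.
have hQ2 q : q \in Q' -> [/\ prime q, odd q, ~~ (q %| r), exists v, q %| v ^ 2 + r & q <= X].
  move=> qQ; have [h1 h2] := hQ' q qQ; have [pq q1 _ qX] := QP q (subQ' q qQ); split=> //.
  by case: (even_prime pq) => // q2; rewrite q2 in q1.
have XQ : X <= size Q' * (679 * l).
  have : X./2 <= l * (16 * size Q' + 323).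
    by apply: leq_trans ch _; rewrite leq_mul2l (leq_trans sQ) ?orbT // leq_add2r.
  have q'0 : 0 < size Q' by move: sQ' Q0; clear; lia.
  have h339 : l * (16 * size Q' + 323) <= 339 * (l * size Q').
    have -> : l * (16 * size Q' + 323) = 16 * (l * size Q') + 323 * l by ring.
    have : l <= l * size Q' by rewrite leq_pmulr.
    by move: (l * size Q') => z; clear; lia.
  have : 0 < l * size Q' by rewrite muln_gt0 l0.
  have -> : size Q' * (679 * l) = 679 * (l * size Q') by ring.
  by move: h339; move: (l * size Q') (l * (16 * size Q' + 323)) => z y; clear; lia.
have hDr M : 0 < M -> M <= r ^ 2 -> size (divisors M) <= X.
  by move=> M0 Mr; apply: divX => //; apply: leq_trans Mr _; rewrite leq_exp2r.
have [q [q0 nq q2 qP]] := good_rep pp po k0 sr r7 pr hx he0 rX rX2 b1 g0 gX hDr uQ' hQ2 XQ.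
have oP : odd P by rewrite /P oddX po orbT.
(* [p] divides none of 2, a, m, so it cannot divide both factors, and the one prime to [p]
   cancels. *)
have hs (x y : int) : (Posz P %| (x * y)%R)%Z -> (x + y)%R = (2 * Posz (a * m ^ 2))%R ->
    (Posz P %| x)%Z \/ (Posz P %| y)%Z.
  move=> h exy; case: (boolP (Posz p %| y)%Z) => py.
    right; have px : ~~ (Posz p %| x)%Z.
      apply/negP => px; have : (Posz p %| (2 * Posz (a * m ^ 2))%R)%Z by rewrite -exy rpredD.
      rewrite dvdzE abszM /= !Euclid_dvdM // (negPf pa) (negPf pm) /= ?orbF.
      by rewrite dvdn_prime2 // => /eqP p2; rewrite p2 in po.
    have cx : coprimez (Posz P) x by rewrite coprimezE /= coprimeXl // prime_coprime.
    by rewrite -(Gauss_dvdzr _ cx).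
  left; have cy : coprimez (Posz P) y by rewrite coprimezE /= coprimeXl // prime_coprime.
  by rewrite -(Gauss_dvdzl _ cy).
have [] := @finish a b n m c r P e (qi q) (qj q) (qk q) a0 b0 co ed oP he hs.
- by rewrite -eD eDn /d ed.
- by rewrite -nq /qnorm q0; ring.
- exact: q2.
- exact: qP.
- rewrite -/d; have -> : c ^ 2 * r = D - m ^ 4 by rewrite eD addnC addnK.
  apply: (@window d D v m); rewrite -?eT; [exact: d0 | exact: hv2 | | ].
    have le : T <= S.+2 by rewrite /S; clear; lia.
    by apply: leq_trans vS; apply: leq_trans le _; rewrite leq_pmull.
  by apply: leq_trans m1 _; rewrite leq_addr.
by move=> x [y [z [w h]]]; exists x, y, z, w, m.
Qed.
End MainTheorem.

Theorem theorem1p1 (a b C : nat) :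
  0 < a -> 0 < b -> coprime a b ->
  cyclic (units_Zp (a ^ 2 + b ^ 2)) ->
  3 <= C ->
  exists N : nat, forall n : nat, N <= n -> logn 2 n <= C ->
    exists x y z w : nat,
      x ^ 2 + y ^ 2 + z ^ 2 + w ^ 2 = n /\ is_square (a * x + b * y).
Proof.
move=> a0 b0 co cy _.
suff [N hN] : exists N, forall n, N <= n -> logn 2 n <= C ->
    exists x y z w m, x ^ 2 + y ^ 2 + z ^ 2 + w ^ 2 = n /\ a * x + b * y = m ^ 2.
  exists N => n n1 n2; have [x [y [z [w [m [e1 e2]]]]]] := hN n n1 n2.
  by exists x, y, z, w; split=> //; exists m.
case: (cyclic_sum_squares a0 b0 co cy) => [d2|[p [k [e [pp po k0 he ed]]]]].
  exact: conclusion_two.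
exact: conclusion_prime_power k0 he ed.
Qed.
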